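(* Let $W$ be a complex reflection group and $K$ a proper field for $W$. The algebra $\mathrm{Br}^K(W)$ is split semisimple, with dimension $$\dim_K\mathrm{Br}^K(W)=\sum_{B\in\mathcal C}\dim_K\bigl(KW/\mathrm{Ann}_{KW}(B)\bigr)=\sum_{B\in\mathcal C^K_{adm}}\dim_K\bigl(KW/\mathrm{Ann}_{KW}(B)\bigr).$$
   Context: All modules are finite dimensional over $K$. Complex reflection groups. A reflection of a finite dimensional complex vector space $V_W$ is an $r\in GL(V_W)$ such that $H_r:=\ker(r-1)$ has codimension $1$; $H_r$ is its reflecting hyperplane. A complex reflection group $W\subseteq GL(V_W)$ is a finite group generated by reflections. $\mathcal R$ is the set of reflections in $W$ and $\mathcal H$ the set of their reflecting hyperplanes. $W$ acts on $\mathcal H$ by $wH=w(H)$ and on $\mathcal R$ by conjugation; $\sim$ denotes conjugacy. $\mathcal R_{a\to b}$ is the set of $s\in\mathcal R$ with $sa=b$. Distinct $H_1,H_2\in\mathcal H$ are transverse, $H_1\pitchfork H_2$, if they are the only elements of $\mathcal H$ containing $H_1\cap H_2$; $H_1\not\pitchfork H_2$ means distinct and not transverse. A transverse collection is a (possibly empty) set of pairwise transverse elements of $\mathcal H$; $\mathcal C$ is the set of all of them, with the induced $W$-action. $\mathrm{Stab}(B)=\{w\in W: wB=B\}$. Brauer-Chen algebra. Let $\delta,\mu_s$ ($s\in\mathcal R$) be indeterminates, $\underline\mu=\{\mu_s\}$, and $\mathcal A=\mathbb Z[\underline\mu^{\pm1},\delta^{\pm1}]/(\mu_s-\mu_{s'}\mid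 s\sim s')$. $\mathrm{Br}(W)$ is the $\mathcal A$-algebra generated by the elements of $W$ (with the group relations) and elements $e_H$, $H\in\mathcal H$, with relations: (B1) $e_H^2=\delta e_H$; (B2) $we_Hw^{-1}=e_{wH}$; (B3) $we_H=e_H$ if $H\subseteq\ker(w-1)$; (B4) $e_{H_1}e_{H_2}=e_{H_2}e_{H_1}$ if $H_1\pitchfork H_2$; (B5) $e_{H_1}e_{H_2}=\sum_{s\in\mathcal R_{H_2\to H_1}}\mu_s s\,e_{H_2}$ if $H_1\not\pitchfork H_2$. For an $\mathcal A$-algebra $R$, $\mathrm{Br}^R(W)=R\otimes_{\mathcal A}\mathrm{Br}(W)$. For $B\in\mathcal C$, $e_B=\prod_{H\in B}e_H$ ($e_\emptyset=1$). Proper rings. A (commutative) $\mathcal A$-algebra $R$ is proper for $W$ if $R$ is a domain of characteristic $0$; $\mathrm{Frac}(R)$ has a subfield $k_R$ containing the images of $\underline\mu$ over which every subgroup of $W$ splits; $\delta$ is transcendental over $k_R$ and $\mathrm{Frac}(R)$ is a finite extension of $k_R(\delta)$. A proper field is a proper $R$ that is a field. Annihilators and admissibility. For $B\in\mathcal C$ let $\mathrm{Ann}_{KW}(e_B)=\{x\in KW: xe_B=0\text{ in }\mathrm{Br}^K(W)\}$. For $w\in W$ let $\pi_w:KW\to wK\mathrm{Stab}(B)$ be the projection $\pi_w(\sum_h\lambda_hh)=\sum_{h\in w\mathrm{Stab}(B)}\lambda_hh$. Then $\mathrm{Ann}_{KW}(B):=\sum_{w\in W}\pi_w(\mathrm{Ann}_{KW}(e_B))$,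 a left ideal of $KW$. For a $K\mathrm{Stab}(B)$-module $V$, the pair $(B,V)$ is admissible if $\mathrm{Ann}_{KW}(e_B)\cdot\hat V=0$, where $\hat V$ is the image of $V$ in $\mathrm{Ind}_{K\mathrm{Stab}(B)}^{KW}V$. $B$ is $K$-admissible if $(B,V)$ is admissible for some $V\ne0$; $\mathcal C^K_{adm}$ is the set of $K$-admissible $B\in\mathcal C$. *)

(* Defs.v *)
From HB Require Import structures.
From mathcomp Require Import all_boot all_order all_fingroup all_algebra.
From mathcomp Require Import mxrepresentation complex.
From mathcomp Require Import boolp reals generic_quotient.

Set Implicit Arguments.
Unset Strict Implicit.
Unset Printing Implicit Defensive.

Import GRing.Theory.
Local Open Scope ring_scope.

(* Noncommutative polynomial expressions over [R] in the generators [X]. *)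
Inductive pterm (R : comPzRingType) (X : Type) : Type :=
| PVar of X
| PCst of R
| PAdd of pterm R X & pterm R X
| PMul of pterm R X & pterm R X.

Arguments PVar {R X}.
Arguments PCst {R X}.

Declare Scope pterm_scope.
Delimit Scope pterm_scope with P.
Bind Scope pterm_scope with pterm.
Notation "t + u" := (PAdd t u) : pterm_scope.
Notation "t * u" := (PMul t u) : pterm_scope.

HB.instance Definition _ (R : comPzRingType) (X : Type) :=
  gen_eqMixin (pterm R X).
HB.instance Definition _ (R : comPzRingType) (X : Type) :=
  gen_choiceMixin (pterm R X).

(* The least congruence that contains [rel] and for which the quotient is an
   [R]-algebra; the opposite of [t] is [PCst (-1) * t]. *)
Inductive pcong (R : comPzRingType) (X : Type)
    (rel : pterm R X -> pterm R X -> Prop) : pterm R X -> pterm R X -> Prop :=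
| pc_rel t u : rel t u -> pcong rel t u
| pc_refl t : pcong rel t t
| pc_sym t u : pcong rel t u -> pcong rel u t
| pc_trans t u v : pcong rel t u -> pcong rel u v -> pcong rel t v
| pc_add t t' u u' :
    pcong rel t t' -> pcong rel u u' -> pcong rel (t + u)%P (t' + u')%P
| pc_mul t t' u u' :
    pcong rel t t' -> pcong rel u u' -> pcong rel (t * u)%P (t' * u')%P
| pc_addA t u v : pcong rel (t + (u + v))%P ((t + u) + v)%P
| pc_addC t u : pcong rel (t + u)%P (u + t)%P
| pc_add0 t : pcong rel (PCst 0 + t)%P t
| pc_addN t : pcong rel (PCst (-1) * t + t)%P (PCst 0)
| pc_mulA t u v : pcong rel (t * (u * v))%P ((t * u) * v)%P
| pc_mul1 t : pcong rel (PCst 1 * t)%P t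
| pc_mulDl t u v : pcong rel ((t + u) * v)%P (t * v + u * v)%P
| pc_mulDr t u v : pcong rel (t * (u + v))%P (t * u + t * v)%P
| pc_cstD a b : pcong rel (PCst (a + b)) (PCst a + PCst b)%P
| pc_cstM a b : pcong rel (PCst (a * b)) (PCst a * PCst b)%P
| pc_cstC a t : pcong rel (PCst a * t)%P (t * PCst a)%P.

Section PresentedAlgebra.
Variables (R : comPzRingType) (X : Type).
Variable rel : pterm R X -> pterm R X -> Prop.

Definition pcongb (t u : pterm R X) : bool := `[< pcong rel t u >].

Lemma pcongb_refl : reflexive pcongb.
Proof. by move=> t; apply/asboolP; exact: pc_refl. Qed.

Lemma pcongb_sym : symmetric pcongb.
Proof. by move=> t u; apply/asboolP/asboolP; exact: pc_sym. Qed.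

Lemma pcongb_trans : transitive pcongb.
Proof.
by move=> t u v /asboolP H1 /asboolP H2; apply/asboolP; exact: pc_trans H1 H2.
Qed.

Canonical pcongb_equiv := EquivRel pcongb pcongb_refl pcongb_sym pcongb_trans.

Definition presalg := {eq_quot pcongb_equiv}%qT.

HB.instance Definition _ := Choice.on presalg.

Definition pclass (t : pterm R X) : presalg := (\pi_presalg t)%qT.

Lemma pclassP t u : pclass t = pclass u <-> pcong rel t u.
Proof.
split=> [/eqP|H]; first by rewrite eqmodE => /asboolP.
by apply/eqP; rewrite eqmodE; apply/asboolP.
Qed.

Lemma pclass_surj (a : presalg) : exists t, a = pclass t.
Proof. by exists (repr a); rewrite /pclass reprK. Qed.

Definition pa_add (a b : presalg) := pclass (repr a + repr b)%P.
Definition pa_mul (a b : presalg) := pclass (repr a * repr b)%P.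
Definition pa_opp (a : presalg) := pclass (PCst (-1) * repr a)%P.

Lemma repr_pclass t : pcong rel (repr (pclass t)) t.
Proof. by apply/pclassP; rewrite /pclass reprK. Qed.

Lemma pa_addE t u : pa_add (pclass t) (pclass u) = pclass (t + u)%P.
Proof. by apply/pclassP; apply: pc_add; exact: repr_pclass. Qed.

Lemma pa_mulE t u : pa_mul (pclass t) (pclass u) = pclass (t * u)%P.
Proof. by apply/pclassP; apply: pc_mul; exact: repr_pclass. Qed.

Lemma pa_oppE t : pa_opp (pclass t) = pclass (PCst (-1) * t)%P.
Proof.
by apply/pclassP; apply: pc_mul; [exact: pc_refl | exact: repr_pclass].
Qed.

Lemma pa_addA : associative pa_add.
Proof.
move=> a b c; have [t ->] := pclass_surj a; have [u ->] := pclass_surj b.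
have [v ->] := pclass_surj c; rewrite !pa_addE; apply/pclassP; exact: pc_addA.
Qed.

Lemma pa_addC : commutative pa_add.
Proof.
move=> a b; have [t ->] := pclass_surj a; have [u ->] := pclass_surj b.
by rewrite !pa_addE; apply/pclassP; exact: pc_addC.
Qed.

Lemma pa_add0 : left_id (pclass (PCst 0)) pa_add.
Proof.
move=> a; have [t ->] := pclass_surj a; rewrite pa_addE.
by apply/pclassP; exact: pc_add0.
Qed.

Lemma pa_addN : left_inverse (pclass (PCst 0)) pa_opp pa_add.
Proof.
move=> a; have [t ->] := pclass_surj a; rewrite pa_oppE pa_addE.
by apply/pclassP; exact: pc_addN.
Qed.

HB.instance Definition _ :=
  GRing.isZmodule.Build presalg pa_addA pa_addC pa_add0 pa_addN.

Lemma pa_mulA : associative pa_mul.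
Proof.
move=> a b c; have [t ->] := pclass_surj a; have [u ->] := pclass_surj b.
have [v ->] := pclass_surj c; rewrite !pa_mulE; apply/pclassP; exact: pc_mulA.
Qed.

Lemma pa_mul1l : left_id (pclass (PCst 1)) pa_mul.
Proof.
move=> a; have [t ->] := pclass_surj a; rewrite pa_mulE.
by apply/pclassP; exact: pc_mul1.
Qed.

Lemma pa_mul1r : right_id (pclass (PCst 1)) pa_mul.
Proof.
move=> a; have [t ->] := pclass_surj a; rewrite pa_mulE; apply/pclassP.
exact: pc_trans (pc_sym (pc_cstC _ _ _)) (pc_mul1 _ _).
Qed.

Lemma pa_mulDl : left_distributive pa_mul +%R.
Proof.
move=> a b c; have [t ->] := pclass_surj a; have [u ->] := pclass_surj b.
have [v ->] := pclass_surj c; rewrite /GRing.add/= !(pa_mulE, pa_addE).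
by apply/pclassP; exact: pc_mulDl.
Qed.

Lemma pa_mulDr : right_distributive pa_mul +%R.
Proof.
move=> a b c; have [t ->] := pclass_surj a; have [u ->] := pclass_surj b.
have [v ->] := pclass_surj c; rewrite /GRing.add/= !(pa_mulE, pa_addE).
by apply/pclassP; exact: pc_mulDr.
Qed.

HB.instance Definition _ := GRing.Zmodule_isPzRing.Build presalg
  pa_mulA pa_mul1l pa_mul1r pa_mulDl pa_mulDr.

Lemma pclassD t u : pclass (t + u)%P = pclass t + pclass u.
Proof. by rewrite -pa_addE. Qed.

Lemma pclassM t u : pclass (t * u)%P = pclass t * pclass u.
Proof. by rewrite -pa_mulE. Qed.

Lemma pclass0 : pclass (PCst 0) = 0.
Proof. by []. Qed.

Lemma pclass1 : pclass (PCst 1) = 1.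
Proof. by []. Qed.

Definition pcst (a : R) : presalg := pclass (PCst a).
Definition pvar (x : X) : presalg := pclass (PVar x).

Lemma pcstD a b : pcst (a + b) = pcst a + pcst b.
Proof. by rewrite -pclassD; apply/pclassP; exact: pc_cstD. Qed.

Lemma pcstM a b : pcst (a * b) = pcst a * pcst b.
Proof. by rewrite -pclassM; apply/pclassP; exact: pc_cstM. Qed.

Lemma pcstC a b : pcst a * b = b * pcst a.
Proof.
have [t ->] := pclass_surj b.
by rewrite -!pclassM; apply/pclassP; exact: pc_cstC.
Qed.

Definition pa_scale (a : R) (b : presalg) := pcst a * b.

Lemma pa_scaleA a b c : pa_scale a (pa_scale b c) = pa_scale (a * b) c.
Proof. by rewrite /pa_scale pcstM mulrA. Qed.

Lemma pa_scale1 : left_id 1 pa_scale.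
Proof. by move=> a; rewrite /pa_scale /pcst pclass1 mul1r. Qed.

Lemma pa_scaleDr : right_distributive pa_scale +%R.
Proof. by move=> a b c; rewrite /pa_scale mulrDr. Qed.

Lemma pa_scaleDl b : {morph pa_scale^~ b : a a' / a + a'}.
Proof. by move=> a a'; rewrite /pa_scale pcstD mulrDl. Qed.

HB.instance Definition _ := GRing.Zmodule_isLmodule.Build R presalg
  pa_scaleA pa_scale1 pa_scaleDr pa_scaleDl.

Lemma pa_scaleE a (b : presalg) : a *: b = pcst a * b.
Proof. by []. Qed.

Lemma pa_scaleAl a (b c : presalg) : a *: (b * c) = (a *: b) * c.
Proof. by rewrite !pa_scaleE mulrA. Qed.

Lemma pa_scaleAr a (b c : presalg) : a *: (b * c) = b * (a *: c).
Proof. by rewrite !pa_scaleE mulrA pcstC -!mulrA pcstC. Qed.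

Lemma pclass_rel t u : rel t u -> pclass t = pclass u.
Proof. by move=> h; apply/pclassP; exact: pc_rel. Qed.

Section Eval.
Variables (S : pzRingType) (c : {rmorphism R -> S}) (g : X -> S).

Fixpoint peval (t : pterm R X) : S :=
  match t with
  | PVar x => g x
  | PCst a => c a
  | PAdd t u => peval t + peval u
  | PMul t u => peval t * peval u
  end.

Hypothesis cC : forall a x, c a * x = x * c a.
Hypothesis g_rel : forall t u, rel t u -> peval t = peval u.

Lemma peval_cong t u : pcong rel t u -> peval t = peval u.
Proof.
elim=> //=; do ?by move=> *; congruence.
- by move=> *; rewrite addrA.
- by move=> *; rewrite addrC.
- by move=> *; rewrite rmorph0 add0r.
- by move=> v; rewrite rmorphN rmorph1 rmorph0 mulN1r addNr.
- by move=> *; rewrite mulrA.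
- by move=> *; rewrite rmorph1 mul1r.
- by move=> *; rewrite mulrDl.
- by move=> *; rewrite mulrDr.
- by move=> *; rewrite rmorphD.
- by move=> *; rewrite rmorphM.
Qed.

Definition plift (a : presalg) : S := peval (repr a).

Lemma plift_class t : plift (pclass t) = peval t.
Proof. exact/peval_cong/repr_pclass. Qed.

Lemma plift_additive : {morph plift : a b / a + b}.
Proof.
move=> a b; have [t ->] := pclass_surj a; have [u ->] := pclass_surj b.
by rewrite -pclassD !plift_class.
Qed.

Lemma plift_multiplicative : {morph plift : a b / a * b}.
Proof.
move=> a b; have [t ->] := pclass_surj a; have [u ->] := pclass_surj b.
by rewrite -pclassM !plift_class.
Qed.

Lemma plift1 : plift 1 = 1.
Proof. by rewrite -pclass1 plift_class /= rmorph1. Qed.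

Lemma plift0 : plift 0 = 0.
Proof. by rewrite -pclass0 plift_class /= rmorph0. Qed.

End Eval.
End PresentedAlgebra.

Arguments pvar {R X} rel.

Definition semisimple_module (A : pzRingType) (V : lmodType A) : Prop :=
  forall S : {pred V}, GRing.submod_closed S ->
  exists T : {pred V},
    [/\ GRing.submod_closed T,
        forall v, v \in S -> v \in T -> v = 0
      & forall v, exists s t, [/\ s \in S, t \in T & v = s + t]].

Definition simple_module (A : pzRingType) (V : lmodType A) : Prop :=
  (exists v : V, v != 0) /\
  forall S : {pred V}, GRing.submod_closed S ->
    (exists2 v, v \in S & v != 0) -> forall v, v \in S.

Definition split_algebra (K : fieldType) (A : algType K) : Prop :=
  forall V : lmodType A, simple_module V ->
  forall f : {linear V -> V}, exists c : K, forall v, f v = c%:A *: v.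

Definition semisimple_algebra (K : fieldType) (A : algType K) : Prop :=
  semisimple_module (A^o : lmodType A).

Definition split_semisimple (K : fieldType) (A : algType K) : Prop :=
  split_algebra A /\ semisimple_algebra A.

Definition has_dim (K : fieldType) (V : lmodType K) (n : nat) : Prop :=
  inhabited (Vector.axiom n V).

(* [lker] requires a finite dimensional codomain; the Brauer-Chen algebra is not
   known to be finite dimensional beforehand. *)

Section Kernel.
Variables (K : fieldType) (V : vectType K) (U : lmodType K).
Variable f : {linear V -> U}.

Lemma kerv_exists :
  exists S : {vspace V}, forall v, (v \in S) = (f v == 0).
Proof.
pose P n := `[< exists2 S : {vspace V}, \dim S = n & forall v, v \in S -> f v = 0 >].
have exP : exists n, P n.
  exists 0%N; apply/asboolP; exists 0%VS; first exact: dimv0.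
  by move=> v; rewrite memv0 => /eqP->; rewrite linear0.
have ubP n : P n -> (n <= \dim {:V})%N.
  by move=> /asboolP[S <- _]; apply/dimvS/subvf.
case: (ex_maxnP exP ubP) => n /asboolP[S dS fS] maxn.
exists S => v; apply/idP/eqP => [/fS//|fv0].
have: P (\dim (S + <[v]>)%VS).
  apply/asboolP; exists (S + <[v]>)%VS => // x /memv_addP[s sS [t + ->]].
  by case/vlineP=> a ->; rewrite linearD linearZ fS //= fv0 scaler0 addr0.
move/maxn; rewrite -dS => le_dim.
have /eqP-> : S == (S + <[v]>)%VS by rewrite eqEdim addvSl.
by apply: (subvP (addvSr _ _)); exact: memv_line.
Qed.

Definition kerv : {vspace V} := sval (cid kerv_exists).

Lemma memv_kerv v : (v \in kerv) = (f v == 0).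
Proof. by rewrite /kerv; case: cid. Qed.

End Kernel.

(* [R (x)_A B] as an [R]-algebra: it is spanned by the pure tensors
   [PVar (a, b)], which are biadditive, [A]-balanced and multiply factorwise. *)
Inductive tensor_rel (A : comPzRingType) (R : comPzRingType)
    (phi : {rmorphism A -> R}) (B : algType A) :
    pterm R (R * B) -> pterm R (R * B) -> Prop :=
| tensor_addl a a' b :
    tensor_rel phi (PVar (a + a', b)) (PVar (a, b) + PVar (a', b))%P
| tensor_addr a b b' :
    tensor_rel phi (PVar (a, b + b')) (PVar (a, b) + PVar (a, b'))%P
| tensor_balanced a r b :
    tensor_rel phi (PVar (a * phi r, b)) (PVar (a, r *: b))
| tensor_scale c a b :
    tensor_rel phi (PVar (c * a, b)) (PCst c * PVar (a, b))%P
| tensor_one : tensor_rel phi (PVar (1, 1)) (PCst 1)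
| tensor_mul a b a' b' :
    tensor_rel phi (PVar (a, b) * PVar (a', b'))%P (PVar (a * a', b * b')).

Definition is_reflection (F : fieldType) (V : vectType F) (r : 'End(V)) : bool :=
  (\dim (lker (r - \1)%VF)).+1 == \dim {:V}.

(* [crg_act] embeds the finite group [crg_group] in GL(V): it takes values in
   invertible maps because it is multiplicative and sends 1 to the identity. *)
Record complexReflectionGroup (R : realType) := ComplexReflectionGroup {
  crg_space : vectType R[i];
  crg_group :> finGroupType;
  crg_act : crg_group -> 'End(crg_space);
  crg_act1 : crg_act 1%g = \1%VF;
  crg_actM : forall g h, crg_act (g * h)%g = (crg_act g \o crg_act h)%VF;
  crg_act_inj : injective crg_act;
  crg_gen :
    <<[set r | is_reflection (crg_act r)]>>%g = [set: crg_group]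
}.

Section Reflections.
Variables (R : realType) (W : complexReflectionGroup R).
Local Notation rho := (@crg_act R W).

Definition reflections : {set W} := [set r | is_reflection (rho r)].
Definition refl := {r : W | r \in reflections}.

Definition fix_space (w : W) : {vspace crg_space W} := lker (rho w - \1)%VF.

Definition hyps : seq {vspace crg_space W} :=
  [seq fix_space r | r <- enum reflections].
Definition hyp := seq_sub hyps.

Lemma crg_lker0 w : lker (rho w) == 0%VS.
Proof.
apply/lker0P => u v /(congr1 (rho w^-1%g)).
by rewrite -!comp_lfunE -!crg_actM mulVg crg_act1 !id_lfunE.
Qed.

Lemma mem_fix_space w v : (v \in fix_space w) = (rho w v == v).
Proof. by rewrite memv_ker add_lfunE opp_lfunE id_lfunE subr_eq0. Qed.

Lemma crg_actMv g h v : rho (g * h)%g v = rho g (rho h v).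
Proof. by rewrite crg_actM comp_lfunE. Qed.

Lemma fix_space_conj w r :
  fix_space (w * r * w^-1)%g = (rho w @: fix_space r)%VS.
Proof.
apply/vspaceP => v; rewrite mem_fix_space; apply/eqP/memv_imgP => [E|[u]].
  exists (rho w^-1%g v); last by rewrite -crg_actMv mulgV crg_act1 id_lfunE.
  by rewrite mem_fix_space -{2}E -!crg_actMv -!mulgA mulKg.
by rewrite mem_fix_space => /eqP E ->; rewrite -crg_actMv mulgKV crg_actMv E.
Qed.

Lemma reflections_conj w r :
  r \in reflections -> (w * r * w^-1)%g \in reflections.
Proof.
rewrite !inE /is_reflection -!/(fix_space _) fix_space_conj => /eqP <-.
rewrite limg_dim_eq //.
by apply/eqP; rewrite -subv0 (eqP (crg_lker0 w)) capvSr.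
Qed.

Lemma hyps_act w H : H \in hyps -> (rho w @: H)%VS \in hyps.
Proof.
case/mapP => r; rewrite mem_enum => rR ->; rewrite -fix_space_conj.
by apply: map_f; rewrite mem_enum reflections_conj.
Qed.

Definition hact (w : W) (H : hyp) : hyp := SeqSub (hyps_act w (ssvalP H)).

Definition transverse (H1 H2 : hyp) : bool :=
  (H1 != H2) &&
  [forall H : hyp, (ssval H1 :&: ssval H2 <= ssval H)%VS ==>
                   (H == H1) || (H == H2)].

Definition nontransverse (H1 H2 : hyp) : bool :=
  (H1 != H2) && ~~ transverse H1 H2.

Definition transverse_collections : {set {set hyp}} :=
  [set B : {set hyp} | [forall H1 in B, forall H2 in B,
     (H1 != H2) ==> transverse H1 H2]].

Lemma hact1 H : hact 1%g H = H.
Proof. by apply: val_inj; rewrite /= crg_act1 lim1g. Qed.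

Lemma hactM g h H : hact (g * h)%g H = hact g (hact h H).
Proof. by apply: val_inj; rewrite /= crg_actM limg_comp. Qed.

Definition stab (B : {set hyp}) : {set W} := [set w | hact w @: B == B].

Lemma stab_group_set B : group_set (stab B).
Proof.
apply/group_setP; split => [|g h].
  by rewrite inE (eq_imset _ hact1) imset_id.
rewrite !inE => /eqP gB /eqP hB; rewrite (eq_imset _ (hactM g h)).
by rewrite (imset_comp (hact g) (hact h)) hB gB.
Qed.
Canonical stab_group B := Group (stab_group_set B).

Inductive param := Delta | DeltaInv | Mu of refl | MuInv of refl.

Inductive param_rel : pterm int param -> pterm int param -> Prop :=
| param_comm x y : param_rel (PVar x * PVar y)%P (PVar y * PVar x)%P
| param_delta : param_rel (PVar Delta * PVar DeltaInv)%P (PCst 1)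
| param_mu s : param_rel (PVar (Mu s) * PVar (MuInv s))%P (PCst 1)
| param_conj s s' (g : W) :
    val s' = (g * val s * g^-1)%g -> param_rel (PVar (Mu s)) (PVar (Mu s')).

(* The generic ring Z[mu^+-1, delta^+-1] / (mu_s - mu_s' | s ~ s'). *)
Definition paramRing : Type := presalg param_rel.
HB.instance Definition _ := GRing.PzRing.on paramRing.

Lemma paramRing_comm : commutative (@GRing.mul paramRing).
Proof.
suff H t u : pclass param_rel (t * u)%P = pclass param_rel (u * t)%P.
  move=> a b; have [t ->] := pclass_surj a; have [u ->] := pclass_surj b.
  by have := H t u; rewrite !pclassM.
rewrite !pclassM; elim: t u => [x|a|t1 IH1 t2 IH2|t1 IH1 t2 IH2] u.
- elim: u => [y|b|u1 IH1 u2 IH2|u1 IH1 u2 IH2].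
  + by rewrite -!pclassM; apply: pclass_rel; exact: param_comm.
  + by rewrite -[pclass _ (PCst b)]/(pcst _ b) pcstC.
  + by rewrite pclassD mulrDl mulrDr IH1 IH2.
  + by rewrite pclassM mulrA IH1 -mulrA IH2 mulrA.
- by rewrite -[pclass _ (PCst a)]/(pcst _ a) pcstC.
- by rewrite pclassD mulrDl mulrDr IH1 IH2.
- by rewrite pclassM -mulrA IH2 mulrA IH1 mulrA.
Qed.
HB.instance Definition _ :=
  GRing.PzRing_hasCommutativeMul.Build paramRing paramRing_comm.

Lemma paramRing_neq0 : (1 : paramRing) != 0.
Proof.
have H t u : param_rel t u ->
    peval (idfun : {rmorphism int -> int}) (fun=> 1) t =
    peval (idfun : {rmorphism int -> int}) (fun=> 1) u by case.
apply/eqP => /(congr1 (plift (idfun : {rmorphism int -> int}) (fun=> 1))).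
by rewrite plift1 ?plift0 //; move=> a x; rewrite mulrC.
Qed.
HB.instance Definition _ :=
  GRing.PzSemiRing_isNonZero.Build paramRing paramRing_neq0.

Definition delta : paramRing := pvar param_rel Delta.
Definition mu (s : refl) : paramRing := pvar param_rel (Mu s).

Local Notation tw := (fun w : W => PVar (inl w) : pterm paramRing (W + hyp)).
Local Notation te := (fun H : hyp => PVar (inr H) : pterm paramRing (W + hyp)).

Inductive brauer_rel :
    pterm paramRing (W + hyp) -> pterm paramRing (W + hyp) -> Prop :=
| brauer_one : brauer_rel (tw 1%g) (PCst 1)
| brauer_mul g h : brauer_rel (tw (g * h)%g) (tw g * tw h)%P
| brauer_B1 H : brauer_rel (te H * te H)%P (PCst delta * te H)%P
| brauer_B2 w H : brauer_rel (tw w * te H * tw w^-1%g)%P (te (hact w H))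
| brauer_B3 w H : (ssval H <= fix_space w)%VS ->
    brauer_rel (tw w * te H)%P (te H)
| brauer_B4 H1 H2 : transverse H1 H2 ->
    brauer_rel (te H1 * te H2)%P (te H2 * te H1)%P
| brauer_B5 H1 H2 : nontransverse H1 H2 ->
    brauer_rel (te H1 * te H2)%P
      (\big[@PAdd _ _/PCst 0]_(s : refl | hact (val s) H2 == H1)
         (PCst (mu s) * tw (val s) * te H2)%P).

Definition brauer : Type := presalg brauer_rel.
HB.instance Definition _ := GRing.PzRing.on brauer.
HB.instance Definition _ := GRing.Lmodule.on brauer.

(* [algType] requires [1 != 0]; it follows from the augmentation [w |-> 1],
   [e_H |-> 0]. *)
Definition brauer_aug_gen (x : W + hyp) : paramRing :=
  match x with inl _ => 1 | inr _ => 0 end.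

Lemma brauer_aug_rel t u : brauer_rel t u ->
  peval (idfun : {rmorphism paramRing -> paramRing}) brauer_aug_gen t =
  peval (idfun : {rmorphism paramRing -> paramRing}) brauer_aug_gen u.
Proof.
case=> //=; do ?by move=> *; rewrite ?(mulr0, mul0r, mulr1).
move=> H1 H2 _; rewrite mulr0; elim/big_ind: _ => //= [x y <- <-|s _].
  by rewrite addr0.
by rewrite mulr0.
Qed.

Definition brauer_aug : brauer -> paramRing :=
  plift (idfun : {rmorphism paramRing -> paramRing}) brauer_aug_gen.

Lemma brauer_aug1 : brauer_aug 1 = 1.
Proof. by apply: plift1; [move=> a x; rewrite mulrC|exact: brauer_aug_rel]. Qed.

Lemma brauer_neq0 : (1 : brauer) != 0.
Proof.
apply/eqP => /(congr1 brauer_aug); rewrite brauer_aug1 /brauer_aug plift0.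
- by move/eqP; rewrite oner_eq0.
- by move=> a x; rewrite mulrC.
- exact: brauer_aug_rel.
Qed.
HB.instance Definition _ := GRing.PzSemiRing_isNonZero.Build brauer brauer_neq0.
HB.instance Definition _ := GRing.Lmodule_isLalgebra.Build paramRing brauer
  (@pa_scaleAl _ _ brauer_rel).
HB.instance Definition _ := GRing.Lalgebra_isAlgebra.Build paramRing brauer
  (@pa_scaleAr _ _ brauer_rel).

End Reflections.

Section ExtendedBrauer.
Variables (R : realType) (W : complexReflectionGroup R).
Variables (S : comNzRingType) (phi : {rmorphism paramRing W -> S}).

Definition brauer_ext : Type := presalg (@tensor_rel _ S phi (brauer W)).
HB.instance Definition _ := GRing.PzRing.on brauer_ext.
HB.instance Definition _ := GRing.Lmodule.on brauer_ext.

Lemma brauer_ext_aug_rel t u : tensor_rel phi t u ->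
  let g (x : S * brauer W) := x.1 * phi (brauer_aug x.2) in
  peval (idfun : {rmorphism S -> S}) g t =
  peval (idfun : {rmorphism S -> S}) g u.
Proof.
have idC (a x : paramRing W) : a * x = x * a by rewrite mulrC.
case=> //= *.
- by rewrite mulrDl.
- rewrite /brauer_aug plift_additive; [|exact: idC|exact: brauer_aug_rel].
  by rewrite rmorphD mulrDr.
- rewrite pa_scaleE /brauer_aug plift_multiplicative;
    [|exact: idC|exact: brauer_aug_rel].
  rewrite plift_class; [|exact: idC|exact: brauer_aug_rel].
  by rewrite rmorphM mulrA.
- by rewrite mulrA.
- by rewrite brauer_aug1 rmorph1 mulr1.
- rewrite /brauer_aug plift_multiplicative; [|exact: idC|exact: brauer_aug_rel].
  by rewrite rmorphM mulrACA.
Qed.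

Lemma brauer_ext_neq0 : (1 : brauer_ext) != 0.
Proof.
pose g (x : S * brauer W) := x.1 * phi (brauer_aug x.2).
apply/eqP => /(congr1 (plift (idfun : {rmorphism S -> S}) g)).
rewrite plift1 ?plift0; do ?by [move=> a x; rewrite mulrC | exact: brauer_ext_aug_rel].
by move/eqP; rewrite oner_eq0.
Qed.
HB.instance Definition _ :=
  GRing.PzSemiRing_isNonZero.Build brauer_ext brauer_ext_neq0.
HB.instance Definition _ := GRing.Lmodule_isLalgebra.Build S brauer_ext
  (@pa_scaleAl _ _ (@tensor_rel _ S phi (brauer W))).
HB.instance Definition _ := GRing.Lalgebra_isAlgebra.Build S brauer_ext
  (@pa_scaleAr _ _ (@tensor_rel _ S phi (brauer W))).

Definition pure_tensor (a : S) (b : brauer W) : brauer_ext :=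
  pvar (@tensor_rel _ S phi (brauer W)) (a, b).

Definition brauer_w (w : W) : brauer_ext :=
  pure_tensor 1 (pvar (@brauer_rel R W) (inl w)).
Definition brauer_e (H : hyp W) : brauer_ext :=
  pure_tensor 1 (pvar (@brauer_rel R W) (inr H)).

(* The factors commute when [B] is a transverse collection. *)
Definition brauer_eB (B : {set hyp W}) : brauer_ext :=
  \prod_(H in B) brauer_e H.

End ExtendedBrauer.

Section ProperField.
Variables (k K : fieldType) (iota : {rmorphism k -> K}) (d : K).

(* [x] lies in the subfield [k(d)] of [K]. *)
Definition in_adjoin (x : K) : Prop :=
  exists p q : {poly k},
    (map_poly iota q).[d] != 0 /\
    x = (map_poly iota p).[d] / (map_poly iota q).[d].

Definition finite_over_adjoin : Prop :=
  exists (n : nat) (b : 'I_n -> K), forall x : K, exists c : 'I_n -> K,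
    (forall i, in_adjoin (c i)) /\ x = \sum_(i < n) c i * b i.
End ProperField.

(* Here [Frac(K) = K]; the subfield is given by an embedding [iota]. *)
Definition proper_field (R : realType) (W : complexReflectionGroup R)
    (K : fieldType) (phi : {rmorphism paramRing W -> K}) : Prop :=
  [pchar K] =i pred0 /\
  exists (k : fieldType) (iota : {rmorphism k -> K}),
    [/\ forall s : refl W, exists a : k, phi (mu s) = iota a,
        group_closure_field k W,
        ~ algebraicOver iota (phi (delta W))
      & finite_over_adjoin iota (phi (delta W))].

(* The group algebra of [W] is the space [{ffun W -> K^o}], and
   [{ffun W -> 'cV[K]_n}] is its tensor product over [K] with ['cV[K]_n]; the
   function supported at [g] with value [v] is [g (x) v]. A left module over the
   group algebra of [H] is a representation [rV] of [H] acting on columns. *)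
Section Induction.
Variables (K : fieldType) (W : finGroupType).

Definition group_alg := {ffun W -> K^o}.

Definition pure_ind (n : nat) (g : W) (v : 'cV[K]_n) : {ffun W -> 'cV[K]_n} :=
  [ffun u => if u == g then v else 0].

Definition group_alg_act (n : nat) (x : group_alg) (z : {ffun W -> 'cV[K]_n}) :
    {ffun W -> 'cV[K]_n} :=
  [ffun u => \sum_(g : W) (x g : K) *: z (g^-1 * u)%g].

(* The induced module is the quotient of [{ffun W -> 'cV[K]_n}] by the subspace
   generated by the [gh (x) v - g (x) hv] for [h] in [H]. *)
Definition ind_rel (H : {group W}) (n : nat) (rV : mx_representation K H n) :
    {vspace {ffun W -> 'cV[K]_n}} :=
  (\sum_(g : W) \sum_(h in H)
     limg (linfun (fun v : 'cV[K]_n =>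
                     pure_ind (g * h)%g v - pure_ind g (rV h *m v))))%VS.

End Induction.

Arguments group_alg : clear implicits.

Section Annihilators.
Variables (R : realType) (W : complexReflectionGroup R).
Variables (K : fieldType) (phi : {rmorphism paramRing W -> K}).
Implicit Type B : {set hyp W}.

Definition mul_eB B (x : group_alg K W) : brauer_ext phi :=
  (\sum_(w : W) (x w : K) *: brauer_w phi w) * brauer_eB phi B.

Lemma mul_eB_linear B : linear (mul_eB B).
Proof.
move=> a x y; rewrite /mul_eB scalerAl -mulrDl scaler_sumr -big_split /=.
by congr (_ * _); apply: eq_bigr => w _; rewrite !ffunE scalerDl scalerA.
Qed.
HB.instance Definition _ B := GRing.isLinear.Build K (group_alg K W)
  (brauer_ext phi) _ (mul_eB B) (mul_eB_linear B).

Definition ann_eB B : {vspace group_alg K W} := kerv (mul_eB B).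

Definition coset_proj B (w : W) (x : group_alg K W) : group_alg K W :=
  [ffun h => if h \in (w *: stab B)%g then x h else 0].

Lemma coset_proj_linear B w : linear (coset_proj B w).
Proof.
move=> a x y; apply/ffunP => h; rewrite !ffunE.
by case: ifP => // _; rewrite scaler0 addr0.
Qed.
HB.instance Definition _ B w := GRing.isLinear.Build K (group_alg K W)
  (group_alg K W) _ (coset_proj B w) (coset_proj_linear B w).

Definition ann B : {vspace group_alg K W} :=
  (\sum_(w : W) (linfun (coset_proj B w) @: ann_eB B))%VS.

(* The dimension of the quotient of the group algebra by [ann B]. *)
Definition dim_quot_ann B : nat := (\dim {:group_alg K W} - \dim (ann B))%N.

Definition admissible_pair B (n : nat)
    (rV : mx_representation K (stab_group B) n) : Prop :=
  forall (x : group_alg K W) (v : 'cV[K]_n), x \in ann_eB B ->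
    group_alg_act x (pure_ind 1%g v) \in ind_rel rV.

Definition admissible B : Prop :=
  exists (n : nat) (rV : mx_representation K (stab_group B) n),
    (0 < n)%N /\ admissible_pair rV.

Definition admissible_collections : {set {set hyp W}} :=
  [set B in transverse_collections W | `[< admissible B >]].

End Annihilators.

(* Main.v *)
(** Let I_n be the ideal of Br spanned by the w e_B with |B| >= n. Modulo I_{n+1},
    multiplying by the sum of the delta^-n e_C, |C| = n, is on I_n a matrix of
    polynomials in 1/delta which is the identity at 1/delta = 0; since delta is
    transcendental over a field containing the mu_s, it is invertible. Hence each
    I_n has a two-sided unit, a central idempotent of Br, and the x in KW with
    x e_B in I_{n+1} form a space graded by the cosets of Stab(B), so containing
    Ann(B). It is no larger: KW/Ann(B) carries an action of Br under which the
    e_H, H in B, act by delta on the class of 1 and I_{n+1} acts by 0. So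
    I_n/I_{n+1} is the direct sum of the KW/Ann(B) with |B| = n.

    If V is simple and n is maximal with I_n V <> 0, some e_B V with |B| = n is a
    nonzero simple module over K Stab(B), hence absolutely simple, and an
    endomorphism of V is determined by its scalar action there. A complement of a
    left ideal S is assembled from the corners p_B f Br, with p_B = delta^-n e_B
    and f the central idempotent of the layer of B, by means of a projection onto S
    averaged over W. Finally, if Ann(B) <> KW then the image of K Stab(B) in
    KW/Ann(B) is a module making B admissible. *)

Require Import Defs.
From HB Require Import structures.
From mathcomp Require Import all_boot all_order all_fingroup all_algebra.
From mathcomp Require Import mxrepresentation complex.
From mathcomp Require Import boolp reals generic_quotient.

Set Implicit Arguments.
Unset Strict Implicit.
Unset Printing Implicit Defensive.

Import GRing.Theory.
Local Open Scope ring_scope.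

(** * Transverse hyperplanes *)

(** The delicate point is that the operators on [KW/Ann(B)] satisfy (B4). Relation (B5) prescribes
    [e_H g] through a choice of [X] in [gB]. Different choices agree modulo [Ann(B)], so they can be
    averaged, and the averages for all [H] are compressions of one operator, whose entry at a
    reflection [h g^-1] is weighted by the inverse of the size of [hB - gB]. With this weight
    [sum_H e_H] and [sum_s mu_s s] differ by a block-diagonal operator commuting with every [e_H].
    By (B5) the commutators of [e_H] with non-transverse [e_X] cancel against the reflections, so
    those with transverse [e_X] have sum zero. Cut by cosets, this says that a two-step term indexed
    by a hyperplane equals its own average, so it does not depend on the hyperplane and each
    commutator vanishes.

    The geometric input is that when a reflection changes a transverse collection, each hyperplane
    that leaves is non-transverse to each one that enters.

    Finite dimension of [Br] is a conclusion, so ideals are predicates, and inversion takes place in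
    coordinates, on functions on a finite set. *)

Section TransverseGeometry.
Variables (R : realType) (W : complexReflectionGroup R).
Local Notation rho := (@crg_act R W).
Local Notation V := (crg_space W).
Implicit Types (s w g : W) (H X Y : hyp W) (B C : {set hyp W}).

Lemma hactK w : cancel (hact w) (hact w^-1%g).
Proof. by move=> H; rewrite -hactM mulVg hact1. Qed.

Lemma hactKV w : cancel (hact w^-1%g) (hact w).
Proof. by move=> H; rewrite -hactM mulgV hact1. Qed.

Lemma hact_inj w : injective (hact w).
Proof. exact: can_inj (hactK w). Qed.

Lemma hyp_reflection H :
  exists2 t, t \in reflections W & ssval H = fix_space t.
Proof. by case/mapP: (ssvalP H) => t; rewrite mem_enum; exists t. Qed.

Definition mirror s (sR : s \in reflections W) : hyp W :=
  SeqSub (map_f (@fix_space R W) (etrans (mem_enum _ s) sR)).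

Lemma mem_hact w H v : (v \in ssval (hact w H)) = (rho w^-1%g v \in ssval H).
Proof.
apply/memv_imgP/idP => [[u uH ->]|vH].
  by rewrite -crg_actMv mulVg crg_act1 id_lfunE.
by exists (rho w^-1%g v); rewrite // -crg_actMv mulgV crg_act1 id_lfunE.
Qed.

Lemma dim_hyp H : (\dim (ssval H)).+1 = \dim {:V}.
Proof. by have [t] := hyp_reflection H; rewrite inE => /eqP <- ->. Qed.

Lemma hyp_subP H X : (ssval H <= ssval X)%VS -> H = X.
Proof.
move=> sHX; apply: val_inj; apply/eqP; rewrite eqEdim sHX /=.
by rewrite -ltnS !dim_hyp.
Qed.

(** By rank-nullity the image of [rho s - 1] is a line; [a] spans it and is called a root of [s]
    below. *)
Lemma reflection_root s : s \in reflections W ->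
  exists2 a, a != 0 & forall v, rho s v - v \in <[a]>%VS.
Proof.
rewrite inE /is_reflection => /eqP ds.
have := limg_ker_dim (rho s - \1)%VF fullv; rewrite capfv -ds.
move/eqP; rewrite -addn1 eqn_add2l => /eqP d1.
pose L := ((rho s - \1)%VF @: fullv)%VS.
have Lpick : vpick L != 0 by rewrite vpick0 -dimv_eq0 d1.
exists (vpick L) => // v.
have /eqP -> : (<[vpick L]> == L)%VS.
  by rewrite eqEdim -memvE memv_pick /= d1 dim_vline Lpick.
have -> : rho s v - v = (rho s - \1)%VF v by rewrite add_lfunE opp_lfunE id_lfunE.
exact/memv_img/memvf.
Qed.

Lemma hact_root s a X : (forall v, rho s v - v \in <[a]>%VS) ->
  a \in ssval X -> hact s X = X.
Proof.
move=> sa aX; apply/esym/hyp_subP/subvP => v vX; rewrite mem_hact.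
have /vlineP[c E] := sa (rho s^-1%g v).
move: E; rewrite -crg_actMv mulgV crg_act1 id_lfunE => E.
have -> : rho s^-1%g v = v - c *: a by rewrite -E subKr.
by rewrite rpredB // rpredZ.
Qed.

Lemma mem_root s a X v : (forall v, rho s v - v \in <[a]>%VS) ->
  v \in ssval X -> rho s v \in ssval X -> rho s v != v -> a \in ssval X.
Proof.
move=> sa vX svX sv; have /vlineP[c E] := sa v.
have c0 : c != 0.
  by apply: contraNneq sv => c0; rewrite -subr_eq0 E c0 scale0r.
have -> : a = c^-1 *: (rho s v - v) by rewrite E scalerA mulVf // scale1r.
by rewrite rpredZ // rpredB.
Qed.

Lemma hact_mirror s (sR : s \in reflections W) : hact s (mirror sR) = mirror sR.
Proof.
apply/hyp_subP/subvP => v; rewrite mem_hact /= !mem_fix_space -crg_actMv mulgV.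
by rewrite crg_act1 id_lfunE => /eqP E; rewrite {1}E -crg_actMv mulgV crg_act1 id_lfunE.
Qed.

Lemma transverse_sym H X : transverse H X = transverse X H.
Proof.
suff h Y Z : transverse Y Z -> transverse Z Y by apply/idP/idP; exact: h.
case/andP=> nYZ /forallP tr; apply/andP; split; first by rewrite eq_sym.
by apply/forallP => T; rewrite capvC orbC; exact: tr.
Qed.

Lemma transverse_neq H X : transverse H X -> H != X.
Proof. by case/andP. Qed.

Lemma transverseP H X Y : transverse H X ->
  (ssval H :&: ssval X <= ssval Y)%VS -> Y = H \/ Y = X.
Proof.
case/andP=> _ /forallP/(_ Y)/implyP h /h /orP[]/eqP; by [left|right].
Qed.

Lemma transverse_act w H X : transverse (hact w H) (hact w X) = transverse H X.
Proof.
suff h u Y Z : transverse Y Z -> transverse (hact u Y) (hact u Z).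
  by apply/idP/idP => [/(h w^-1%g)|/(h w)]; rewrite ?hactK.
move=> trYZ; have [nYZ _] := andP trYZ; rewrite /transverse (inj_eq (@hact_inj u)) nYZ.
apply/forallP => T; apply/implyP => sT.
have [|E|E] := @transverseP _ _ (hact u^-1%g T) trYZ.
- apply/subvP => v; rewrite memv_cap => /andP[vY vZ]; rewrite mem_hact invgK.
  apply: (subvP sT); rewrite memv_cap !mem_hact -!crg_actMv mulVg crg_act1.
  by rewrite !id_lfunE vY.
- by rewrite -E hactKV eqxx.
- by rewrite -E hactKV eqxx orbT.
Qed.

Lemma nontransverse_act w H X :
  nontransverse (hact w H) (hact w X) = nontransverse H X.
Proof. by rewrite /nontransverse transverse_act (inj_eq (@hact_inj w)). Qed.

Lemma nontransverse_sym H X : nontransverse H X = nontransverse X H.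
Proof. by rewrite /nontransverse eq_sym transverse_sym. Qed.

Lemma nontransverse_neq H X : nontransverse H X -> H != X.
Proof. by case/andP. Qed.

Lemma nontransverseN H X : nontransverse H X -> ~~ transverse H X.
Proof. by case/andP. Qed.

(** The mirror of [s] contains the intersection of [X] and [sX]: if [s] moved a vector of it, the
    root of [s] would lie in [X], and [s] would preserve [X]. Being fixed by [s], the mirror is
    neither [X] nor [sX]. *)
Lemma reflection_nontransverse s X : s \in reflections W ->
  hact s X != X -> nontransverse X (hact s X).
Proof.
move=> sR sX; rewrite /nontransverse eq_sym sX /=; apply/negP => tr.
have [a _ sa] := reflection_root sR.
have [|E|E] := @transverseP _ _ (mirror sR) tr.
- apply/subvP => v; rewrite memv_cap => /andP[vX]; rewrite mem_hact => v'X.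
  rewrite /= mem_fix_space; apply/negPn/negP => sv; case/negP: sX; apply/eqP.
  have svv' : rho s (rho s^-1%g v) = v by rewrite -crg_actMv mulgV crg_act1 id_lfunE.
  apply: (hact_root sa); apply: (mem_root sa v'X); rewrite svv' //.
  by apply: contra sv => /eqP E; rewrite {1}E svv'.
- by case/negP: sX; rewrite -E hact_mirror.
- by case/negP: sX; apply/eqP/(@hact_inj s); rewrite -E hact_mirror.
Qed.

Lemma transverse_mirror t X (tR : t \in reflections W) :
  transverse X (mirror tR) -> hact t X = X.
Proof.
move=> tr; have [|//|E] := @transverseP _ _ (hact t X) tr.
- apply/subvP => v; rewrite memv_cap /= -/(ssval (hact t X)) mem_hact.
  rewrite mem_fix_space => /andP[vX /eqP E].
  by rewrite -{1}E -crg_actMv mulVg crg_act1 id_lfunE.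
- by move: (transverse_neq tr); rewrite -(inj_eq (@hact_inj t)) E hact_mirror eqxx.
Qed.

(** [t] preserves [X] but moves some vector of it, since [X] is not the mirror; the displacement is
    a nonzero multiple of the root. *)
Lemma transverse_root t a X (tR : t \in reflections W) :
  (forall v, rho t v - v \in <[a]>%VS) -> transverse X (mirror tR) ->
  a \in ssval X.
Proof.
move=> ta tr; have tX := transverse_mirror tr.
have : ~~ (ssval X <= ssval (mirror tR))%VS.
  by apply: contra (transverse_neq tr) => /hyp_subP ->.
case/subvPn => v vX; rewrite /= mem_fix_space => tv.
apply: (mem_root ta vX _ tv).
by rewrite -tX mem_hact -crg_actMv mulVg crg_act1 id_lfunE.
Qed.

(* Two conjugate reflections with the same root line differ by a unipotent
   element of finite order, hence are equal. *)
Lemma reflection_eq_root s t a : a != 0 ->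
  (forall v, rho t v - v \in <[a]>%VS) -> rho s a = a ->
  (s * t * s^-1 = t)%g.
Proof.
move=> a0 ta sa; have s'a : rho s^-1%g a = a.
  by rewrite -{1}sa -crg_actMv mulVg crg_act1 id_lfunE.
have t'a v : rho (s * t * s^-1)%g v - v \in <[a]>%VS.
  rewrite !crg_actMv; set u := rho s^-1%g v.
  have -> : v = rho s u by rewrite /u -crg_actMv mulgV crg_act1 id_lfunE.
  by rewrite -linearB; have /vlineP[c ->] := ta u; rewrite linearZ /= sa rpredZ ?memv_line.
(* [t] and [s t s^-1] have the same eigenvalue [c] on [a], because [s] fixes [a]. Hence [u] fixes
   [a] and translates every vector along [a], so that [u^j v = v + j d a]; finite order and
   characteristic 0 force [d = 0]. *)
pose u := (t^-1 * (s * t * s^-1))%g.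
have [c tac] : exists c, rho t a = c *: a.
  have /vlineP[c E] := ta a; exists (c + 1).
  by rewrite scalerDl scale1r -E subrK.
have c0 : c != 0.
  apply: contraNneq a0 => c0; move: tac; rewrite c0 scale0r.
  move/(congr1 (rho t^-1%g)); rewrite -crg_actMv mulVg crg_act1 id_lfunE => ->.
  by rewrite linear0.
have t'a1 : rho t^-1%g a = c^-1 *: a.
  have := congr1 (rho t^-1%g) tac.
  rewrite -crg_actMv mulVg crg_act1 id_lfunE linearZ /= => {2}->.
  by rewrite scalerA mulVf // scale1r.
have ua : rho u a = a.
  by rewrite /u !crg_actMv s'a tac linearZ /= sa linearZ /= t'a1 scalerA mulfV ?scale1r.
have uv v : exists d, rho u v = v + d *: a.
  have /vlineP[d Ed] := t'a v.
  have /vlineP[e Ee] := ta (rho t^-1%g v).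
  move: Ee; rewrite -crg_actMv mulgV crg_act1 id_lfunE => Ee.
  exists (d / c - e); rewrite /u crg_actMv -[rho (s * t * s^-1)%g v](subrK v) Ed.
  rewrite linearD linearZ /= t'a1 scalerA scalerBl -Ee opprB addrCA.
  by congr (_ + _); rewrite addrC subrK.
have uj v d j : rho u v = v + d *: a -> rho (u ^+ j)%g v = v + (j%:R * d) *: a.
  move=> E; elim: j => [|j IH]; first by rewrite expg0 crg_act1 id_lfunE mul0r scale0r addr0.
  by rewrite expgS crg_actMv IH linearD linearZ /= ua E -addrA -scalerDl -nat1r mulrDl mul1r.
have u1 : u = 1%g.
  apply: crg_act_inj; apply/lfunP => v; rewrite crg_act1 id_lfunE.
  have [d E] := uv v; have := uj v d #[u]%g E.
  rewrite expg_order crg_act1 id_lfunE => /eqP.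
  rewrite -{1}[v]addr0 (inj_eq (addrI v)) eq_sym scaler_eq0 (negbTE a0) orbF.
  rewrite mulf_eq0 Num.Theory.pnatr_eq0 -[_ == 0%N]negbK -lt0n order_gt0 /= => /eqP d0.
  by rewrite E d0 scale0r addr0.
by move/eqP: u1; rewrite -(inj_eq (mulgI t)) mulgA mulgV mul1g mulg1 => /eqP.
Qed.

(** If [b] is a root of the reflection with mirror [X], then [s b] is one for the mirror [sX], and
    transversality puts both in [Y]. Their difference is a multiple of the root of [s]. It is
    nonzero, since otherwise the two reflections would coincide and so would their mirrors. So the
    root of [s] lies in [Y]. *)
Lemma reflection_fix_transverse s X Y : s \in reflections W ->
  hact s X != X -> transverse Y X -> transverse Y (hact s X) -> hact s Y = Y.
Proof.
move=> sR sX trX trsX; have [a a0 sa] := reflection_root sR.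
have [t tR Ht] := hyp_reflection X; have [b b0 tb] := reflection_root tR.
have XE : X = mirror tR by apply: val_inj.
pose t' := (s * t * s^-1)%g; have t'R : t' \in reflections W by apply: reflections_conj.
have sXE : hact s X = mirror t'R by apply: val_inj; rewrite /= Ht fix_space_conj.
have t'b v : rho t' v - v \in <[rho s b]>%VS.
  rewrite /t' !crg_actMv; set u := rho s^-1%g v.
  have -> : v = rho s u by rewrite /u -crg_actMv mulgV crg_act1 id_lfunE.
  by rewrite -linearB; have /vlineP[c ->] := tb u; rewrite linearZ /= rpredZ ?memv_line.
have bY : b \in ssval Y by move: trX; rewrite XE; exact: transverse_root.
have sbY : rho s b \in ssval Y by move: trsX; rewrite sXE; exact: transverse_root.
apply: (hact_root sa); apply: (mem_root sa bY sbY).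
apply: contraNneq sX => sb; have E := reflection_eq_root b0 tb sb.
by rewrite sXE XE; apply/eqP/val_inj; rewrite /= /t' E.
Qed.

Lemma transverse_collectionP B : reflect
  {in B &, forall H X, H != X -> transverse H X} (B \in transverse_collections W).
Proof.
rewrite inE; apply: (iffP forall_inP) => [h H X HB XB nHX|h H HB].
  by have /forall_inP/(_ X XB)/implyP := h H HB; apply.
by apply/forall_inP => X XB; apply/implyP; exact: h.
Qed.

Lemma transverse_collection_act w B :
  (hact w @: B \in transverse_collections W) = (B \in transverse_collections W).
Proof.
suff h u C : C \in transverse_collections W -> hact u @: C \in transverse_collections W.
  apply/idP/idP => [/(h w^-1%g)|]; last exact: h.
  by rewrite -imset_comp (eq_imset (g := id)) ?imset_id //; exact: hactK.
move/transverse_collectionP => h; apply/transverse_collectionP.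
move=> _ _ /imsetP[H HC ->] /imsetP[X XC ->]; rewrite (inj_eq (@hact_inj u)).
by rewrite transverse_act; exact: h.
Qed.

(** Write [Y = sX']. If [X' = X], this is the case of a single moved hyperplane. Otherwise [X] is
    transverse to [X'], and were it also transverse to [sX'], it would be fixed by [s] and could not
    leave the collection. *)
Lemma reflection_collection_nontransverse s B X Y :
  B \in transverse_collections W -> s \in reflections W ->
  X \in B -> X \notin hact s @: B -> Y \in hact s @: B -> Y \notin B ->
  nontransverse X Y.
Proof.
move=> /transverse_collectionP tcB sR XB XsB /imsetP[X' X'B ->] YB.
have [E|nX] := eqVneq X' X.
  rewrite E; apply: reflection_nontransverse => //.
  by apply: contraNneq YB; rewrite E => ->.
rewrite /nontransverse (contraNneq _ YB) => [|<- //]; apply/negP => tr.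
case/imsetP: XsB; exists X => //; apply/esym.
have sX' : hact s X' != X' by apply: contraNneq YB => ->.
have trX : transverse X X' by apply: tcB; rewrite // eq_sym.
exact: reflection_fix_transverse sR sX' trX tr.
Qed.

End TransverseGeometry.

(** * The presentation *)

Section Presentation.
Variables (R : realType) (W : complexReflectionGroup R).
Variables (K : fieldType) (phi : {rmorphism paramRing W -> K}).
Local Notation A := (brauer_ext phi).
Local Notation ww := (@brauer_w R W K phi).
Local Notation ee := (@brauer_e R W K phi).
Implicit Types (w g s : W) (H X : hyp W).

(** Extended by zero to [W], so that sums over reflections can be reindexed by translations and
    conjugations of the whole group. *)
Definition refl_coef w : K :=
  if insub w is Some s then phi (mu (s : refl W)) else 0.

Lemma refl_coef_val (s : refl W) : refl_coef (val s) = phi (mu s).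
Proof. by rewrite /refl_coef valK. Qed.

Lemma refl_coef0 w : w \notin reflections W -> refl_coef w = 0.
Proof. by move=> wR; rewrite /refl_coef insubN. Qed.

Lemma refl_coef_neq0 w : refl_coef w != 0 -> w \in reflections W.
Proof. by apply: contraNT => /refl_coef0 ->. Qed.

Lemma refl_coefJ g w : refl_coef (g * w * g^-1)%g = refl_coef w.
Proof.
have [wR|wR] := boolP (w \in reflections W).
  have gwR := reflections_conj g wR.
  pose s : refl W := exist _ w wR.
  pose t : refl W := exist (fun r => r \in reflections W) (g * w * g^-1)%g gwR.
  rewrite -[w]/(val s) -[(g * val s * g^-1)%g]/(val t) !refl_coef_val.
  by congr (phi _); apply/esym/pclass_rel/(@param_conj _ _ s t g).
rewrite !refl_coef0 //; apply: contra wR => /(reflections_conj g^-1%g).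
by rewrite invgK !mulgA mulVg mul1g mulgKV.
Qed.

Definition brauer_in (b : brauer W) : A := pure_tensor phi 1 b.
Local Notation jj := brauer_in.

Lemma brauer_inD b c : jj (b + c) = jj b + jj c.
Proof. by rewrite -pclassD; apply: pclass_rel; exact: tensor_addr. Qed.

Lemma brauer_inM b c : jj (b * c) = jj b * jj c.
Proof.
rewrite -pclassM; apply/esym.
rewrite /brauer_in /pure_tensor /pvar -[X in PVar (X, b * c)](mulr1 1).
by apply: pclass_rel; exact: tensor_mul.
Qed.

Lemma brauer_in1 : jj 1 = 1.
Proof. by apply: pclass_rel; exact: tensor_one. Qed.

Lemma pure_tensorE (a : K) b : pure_tensor phi a b = a *: jj b.
Proof.
rewrite pa_scaleE /pcst -pclassM -[in LHS](mulr1 a); apply: pclass_rel.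
exact: tensor_scale.
Qed.

Lemma brauer_inZ r b : jj (r *: b) = phi r *: jj b.
Proof.
rewrite -pure_tensorE -[phi r]mul1r; apply/esym/pclass_rel.
exact: tensor_balanced.
Qed.

Lemma brauer_in_cst r : jj (pclass (@brauer_rel R W) (PCst r)) = phi r *: 1.
Proof. by rewrite -brauer_in1 -brauer_inZ pa_scaleE mulr1. Qed.

Lemma brauer_in_rel t u : brauer_rel t u ->
  jj (pclass (@brauer_rel R W) t) = jj (pclass (@brauer_rel R W) u).
Proof. by move/pclass_rel->. Qed.

Lemma brauer_w1 : ww 1%g = 1.
Proof. by rewrite -brauer_in1; exact: (brauer_in_rel (brauer_one W)). Qed.

Lemma brauer_wM g w : ww (g * w)%g = ww g * ww w.
Proof.
by rewrite -brauer_inM -pclassM; exact: (brauer_in_rel (brauer_mul g w)).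
Qed.

Lemma brauer_eM H : ee H * ee H = phi (delta W) *: ee H.
Proof.
have := brauer_in_rel (brauer_B1 H).
by rewrite !pclassM !brauer_inM brauer_in_cst -scalerAl mul1r.
Qed.

Lemma brauer_conj w H : ww w * ee H = ee (hact w H) * ww w.
Proof.
have <- : ww w * ee H * ww w^-1%g = ee (hact w H).
  by have := brauer_in_rel (brauer_B2 w H); rewrite !pclassM !brauer_inM.
by rewrite -!mulrA -brauer_wM mulVg brauer_w1 mulr1.
Qed.

Lemma brauer_fix w H : (ssval H <= fix_space w)%VS -> ww w * ee H = ee H.
Proof.
by move=> h; have := brauer_in_rel (brauer_B3 h); rewrite !pclassM !brauer_inM.
Qed.

Lemma brauer_comm H X : transverse H X -> ee H * ee X = ee X * ee H.
Proof.
by move=> h; have := brauer_in_rel (brauer_B4 h); rewrite !pclassM !brauer_inM.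
Qed.

Lemma sum_refl (U : nmodType) (P : pred W) (F : W -> U) :
  (forall w, w \notin reflections W -> F w = 0) ->
  \sum_(s : refl W | P (val s)) F (val s) = \sum_(w | P w) F w.
Proof.
move=> F0; rewrite [RHS](bigID (mem (reflections W))) /=.
rewrite [X in _ + X]big1 ?addr0 => [|w /andP[_ /F0]//].
rewrite (reindex_omap (val : refl W -> W) insub) => [|w /andP[_ wR]]; last first.
  by rewrite insubT.
by apply: eq_bigl => s; rewrite valK eqxx andbT (valP s) andbT.
Qed.

Lemma brauer_nontransverse H X : nontransverse H X ->
  ee H * ee X = \sum_(w | hact w X == H) refl_coef w *: (ww w * ee X).
Proof.
move=> h; have := brauer_in_rel (brauer_B5 h); rewrite pclassM brauer_inM => ->.
rewrite -(sum_refl (fun w => hact w X == H)); last first.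
  by move=> w /refl_coef0 ->; rewrite scale0r.
elim/big_rec2: _ => [|s a t _ <-]; first by rewrite brauer_in_cst rmorph0 scale0r.
rewrite pclassD brauer_inD; congr (_ + _).
by rewrite !pclassM !brauer_inM brauer_in_cst refl_coef_val -mulrA -scalerAl mul1r.
Qed.

(** Closure under left multiplication by generators suffices because words are peeled from the left:
    what is proved by induction on a term [t] is that [P a] implies [P (t a)], for the terms of
    [Br(W)] and then for those of the tensor product. *)
Lemma brauer_ext_ind (P : A -> Prop) :
    P 1 -> (forall a b, P a -> P b -> P (a + b)) ->
    (forall c a, P a -> P (c *: a)) -> (forall w a, P a -> P (ww w * a)) ->
    (forall H a, P a -> P (ee H * a)) ->
  forall a, P a.
Proof.
move=> P1 PD PZ Pw Pe.
have Pj t a : P a -> P (jj (pclass (@brauer_rel R W) t) * a).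
  elim: t a => [[w|H]|r|t IHt u IHu|t IHt u IHu] a Pa.
  - exact: Pw.
  - exact: Pe.
  - by rewrite brauer_in_cst -scalerAl mul1r; exact: PZ.
  - by rewrite pclassD brauer_inD mulrDl; apply: PD; [exact: IHt|exact: IHu].
  - by rewrite pclassM brauer_inM -mulrA; apply/IHt/IHu.
suff Pt t a : P a -> P (pclass (@tensor_rel _ _ phi (brauer W)) t * a).
  by move=> a; have [t ->] := pclass_surj a; rewrite -[pclass _ t]mulr1; exact: Pt.
elim: t a => [[c b]|c|t IHt u IHu|t IHt u IHu] a Pa.
- rewrite -[pclass _ _]/(pure_tensor phi c b) pure_tensorE.
  rewrite -[X in P X](@scalerAl K A c (jj b) a); apply: PZ.
  by have [t ->] := pclass_surj b; exact: Pj.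
- by rewrite -[pclass _ _ * a]/(c *: a); exact: PZ.
- by rewrite pclassD mulrDl; apply: PD; [exact: IHt|exact: IHu].
- by rewrite pclassM -mulrA; apply/IHt/IHu.
Qed.

Section Universal.
Variables (S : pzRingType) (c : {rmorphism K -> S}).
Variables (gw : W -> S) (ge : hyp W -> S).
Hypothesis cC : forall a x, c a * x = x * c a.
Hypothesis gw1 : gw 1%g = 1.
Hypothesis gwM : forall g w, gw (g * w)%g = gw g * gw w.
Hypothesis geM : forall H, ge H * ge H = c (phi (delta W)) * ge H.
Hypothesis gconj : forall w H, gw w * ge H = ge (hact w H) * gw w.
Hypothesis gfix : forall w H, (ssval H <= fix_space w)%VS -> gw w * ge H = ge H.
Hypothesis gcomm : forall H X, transverse H X -> ge H * ge X = ge X * ge H.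
Hypothesis gnontr : forall H X, nontransverse H X ->
  ge H * ge X = \sum_(w | hact w X == H) c (refl_coef w) * (gw w * ge X).

(** Two nested lifts, through the presentation of [Br(W)] and through that of the tensor product.
    Scalars enter by a central ring morphism, so that the target need only be a ring. *)
Lemma brauer_ext_rep : exists rho : A -> S,
  [/\ {morph rho : a b / a + b}, {morph rho : a b / a * b} & rho 1 = 1] /\
  [/\ forall a x, rho (a *: x) = c a * rho x,
      forall w, rho (ww w) = gw w & forall H, rho (ee H) = ge H].
Proof.
pose g x := match x with inl w => gw w | inr H => ge H end.
pose cp : {rmorphism paramRing W -> S} := c \o phi.
have cpC a x : cp a * x = x * cp a by apply: cC.
have g_rel t u : brauer_rel t u -> peval cp g t = peval cp g u.
  case=> //= [|w H|H X /gnontr ->]; rewrite ?rmorph1 //.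
    by rewrite gconj -mulrA -gwM mulgV gw1 mulr1.
  rewrite -(sum_refl (fun w => hact w X == H)
     (F := fun w => c (refl_coef w) * (gw w * ge X))); last first.
    by move=> w /refl_coef0 ->; rewrite rmorph0 mul0r.
  elim/big_rec2: _ => [|s a v _ ->] /=; first by rewrite !rmorph0.
  by rewrite refl_coef_val !mulrA.
pose r0 : brauer W -> S := plift cp g.
have r0D := plift_additive cpC g_rel; have r0M := plift_multiplicative cpC g_rel.
have r0Z r b : r0 (r *: b) = c (phi r) * r0 b.
  by rewrite pa_scaleE [LHS]r0M [X in X * _](plift_class cpC g_rel).
have r01 := plift1 cpC g_rel.
pose g' (x : K * brauer W) := c x.1 * r0 x.2.
have g'_rel t u : @tensor_rel _ _ phi (brauer W) t u -> peval c g' t = peval c g' u.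
  case=> [a a' b|a b b'|a r b|d a b||a b a' b'] /=; rewrite /g' /=.
  - by rewrite rmorphD mulrDl.
  - by rewrite [r0 _]r0D mulrDr.
  - by rewrite r0Z rmorphM mulrA.
  - by rewrite rmorphM mulrA.
  - by rewrite [r0 1]r01 rmorph1 mulr1.
  - by rewrite [r0 (_ * _)]r0M rmorphM -!mulrA; congr (_ * _); rewrite !mulrA cC.
pose rho : A -> S := plift c g'.
have rhoD := plift_additive cC g'_rel; have rhoM := plift_multiplicative cC g'_rel.
exists rho; split; [split=> [//|//|] | split=> [a x|w|H]].
- exact: (plift1 cC g'_rel).
- by rewrite pa_scaleE [LHS]rhoM [X in X * _](plift_class cC g'_rel).
- rewrite [LHS](plift_class cC g'_rel) /= /g' /= rmorph1 mul1r.
  exact: (plift_class cpC g_rel).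
- rewrite [LHS](plift_class cC g'_rel) /= /g' /= rmorph1 mul1r.
  exact: (plift_class cpC g_rel).
Qed.

End Universal.
End Presentation.

(** * The filtration by collections *)

Lemma prod_comm_perm (T : eqType) (S : pzRingType) (F : T -> S) (s t : seq T) :
  perm_eq s t -> {in s &, forall x y, F x * F y = F y * F x} ->
  \prod_(x <- s) F x = \prod_(x <- t) F x.
Proof.
elim: s t => [|x s IH] t st cs; first by move: st; rewrite perm_sym => /perm_nilP ->.
have xt : x \in t by rewrite -(perm_mem st) mem_head.
case/splitPr: xt st => t1 t2; rewrite -(cat1s x t2) perm_sym perm_catCA /= perm_cons perm_sym => st.
rewrite big_cons (IH _ st) => [|y z ys zs]; last by apply: cs; rewrite inE ?ys ?zs orbT.
rewrite !big_cat big_cons /= !mulrA; congr (_ * _).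
rewrite big_seq; elim/big_ind: _ => [|a b ca cb|y yt]; first by rewrite mulr1 mul1r.
  by rewrite mulrA ca -!mulrA cb.
by apply: cs; rewrite !inE ?eqxx // (perm_mem st) mem_cat yt orbT.
Qed.

Definition ga_delta (K : fieldType) (W : finGroupType) (w : W) : group_alg K W :=
  [ffun g => (g == w)%:R].

Lemma ga_deltaE (K : fieldType) (W : finGroupType) (w g : W) :
  ga_delta K w g = (g == w)%:R.
Proof. by rewrite ffunE. Qed.

Section Elements.
Variable T : finType.
Implicit Type B : {set T}.

Definition elems B := [seq x <- index_enum T | x \in B].

Lemma mem_elems B : elems B =i B.
Proof. by move=> x; rewrite mem_filter mem_index_enum andbT. Qed.

Lemma elems_uniq B : uniq (elems B).
Proof. exact/filter_uniq/index_enum_uniq. Qed.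

Lemma size_elems B : size (elems B) = #|B|.
Proof. by rewrite -(card_uniqP (elems_uniq B)); apply/eq_card/mem_elems. Qed.

Lemma all_elems B (P : pred T) : all P (elems B) = (B \subset P).
Proof.
apply/allP/subsetP => h x; first by rewrite -mem_elems; exact: h.
by rewrite mem_elems; exact: h.
Qed.

End Elements.

Section Filtration.
Variables (R : realType) (W : complexReflectionGroup R).
Variables (K : fieldType) (phi : {rmorphism paramRing W -> K}).
Local Notation A := (brauer_ext phi).
Local Notation ww := (@brauer_w R W K phi).
Local Notation ee := (@brauer_e R W K phi).
Local Notation EB := (@brauer_eB R W K phi).
Local Notation del := (phi (delta W)).
Local Notation mm := (@refl_coef R W K phi).
Local Notation tc := (transverse_collections W).
Implicit Types (w g s : W) (H X Y : hyp W) (B C : {set hyp W}).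

Lemma prod_brauer_perm (s t : seq (hyp W)) : perm_eq s t ->
  {in s &, forall H X, H != X -> transverse H X} ->
  \prod_(x <- s) ee x = \prod_(x <- t) ee x.
Proof.
move=> st trs; apply: prod_comm_perm => // x y xs ys.
by have [->|] := eqVneq x y; last by move/(trs _ _ xs ys)/brauer_comm ->.
Qed.

Lemma brauer_eB_elems B : EB B = \prod_(x <- elems B) ee x.
Proof. by rewrite big_filter. Qed.

Lemma brauer_eB_seq B (s : seq (hyp W)) : B \in tc -> uniq s -> s =i B ->
  EB B = \prod_(x <- s) ee x.
Proof.
move=> /transverse_collectionP tcB us sB; rewrite brauer_eB_elems.
apply: prod_brauer_perm => [|x y]; last by rewrite !mem_elems; exact: tcB.
by apply: uniq_perm; rewrite ?elems_uniq // => x; rewrite mem_elems sB.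
Qed.

Lemma transverse_collectionS B C : C \subset B -> B \in tc -> C \in tc.
Proof.
move=> /subsetP sCB /transverse_collectionP tcB; apply/transverse_collectionP.
by move=> H X /sCB HB /sCB XB; exact: tcB.
Qed.

Lemma transverse_collectionU1 H B : B \in tc -> {in B, forall X, transverse H X} ->
  H |: B \in tc.
Proof.
move=> /transverse_collectionP tcB trH; apply/transverse_collectionP => X Y.
case/setU1P=> [->|XB] /setU1P[->|YB]; rewrite ?eqxx //.
- by move=> _; exact: trH.
- by move=> _; rewrite transverse_sym; exact: trH.
- exact: tcB.
Qed.

Lemma transverse_collection0 : set0 \in tc.
Proof. by apply/transverse_collectionP => H X; rewrite inE. Qed.

Lemma hyp_trichotomy H B : H \notin B -> {in B, forall X, transverse H X} \/
  exists2 X, X \in B & nontransverse H X.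
Proof.
move=> HB; have [/forall_inP h|] := boolP [forall X in B, transverse H X].
  by left.
rewrite negb_forall_in => /exists_inP[X XB ntr]; right; exists X => //.
by rewrite /nontransverse ntr andbT; apply: contraNneq HB => ->.
Qed.

Lemma brauer_eBU1 H B : H \notin B -> H |: B \in tc -> EB (H |: B) = ee H * EB B.
Proof.
move=> HB tcHB; have tcB : B \in tc by exact: transverse_collectionS (subsetU1 H B) tcHB.
rewrite (@brauer_eB_seq _ (H :: elems B)) //=; first by rewrite big_cons brauer_eB_elems.
- by rewrite mem_elems HB elems_uniq.
- by move=> X; rewrite !inE mem_elems.
Qed.

Lemma brauer_eBU1r H B : H \notin B -> H |: B \in tc -> EB (H |: B) = EB B * ee H.
Proof.
move=> HB tcHB; have tcB : B \in tc by exact: transverse_collectionS (subsetU1 H B) tcHB.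
rewrite (@brauer_eB_seq _ (rcons (elems B) H)) //=.
- by rewrite -cats1 big_cat big_seq1 brauer_eB_elems.
- by rewrite rcons_uniq mem_elems HB elems_uniq.
- by move=> X; rewrite mem_rcons !inE mem_elems.
Qed.

Lemma brauer_eBD1 H B : H \in B -> B \in tc -> EB B = ee H * EB (B :\ H).
Proof. by move=> HB tcB; rewrite -{1}(setD1K HB) brauer_eBU1 ?setD11 ?setD1K. Qed.

Lemma brauer_eBD1r H B : H \in B -> B \in tc -> EB B = EB (B :\ H) * ee H.
Proof. by move=> HB tcB; rewrite -{1}(setD1K HB) brauer_eBU1r ?setD11 ?setD1K. Qed.

Lemma brauer_e_eB_in H B : H \in B -> B \in tc -> ee H * EB B = del *: EB B.
Proof.
by move=> HB tcB; rewrite (brauer_eBD1 HB tcB) mulrA brauer_eM -scalerAl.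
Qed.

Lemma brauer_eB_e_in H B : H \in B -> B \in tc -> EB B * ee H = del *: EB B.
Proof.
by move=> HB tcB; rewrite (brauer_eBD1r HB tcB) -mulrA brauer_eM -scalerAr.
Qed.

Lemma brauer_e_eB_nontransverse H X B : X \in B -> B \in tc -> nontransverse H X ->
  ee H * EB B = \sum_(w | hact w X == H) mm w *: (ww w * EB B).
Proof.
move=> XB tcB ntr; rewrite (brauer_eBD1 XB tcB) mulrA brauer_nontransverse // mulr_suml.
by apply: eq_bigr => w _; rewrite -scalerAl mulrA.
Qed.

(** When [w H = X], the factor [w e_H] produced by (B5) equals [e_X w], which restores the missing
    factor of [EB B]. *)
Lemma brauer_eB_e_nontransverse H X B : X \in B -> B \in tc -> nontransverse X H ->
  EB B * ee H = \sum_(w | hact w H == X) mm w *: (EB B * ww w).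
Proof.
move=> XB tcB ntr; rewrite (brauer_eBD1r XB tcB) -mulrA brauer_nontransverse // mulr_sumr.
by apply: eq_bigr => w /eqP <-; rewrite -scalerAr -mulrA brauer_conj.
Qed.

Lemma brauer_w_eB w B : B \in tc -> ww w * EB B = EB (hact w @: B) * ww w.
Proof.
move=> tcB; rewrite (@brauer_eB_seq (hact w @: B) (map (hact w) (elems B))).
- rewrite brauer_eB_elems big_map /=.
  elim: (elems B) => [|x s IH]; first by rewrite !big_nil mulr1 mul1r.
  by rewrite !big_cons mulrA brauer_conj -!mulrA IH.
- by rewrite transverse_collection_act.
- by rewrite map_inj_uniq ?elems_uniq //; exact: hact_inj.
- move=> X; apply/mapP/imsetP => -[Y]; rewrite ?mem_elems => YB ->; exists Y => //.
  by rewrite mem_elems.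
Qed.

Lemma brauer_eB_w w B : B \in tc -> EB B * ww w = ww w * EB (hact w^-1%g @: B).
Proof.
move=> tcB; rewrite brauer_w_eB ?transverse_collection_act // -imset_comp.
by rewrite (eq_imset (g := id)) ?imset_id //; exact: hactKV.
Qed.

Lemma brauer_fix_eB w H B : H \in B -> B \in tc -> (ssval H <= fix_space w)%VS ->
  ww w * EB B = EB B.
Proof. by move=> HB tcB h; rewrite (brauer_eBD1 HB tcB) mulrA brauer_fix. Qed.

(** A predicate of linear combinations rather than a subspace, since [A] is not yet known to be
    finite dimensional. *)
Inductive brauer_ideal (n : nat) : A -> Prop :=
| BrauerIdeal0 : brauer_ideal n 0
| BrauerIdealS c w B a of B \in tc & (n <= #|B|)%N & brauer_ideal n a :
    brauer_ideal n (c *: (ww w * EB B) + a).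

Local Notation inI := brauer_ideal.

Lemma brauer_idealD n a b : inI n a -> inI n b -> inI n (a + b).
Proof.
move=> Ia Ib; elim: Ia => [|c w B {}a tcB nB _ IH]; first by rewrite add0r.
by rewrite -addrA; exact: BrauerIdealS.
Qed.

Lemma brauer_idealZ n c a : inI n a -> inI n (c *: a).
Proof.
elim=> [|d w B {}a tcB nB _ IH]; first by rewrite scaler0; exact: BrauerIdeal0.
by rewrite scalerDr scalerA; exact: BrauerIdealS.
Qed.

Lemma brauer_idealB n a b : inI n a -> inI n b -> inI n (a - b).
Proof. by move=> Ia Ib; apply: brauer_idealD; rewrite // -scaleN1r; exact: brauer_idealZ. Qed.

Lemma brauer_ideal_sum n I (r : seq I) (P : pred I) (F : I -> A) :
  (forall i, P i -> inI n (F i)) -> inI n (\sum_(i <- r | P i) F i).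
Proof.
by move=> h; elim/big_ind: _ => //; [exact: BrauerIdeal0|exact: brauer_idealD].
Qed.

Lemma brauer_ideal_base n w B : B \in tc -> (n <= #|B|)%N -> inI n (ww w * EB B).
Proof.
move=> tcB nB; have := BrauerIdealS 1 w tcB nB (BrauerIdeal0 n).
by rewrite scale1r addr0.
Qed.

Lemma brauer_ideal_eB n B : B \in tc -> (n <= #|B|)%N -> inI n (EB B).
Proof. by move=> tcB nB; rewrite -[EB B]mul1r -brauer_w1; exact: brauer_ideal_base. Qed.

Lemma brauer_ideal_leq n k a : (k <= n)%N -> inI n a -> inI k a.
Proof.
move=> kn; elim=> [|c w B {}a tcB nB _ IH]; first exact: BrauerIdeal0.
by apply: BrauerIdealS => //; exact: leq_trans nB.
Qed.

Lemma brauer_ideal_w n w a : inI n a -> inI n (ww w * a).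
Proof.
elim=> [|c g B {}a tcB nB _ IH]; first by rewrite mulr0; exact: BrauerIdeal0.
by rewrite mulrDr -scalerAr mulrA -brauer_wM; exact: BrauerIdealS.
Qed.

Lemma brauer_ideal_e_eB n H B : B \in tc -> (n <= #|B|)%N -> inI n (ee H * EB B).
Proof.
move=> tcB nB; have [HB|HB] := boolP (H \in B).
  by rewrite brauer_e_eB_in //; exact/brauer_idealZ/brauer_ideal_eB.
have [tr|[X XB ntr]] := hyp_trichotomy HB.
  have tcHB := transverse_collectionU1 tcB tr.
  rewrite -brauer_eBU1 //; apply: brauer_ideal_eB => //.
  by rewrite cardsU1 HB; exact: leq_trans nB (leqnSn _).
rewrite (brauer_e_eB_nontransverse XB) //; apply: brauer_ideal_sum => w _.
by apply: brauer_idealZ; exact: brauer_ideal_base.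
Qed.

Lemma brauer_ideal_eB_e n H B : B \in tc -> (n <= #|B|)%N -> inI n (EB B * ee H).
Proof.
move=> tcB nB; have [HB|HB] := boolP (H \in B).
  by rewrite brauer_eB_e_in //; exact/brauer_idealZ/brauer_ideal_eB.
have [tr|[X XB]] := hyp_trichotomy HB.
  have tcHB := transverse_collectionU1 tcB tr.
  rewrite -brauer_eBU1r //; apply: brauer_ideal_eB => //.
  by rewrite cardsU1 HB; exact: leq_trans nB (leqnSn _).
rewrite nontransverse_sym => ntr.
rewrite (brauer_eB_e_nontransverse XB) //; apply: brauer_ideal_sum => w _.
apply: brauer_idealZ.
rewrite brauer_eB_w //; apply: brauer_ideal_base.
  by rewrite transverse_collection_act.
by rewrite card_imset //; exact: hact_inj.
Qed.

Lemma brauer_idealMl n b a : inI n a -> inI n (b * a).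
Proof.
move=> Ia; move: b; apply: brauer_ext_ind => [|b c Ib Ic|d b Ib|w b Ib|H b].
- by rewrite mul1r.
- by rewrite mulrDl; exact: brauer_idealD.
- by rewrite -scalerAl; exact: brauer_idealZ.
- by rewrite -mulrA; exact: brauer_ideal_w.
- rewrite -mulrA; elim=> [|c w B {}b tcB nB _ IH]; first by rewrite mulr0; exact: BrauerIdeal0.
  rewrite mulrDr; apply: brauer_idealD => //.
  rewrite -scalerAr mulrA -{1}(hactKV w H) -brauer_conj -mulrA; apply: brauer_idealZ.
  by apply: brauer_ideal_w; exact: brauer_ideal_e_eB.
Qed.

Lemma brauer_idealMr n b a : inI n a -> inI n (a * b).
Proof.
move: b a; apply: brauer_ext_ind => [|b c Ib Ic|d b Ib|w b Ib|H b Ib] a Ia.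
- by rewrite mulr1.
- by rewrite mulrDr; apply: brauer_idealD; [exact: Ib|exact: Ic].
- by rewrite -scalerAr; apply/brauer_idealZ/Ib.
- rewrite mulrA; apply: Ib; elim: Ia => [|c g B {}a tcB nB _ IH].
    by rewrite mul0r; exact: BrauerIdeal0.
  rewrite mulrDl; apply: brauer_idealD => //; rewrite -scalerAl -mulrA brauer_eB_w //.
  apply: brauer_idealZ; apply/brauer_ideal_w/brauer_ideal_base.
    by rewrite transverse_collection_act.
  by rewrite card_imset //; exact: hact_inj.
- rewrite mulrA; apply: Ib; elim: Ia => [|c g B {}a tcB nB _ IH].
    by rewrite mul0r; exact: BrauerIdeal0.
  rewrite mulrDl; apply: brauer_idealD => //; rewrite -scalerAl -mulrA.
  by apply: brauer_idealZ; apply/brauer_ideal_w/brauer_ideal_eB_e.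
Qed.

Lemma brauer_eB0 : EB set0 = 1.
Proof. by rewrite /brauer_eB big_set0. Qed.

Lemma brauer_ideal_all a : inI 0 a.
Proof.
rewrite -[a]mulr1 -brauer_eB0; apply/brauer_idealMl/brauer_ideal_eB => //.
exact: transverse_collection0.
Qed.

Lemma brauer_ideal_gt n a : (#|{: hyp W}| < n)%N -> inI n a -> a = 0.
Proof.
move=> hn; elim=> // c w B {}a _ nB _ _.
by have := leq_ltn_trans (leq_trans nB (max_card (mem B))) hn; rewrite ltnn.
Qed.

Lemma mul_eBE B (x : group_alg K W) :
  mul_eB phi B x = \sum_w (x w : K) *: (ww w * EB B).
Proof. by rewrite /mul_eB mulr_suml; apply: eq_bigr => w _; rewrite -scalerAl. Qed.

Lemma mul_eB_delta B w : mul_eB phi B (ga_delta K w) = ww w * EB B.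
Proof.
rewrite mul_eBE (bigD1 w) //= big1 ?addr0 => [|g /negPf gw]; rewrite ffunE ?eqxx ?scale1r //.
by rewrite gw scale0r.
Qed.

Lemma brauer_ideal_mul_eB n B x : B \in tc -> (n <= #|B|)%N -> inI n (mul_eB phi B x).
Proof.
move=> tcB nB; rewrite mul_eBE; apply: brauer_ideal_sum => w _; apply: brauer_idealZ.
exact: brauer_ideal_base.
Qed.

(** Modulo larger collections the left ideal of [e_B] is just [KW e_B]: a factor [e_H] gives
    [delta], or group elements by (B5), or enlarges the collection. *)
Lemma brauer_mul_eB a B : B \in tc ->
  exists x : group_alg K W, inI #|B|.+1 (a * EB B - mul_eB phi B x).
Proof.
move=> tcB; move: a; apply: brauer_ext_ind => [|a b [x Ia] [y Ib]|c a [x Ia]|w a [x Ia]|H a [x Ia]].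
- exists (ga_delta K (1%g : W)); rewrite mul_eB_delta brauer_w1 subrr; exact: BrauerIdeal0.
- by exists (x + y); rewrite mulrDl raddfD /= opprD addrACA; exact: brauer_idealD.
- by exists (c *: x); rewrite -scalerAl linearZ /= -scalerBr; exact: brauer_idealZ.
- exists [ffun g => x (w^-1 * g)%g].
  rewrite -mulrA -[X in inI _ X](subrKA (ww w * mul_eB phi B x)) -mulrBr.
  apply: brauer_idealD; first exact: brauer_ideal_w.
  rewrite [X in inI _ X](_ : _ = 0); first exact: BrauerIdeal0.
  apply/eqP; rewrite subr_eq0 !mul_eBE mulr_sumr (reindex_inj (mulgI w^-1%g)); apply/eqP.
  apply: eq_bigr => g _; rewrite ffunE -scalerAr; congr (_ *: _).
  by rewrite mulrA -brauer_wM mulKVg.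
- suff [y Iy] : exists y, inI #|B|.+1 (ee H * mul_eB phi B x - mul_eB phi B y).
    exists y; rewrite -mulrA -[X in inI _ X](subrKA (ee H * mul_eB phi B x)) -mulrBr.
    by apply: brauer_idealD => //; exact: brauer_idealMl.
  rewrite mul_eBE mulr_sumr; elim/big_ind: _ => [|b c [y Ib] [z Ic]|w _].
  + by exists 0; rewrite raddf0 subrr; exact: BrauerIdeal0.
  + by exists (y + z); rewrite raddfD /= opprD addrACA; exact: brauer_idealD.
  + rewrite -scalerAr mulrA -{1}(hactKV w H) -brauer_conj -mulrA.
    set X := hact _ _; have [XB|XB] := boolP (X \in B).
      exists ((x w * del) *: ga_delta K w).
      rewrite brauer_e_eB_in // [mul_eB _ _ _]linearZ /= mul_eB_delta -scalerA -scalerAr subrr.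
      exact: BrauerIdeal0.
    have [tr|[Y YB ntr]] := hyp_trichotomy XB.
      have tcXB := transverse_collectionU1 tcB tr.
      exists 0; rewrite raddf0 subr0 -brauer_eBU1 //; apply/brauer_idealZ/brauer_ideal_base => //.
      by rewrite cardsU1 XB.
    exists (x w *: \sum_(g | hact g Y == X) mm g *: ga_delta K (w * g)%g).
    rewrite (brauer_e_eB_nontransverse YB) // linearZ /= raddf_sum /= mulr_sumr.
    rewrite -scalerBr -sumrB big1 ?scaler0; first exact: BrauerIdeal0.
    move=> g _; rewrite linearZ /= mul_eB_delta brauer_wM -scalerAr mulrA; exact: subrr.
Qed.

End Filtration.

(** A subspace of largest dimension inside [P] absorbs every vector of [P]. *)
Lemma pred_vspace (K : fieldType) (V : vectType K) (P : V -> Prop) :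
    P 0 -> (forall u v, P u -> P v -> P (u + v)) ->
    (forall a u, P u -> P (a *: u)) ->
  exists S : {vspace V}, forall v, v \in S <-> P v.
Proof.
move=> P0 PD PZ.
pose D n := `[< exists2 S : {vspace V}, \dim S = n & forall v, v \in S -> P v >].
have exD : exists n, D n.
  by exists 0%N; apply/asboolP; exists 0%VS; [exact: dimv0|move=> v; rewrite memv0 => /eqP ->].
have ubD n : D n -> (n <= \dim {:V})%N by case/asboolP=> S <- _; exact/dimvS/subvf.
case: (ex_maxnP exD ubD) => n /asboolP[S dS PS] maxn; exists S => v; split=> [/PS//|Pv].
have /maxn : D (\dim (S + <[v]>)%VS).
  apply/asboolP; exists (S + <[v]>)%VS => // _ /memv_addP[s /PS sS [_ /vlineP[a ->] ->]].
  exact/PD/PZ.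
rewrite -dS => le_dim; have /eqP-> : S == (S + <[v]>)%VS by rewrite eqEdim addvSl.
exact/(subvP (addvSr _ _))/memv_line.
Qed.

(** * Matrices of polynomials evaluated at a transcendental element *)

Section Kernels.
Variables (k K : fieldType) (iota : {rmorphism k -> K}) (y : K).

Definition peval_at (p : {poly k}) : K := (map_poly iota p).[y].

Lemma peval_atE p : peval_at p = (horner_eval y \o map_poly iota) p. Proof. by []. Qed.

Lemma peval_at0 : peval_at 0 = 0. Proof. by rewrite peval_atE rmorph0. Qed.

Lemma peval_atX : peval_at 'X = y.
Proof. by rewrite /peval_at map_polyX hornerX. Qed.

Lemma peval_atM p q : peval_at (p * q) = peval_at p * peval_at q.
Proof. by rewrite !peval_atE rmorphM. Qed.

Lemma peval_atC a : peval_at a%:P = iota a.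
Proof. by rewrite /peval_at map_polyC hornerC. Qed.

Lemma peval_at_sum I (r : seq I) (P : pred I) (F : I -> {poly k}) :
  peval_at (\sum_(i <- r | P i) F i) = \sum_(i <- r | P i) peval_at (F i).
Proof. by rewrite !peval_atE rmorph_sum. Qed.

Lemma peval_at_nat n : peval_at n%:R = n%:R.
Proof. by rewrite peval_atE rmorph_nat. Qed.

Section Index.
Variable J : finType.
Implicit Types (f g : J -> J -> {poly k}) (v : {ffun J -> K^o}).

Definition kmul f g i j : {poly k} := \sum_l f i l * g l j.
Definition kid i j : {poly k} := (i == j :> J)%:R.
Definition kact f v : {ffun J -> K^o} := [ffun i => \sum_j peval_at (f i j) * v j].

Lemma kactM f g v : kact (kmul f g) v = kact f (kact g v).
Proof.
apply/ffunP => i; rewrite !ffunE.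
under eq_bigr do rewrite peval_at_sum mulr_suml.
rewrite exchange_big; apply: eq_bigr => j _; rewrite ffunE mulr_sumr.
by apply: eq_bigr => l _; rewrite peval_atM mulrA.
Qed.

Lemma kact1 v : kact kid v = v.
Proof.
apply/ffunP => i; rewrite ffunE (bigD1 i) //= big1 => [|j /negPf ji].
  by rewrite /kid eqxx peval_at_nat mul1r addr0.
by rewrite /kid eq_sym ji peval_at_nat mul0r.
Qed.

Lemma kact_linear f : linear (kact f).
Proof.
move=> a u v; apply/ffunP => i; rewrite !ffunE scaler_sumr -big_split /=.
by apply: eq_bigr => j _; rewrite !ffunE mulrDr; congr (_ + _); exact: mulrCA.
Qed.
HB.instance Definition _ f := GRing.isLinear.Build K {ffun J -> K^o} {ffun J -> K^o}
  _ (kact f) (kact_linear f).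

Hypothesis y_tr : forall p, peval_at p = 0 -> p = 0.
Variable f : J -> J -> {poly k}.
Hypothesis f0 : forall i j, (f i j).[0] = (i == j)%:R.

(* The determinant of [f] is 1 at 0, hence nonzero at the transcendental [y]. *)
Lemma kact_inj v : kact f v = 0 -> v = 0.
Proof.
pose M : 'M_#|J| := \matrix_(i, j) f (enum_val i) (enum_val j).
pose N := map_mx (horner_eval y \o map_poly iota) M.
have NU : N \in unitmx.
  rewrite unitmxE det_map_mx unitfE; apply/eqP => /y_tr M0.
  have : map_mx (horner_eval 0) M = 1%:M.
    by apply/matrixP => i j; rewrite !mxE /horner_eval f0 (inj_eq enum_val_inj).
  move/(congr1 determinant); rewrite det_map_mx M0 det1 rmorph0 => /esym/eqP.
  by rewrite oner_eq0.
move/ffunP=> fv; pose z : 'cV_#|J| := \col_i v (enum_val i).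
have Nz : N *m z = 0.
  apply/matrixP => i j; have := fv (enum_val i); rewrite !ffunE !mxE => fvi.
  rewrite -[RHS]fvi (reindex (@enum_val J predT)) /=; last exact/onW_bij/enum_val_bij.
  by apply: eq_bigr => l _; rewrite !mxE.
have {}Nz : z = 0 by rewrite -[z](mulKmx NU) Nz mulmx0.
apply/ffunP => j; rewrite ffunE -(enum_rankK j).
by have /matrixP/(_ (enum_rank j) 0) := Nz; rewrite !mxE.
Qed.

Lemma kact_surj v : exists u, kact f u = v.
Proof.
have ker0 : lker (linfun (kact f)) == 0%VS.
  apply/lker0P => u u'; rewrite !lfunE /= => /eqP; rewrite -subr_eq0 -linearB /=.
  by move/eqP/kact_inj/eqP; rewrite subr_eq0 => /eqP.
have : v \in (linfun (kact f) @: fullv)%VS.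
  suff -> : (linfun (kact f) @: fullv)%VS = fullv by exact: memvf.
  by apply/eqP; rewrite eqEdim subvf /= limg_dim_eq // (eqP ker0) capv0.
by case/memv_imgP=> u _ ->; exists u; rewrite lfunE.
Qed.

(** An injective operator that preserves a finite dimensional subspace maps it onto itself. In the
    uses of this lemma [Q] is membership in an ideal of [Br], pulled back to coordinates, where
    finiteness is available. *)
Lemma kact_reflect (Q : {ffun J -> K^o} -> Prop) :
    Q 0 -> (forall u v, Q u -> Q v -> Q (u + v)) ->
    (forall a u, Q u -> Q (a *: u)) -> (forall u, Q u -> Q (kact f u)) ->
  forall u, Q (kact f u) -> Q u.
Proof.
move=> Q0 QD QZ Qf u Qu; have [S SE] := pred_vspace Q0 QD QZ.
have ker0 : lker (linfun (kact f)) == 0%VS.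
  apply/lker0P => v v'; rewrite !lfunE /= => /eqP; rewrite -subr_eq0 -linearB /=.
  by move/eqP/kact_inj/eqP; rewrite subr_eq0 => /eqP.
have fS : (linfun (kact f) @: S)%VS = S.
  apply/eqP; rewrite eqEdim limg_dim_eq ?(eqP ker0) ?capv0 // leqnn andbT.
  by apply/subvP => _ /memv_imgP[v /SE Qv ->]; rewrite lfunE; apply/SE/Qf.
have : kact f u \in S by apply/SE.
rewrite -fS => /memv_imgP[v vS]; rewrite lfunE /= => E; apply/SE.
by have /lker0P inj := ker0; rewrite (inj u v) // !lfunE.
Qed.

End Index.
End Kernels.

(** * Invertibility modulo larger collections *)

Section Gram.
Variables (R : realType) (W : complexReflectionGroup R).
Variables (K : fieldType) (phi : {rmorphism paramRing W -> K}).
Variables (k : fieldType) (iota : {rmorphism k -> K}) (mk : W -> k).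
Local Notation A := (brauer_ext phi).
Local Notation ww := (@brauer_w R W K phi).
Local Notation ee := (@brauer_e R W K phi).
Local Notation EB := (@brauer_eB R W K phi).
Local Notation del := (phi (delta W)).
Local Notation mm := (@refl_coef R W K phi).
Local Notation tc := (transverse_collections W).
Local Notation inI := (@brauer_ideal R W K phi).
Local Notation mB := (@mul_eB R W K phi).
Local Notation y := (del^-1).
Local Notation act := (kact iota y).
Local Notation ev := (peval_at iota y).
Hypothesis del0 : del != 0.
Hypothesis y_tr : forall p, ev p = 0 -> p = 0.
Hypothesis mkE : forall w, iota (mk w) = mm w.
Implicit Types (w g : W) (H X Y : hyp W) (B C : {set hyp W}) (s : seq (hyp W)).
Implicit Types (v u : group_alg K W) (n : nat).

Lemma hact_imset1 B : hact 1%g @: B = B.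
Proof. by rewrite (eq_imset (g := id)) ?imset_id //; exact: hact1. Qed.

Lemma hact_imsetM w g B : hact (w * g)%g @: B = hact w @: (hact g @: B).
Proof. by rewrite -imset_comp; apply: eq_imset => H; exact: hactM. Qed.

Lemma card_hact w B : #|hact w @: B| = #|B|.
Proof. by rewrite card_imset //; exact: hact_inj. Qed.

(* Left multiplication by [delta^-1 e_H] on the [w e_B], modulo larger
   collections; the indeterminate stands for [delta^-1]. *)
Definition left_kernel B H (i j : W) : {poly k} :=
  if H \in hact j @: B then (i == j)%:R
  else if [pick X in hact j @: B | nontransverse H X] is Some X then
    if hact (i * j^-1)%g X == H then (mk (i * j^-1)%g)%:P * 'X else 0
  else 0.

Definition left_kernels B s := foldr (fun H f => kmul (left_kernel B H) f) (@kid k W) s.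

Lemma mk_neq0 w : mk w != 0 -> w \in reflections W.
Proof. by move=> h; apply: (@refl_coef_neq0 _ _ _ phi); rewrite -mkE fmorph_eq0. Qed.

(** By (B5) any [X] that [pick] may return computes the same product [e_H e_jB]. If [H] is
    transverse to all of [jB], this product belongs to a larger collection, whence the zero
    entries. *)
Lemma left_kernel_base B H j : B \in tc ->
  inI #|B|.+1 (\sum_i ev (left_kernel B H i j) *: (ww i * EB B)
               - y *: (ee H * (ww j * EB B))).
Proof.
move=> tcB; have tcjB : hact j @: B \in tc by rewrite transverse_collection_act.
rewrite [ww j * _]brauer_w_eB // mulrA /left_kernel.
have [HB|HB] := boolP (H \in hact j @: B).
  rewrite (bigD1 j) //= big1 => [|i /negPf ij]; last by rewrite ij peval_at0 scale0r.
  rewrite eqxx peval_at_nat scale1r addr0 brauer_e_eB_in // -scalerAl scalerA.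
  by rewrite mulVf // scale1r brauer_w_eB // subrr; exact: BrauerIdeal0.
case: pickP => [X /andP[XB ntr]|ntr]; last first.
  rewrite big1 => [|i _]; last by rewrite peval_at0 scale0r.
  rewrite sub0r -scaleN1r scalerA; apply/brauer_idealZ/brauer_idealMr.
  have [tr|[X XB ntrX]] := hyp_trichotomy HB; last by have := ntr X; rewrite XB ntrX.
  have tcHB := transverse_collectionU1 tcjB tr.
  by rewrite -brauer_eBU1 //; apply: brauer_ideal_eB => //; rewrite cardsU1 HB card_hact.
rewrite (brauer_e_eB_nontransverse phi XB) // mulr_suml scaler_sumr.
rewrite (reindex_inj (mulIg j)) [X in _ - X]big_mkcond -sumrB big1; first exact: BrauerIdeal0.
move=> i _; rewrite mulgK; case: ifP => _; last by rewrite peval_at0 scale0r subr0.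
rewrite peval_atM peval_atC peval_atX mkE -scalerAl scalerA [_^-1 * _]mulrC.
by rewrite -mulrA -brauer_w_eB // mulrA -brauer_wM subrr.
Qed.

Lemma mul_eB_kact B f v : mB B (act f v) =
  \sum_j v j *: \sum_i ev (f i j) *: (ww i * EB B).
Proof.
rewrite mul_eBE; under eq_bigr do rewrite ffunE scaler_suml.
rewrite exchange_big; apply: eq_bigr => j _; rewrite scaler_sumr.
by apply: eq_bigr => i _; rewrite scalerA [v j * _]mulrC.
Qed.

Lemma left_kernel_step B H v : B \in tc ->
  inI #|B|.+1 (mB B (act (left_kernel B H) v) - y *: (ee H * mB B v)).
Proof.
move=> tcB; rewrite mul_eB_kact mul_eBE mulr_sumr scaler_sumr -sumrB.
apply: brauer_ideal_sum => j _; rewrite -scalerAr scalerA [y * _]mulrC -scalerA -scalerBr.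
exact/brauer_idealZ/left_kernel_base.
Qed.

Lemma left_kernels_step B s v : B \in tc ->
  inI #|B|.+1 (mB B (act (left_kernels B s) v)
               - y ^+ size s *: (\prod_(H <- s) ee H * mB B v)).
Proof.
move=> tcB; elim: s => [|H s IH] /=.
  by rewrite kact1 big_nil mul1r scale1r subrr; exact: BrauerIdeal0.
rewrite kactM -[X in inI _ X](subrKA (y *: (ee H * mB B (act (left_kernels B s) v)))).
apply: brauer_idealD; first exact: left_kernel_step.
rewrite big_cons exprS -scalerA -scalerBr -mulrA scalerAr -mulrBr.
exact/brauer_idealZ/brauer_idealMl.
Qed.

Lemma left_kernels_elems B C v : B \in tc ->
  inI #|B|.+1 (mB B (act (left_kernels B (elems C)) v) - y ^+ #|C| *: (EB C * mB B v)).
Proof.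
move=> tcB; have := left_kernels_step (elems C) v tcB.
by rewrite size_elems brauer_eB_elems.
Qed.

Lemma left_kernel_at0 B H i j :
  (left_kernel B H i j).[0] = ((i == j) && (H \in hact j @: B))%:R.
Proof.
rewrite /left_kernel; case: ifP => _; first by rewrite andbT; case: eqP => _; rewrite ?hornerC.
rewrite andbF; case: pickP => [X _|_]; last by rewrite horner0.
by case: ifP => _; rewrite ?horner0 // hornerM hornerX mulr0.
Qed.

Lemma left_kernels_at0 B s i j :
  (left_kernels B s i j).[0] = ((i == j) && all (fun H => H \in hact j @: B) s)%:R.
Proof.
elim: s i => [|H s IH] i /=.
  by rewrite /kid andbT; case: eqP => _; rewrite ?hornerC.
rewrite /kmul horner_sum (bigD1 j) //= big1 => [|l /negPf lj].
  rewrite hornerM IH left_kernel_at0 eqxx addr0 /= -natrM mulnb.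
  by rewrite andbA.
by rewrite hornerM IH lj mulr0.
Qed.

(** Off the diagonal a nonzero entry comes from a reflection [w] with [iB = w jB] and [wX = H]. A
    member of [jB] transverse to [H] is also transverse to [X], so [w] fixes it. *)
Lemma left_kernel_supp B H i j : B \in tc -> left_kernel B H i j != 0 ->
  H \in hact i @: B /\
  {in hact j @: B, forall X, transverse H X -> X \in hact i @: B}.
Proof.
move=> tcB; have : hact j @: B \in tc by rewrite transverse_collection_act.
move/transverse_collectionP => tcjB; rewrite /left_kernel.
have [HB|HB] := boolP (H \in hact j @: B).
  by have [-> _|] := eqVneq i j; [split | rewrite eqxx].
case: pickP => [X /andP[XB ntr]|_]; last by rewrite eqxx.
case: ifP => [/eqP|]; last by rewrite eqxx.
set w := (i * j^-1)%g => wX /negP m0.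
have wR : w \in reflections W.
  by apply: mk_neq0; apply/negP => /eqP m1; apply: m0; rewrite m1 polyC0 mul0r.
have iB : hact i @: B = hact w @: (hact j @: B) by rewrite -hact_imsetM mulgKV.
have wXX : hact w X != X by rewrite wX; apply: contraNneq HB => ->.
rewrite iB -{1}wX; split=> [|X' X'B tr]; first exact: imset_f.
have X'X : X' != X.
  by apply: contraTneq tr => ->; rewrite nontransverseN.
rewrite -(@reflection_fix_transverse _ _ _ X X' wR wXX); first exact: imset_f.
  exact: tcjB.
by rewrite wX transverse_sym.
Qed.

(** Each factor [e_H] brings [H] into the collection and keeps the earlier ones, which are
    transverse to it. For [s] listing a collection of the size of [B], this confines the result to
    one coset of the stabilizer, the source of the grading. *)
Lemma left_kernels_supp B s i j : B \in tc ->
  {in s &, forall H X, H != X -> transverse H X} ->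
  left_kernels B s i j != 0 -> {subset s <= hact i @: B}.
Proof.
move=> tcB; elim: s i => [|H s IH] i // trs /= nz.
have [l] : exists l, left_kernel B H i l * left_kernels B s l j != 0.
  apply/existsP; rewrite -negb_forall; apply: contra nz => /forallP h.
  by rewrite /kmul big1 // => l _; exact/eqP/h.
rewrite mulf_eq0 negb_or => /andP[/(left_kernel_supp tcB)[HB hB] /IH sB] X.
rewrite inE => /predU1P[-> //|Xs]; have [-> //|XH] := eqVneq X H.
apply: hB; first by apply: sB => // Y Z Ys Zs; apply: trs; rewrite inE ?Ys ?Zs orbT.
by rewrite transverse_sym; apply: trs; rewrite ?inE ?eqxx ?Xs ?orbT.
Qed.

Lemma left_kernels_coset B C i j : B \in tc -> C \in tc -> #|C| = #|B| ->
  hact i @: B != C -> left_kernels B (elems C) i j = 0.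
Proof.
move=> tcB /transverse_collectionP tcC cC; apply: contraNeq => nz.
have sub : C \subset hact i @: B.
  apply/subsetP => X XC; apply: (left_kernels_supp tcB _ nz); last by rewrite mem_elems.
  by move=> Y Z; rewrite !mem_elems; exact: tcC.
by rewrite eq_sym eqEcard sub card_hact cC leqnn.
Qed.

Definition total_eB n : A := \sum_(C in tc | #|C| == n) y ^+ n *: EB C.

Definition left_total B i j := \sum_(C in tc | #|C| == #|B|) left_kernels B (elems C) i j.

Lemma left_totalE B i j : B \in tc ->
  left_total B i j = left_kernels B (elems (hact i @: B)) i j.
Proof.
move=> tcB; rewrite /left_total (bigD1 (hact i @: B)) /=; last first.
  by rewrite transverse_collection_act tcB card_hact eqxx.
rewrite big1 ?addr0 // => C /andP[/andP[tcC /eqP cC] iC].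
by apply: left_kernels_coset; rewrite // eq_sym.
Qed.

(** Row [i] receives only the collection [iB], and all off-diagonal entries carry a factor
    [delta^-1]. *)
Lemma left_total_at0 B i j : B \in tc -> (left_total B i j).[0] = (i == j)%:R.
Proof.
move=> tcB; rewrite left_totalE // left_kernels_at0.
have [->|//] := eqVneq i j; rewrite (_ : all _ _ = true) //.
by apply/allP => X; rewrite mem_elems.
Qed.

Lemma kact_sum I (r : seq I) (P : pred I) (f : I -> W -> W -> {poly k}) v :
  act (fun i j => \sum_(c <- r | P c) f c i j) v = \sum_(c <- r | P c) act (f c) v.
Proof.
apply/ffunP => i; rewrite ffunE sum_ffunE.
under eq_bigr do rewrite peval_at_sum mulr_suml.
by rewrite exchange_big; apply: eq_bigr => c _; rewrite ffunE.
Qed.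

Lemma left_total_step B v : B \in tc ->
  inI #|B|.+1 (mB B (act (left_total B) v) - total_eB #|B| * mB B v).
Proof.
move=> tcB; rewrite kact_sum raddf_sum mulr_suml /= -sumrB.
apply: brauer_ideal_sum => C /andP[_ /eqP cC]; rewrite -scalerAl -cC cC -{2}cC.
exact: left_kernels_elems.
Qed.

Definition coset_part B C v : group_alg K W :=
  [ffun g => if hact g @: B == C then v g else 0].

Lemma coset_part_linear B C : linear (coset_part B C).
Proof.
move=> a u v; apply/ffunP => g; rewrite !ffunE.
by case: ifP => _ //; rewrite scaler0 addr0.
Qed.
HB.instance Definition _ B C := GRing.isLinear.Build K (group_alg K W) (group_alg K W)
  _ (coset_part B C) (coset_part_linear B C).

Lemma sum_coset_part B v : B \in tc ->
  v = \sum_(C in tc | #|C| == #|B|) coset_part B C v.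
Proof.
move=> tcB; apply/ffunP => g; rewrite sum_ffunE (bigD1 (hact g @: B)) /=; last first.
  by rewrite transverse_collection_act tcB card_hact eqxx.
rewrite big1 ?addr0 ?ffunE ?eqxx // => C /andP[_ gC].
by rewrite ffunE eq_sym (negPf gC).
Qed.

(** Let [L] be the operator of [left_total]. If [u] is in [Q], each coset part of [L u] represents a
    multiple of [e_C u e_B] modulo the ideal, so [L] maps [Q] into the set [Qg] of elements all of
    whose parts are in [Q]. As [Qg] is contained in [Q], it is stable under the invertible [L]; from
    [L v] in [Qg] follows [v] in [Qg]. *)
Lemma ideal_coset_part B C v : B \in tc ->
  inI #|B|.+1 (mB B v) -> inI #|B|.+1 (mB B (coset_part B C v)).
Proof.
move=> tcB; pose Q u := inI #|B|.+1 (mB B u).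
have Q0 : Q 0 by rewrite /Q raddf0; exact: BrauerIdeal0.
have QD u u' : Q u -> Q u' -> Q (u + u') by rewrite /Q raddfD; exact: brauer_idealD.
have QZ a u : Q u -> Q (a *: u) by rewrite /Q linearZ; exact: brauer_idealZ.
have Qstep u : Q u -> forall D, Q (coset_part B D (act (left_total B) u)).
  move=> Qu D; have [/andP[tcD /eqP cD]|nD] := boolP ((D \in tc) && (#|D| == #|B|)); last first.
    rewrite (_ : coset_part _ _ _ = 0) //; apply/ffunP => g; rewrite !ffunE.
    case: eqP => // E; case/negP: nD; rewrite -E transverse_collection_act tcB /=.
    by rewrite card_hact.
  have -> : coset_part B D (act (left_total B) u) = act (left_kernels B (elems D)) u.
    apply/ffunP => g; rewrite !ffunE; case: eqP => [<-|/eqP gD].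
      by apply: eq_bigr => j _; rewrite left_totalE.
    by rewrite big1 // => j _; rewrite left_kernels_coset // peval_at0 mul0r.
  rewrite /Q -[mB B _](subrK (y ^+ #|D| *: (EB D * mB B u))).
  apply: brauer_idealD; first exact: left_kernels_elems.
  exact/brauer_idealZ/brauer_idealMl.
pose Qg u := forall D, Q (coset_part B D u).
move=> Qv; suff : Qg v by exact.
apply: (kact_reflect y_tr (fun i j => left_total_at0 i j tcB) (Q := Qg)).
- by move=> D; rewrite raddf0.
- by move=> u u' Qu Qu' D; rewrite raddfD; apply: QD; [exact: Qu|exact: Qu'].
- by move=> a u Qu D; rewrite linearZ; apply: QZ; exact: Qu.
- move=> u Qu; apply: Qstep; rewrite [u](sum_coset_part _ tcB).
  by rewrite /Q raddf_sum; apply: brauer_ideal_sum => D _; exact: Qu.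
- exact: Qstep.
Qed.

Lemma left_total_surj B v : B \in tc ->
  exists u, inI #|B|.+1 (total_eB #|B| * mB B u - mB B v).
Proof.
move=> tcB; have [u <-] := kact_surj y_tr (fun i j => left_total_at0 i j tcB) v.
exists u; rewrite -opprB -scaleN1r; exact/brauer_idealZ/left_total_step.
Qed.

Lemma left_total_reflect B v : B \in tc ->
  inI #|B|.+1 (total_eB #|B| * mB B v) -> inI #|B|.+1 (mB B v).
Proof.
move=> tcB Iv; pose Q u := inI #|B|.+1 (mB B u).
have Qact u : inI #|B|.+1 (total_eB #|B| * mB B u) -> Q (act (left_total B) u).
  move=> Iu; rewrite /Q -[mB B _](subrK (total_eB #|B| * mB B u)).
  by apply: brauer_idealD => //; exact: left_total_step.
apply: (kact_reflect y_tr (fun i j => left_total_at0 i j tcB) (Q := Q)); last exact: Qact.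
- by rewrite /Q raddf0; exact: BrauerIdeal0.
- by move=> u u'; rewrite /Q raddfD; exact: brauer_idealD.
- by move=> a u; rewrite /Q linearZ; exact: brauer_idealZ.
- by move=> u Qu; apply/Qact/brauer_idealMl.
Qed.

End Gram.

(** * Right multiplication and the units of the ideals *)

Section RightGram.
Variables (R : realType) (W : complexReflectionGroup R).
Variables (K : fieldType) (phi : {rmorphism paramRing W -> K}).
Variables (k : fieldType) (iota : {rmorphism k -> K}) (mk : W -> k).
Local Notation A := (brauer_ext phi).
Local Notation ww := (@brauer_w R W K phi).
Local Notation EB := (@brauer_eB R W K phi).
Local Notation del := (phi (delta W)).
Local Notation mm := (@refl_coef R W K phi).
Local Notation tc := (transverse_collections W).
Local Notation inI := (@brauer_ideal R W K phi).
Local Notation mB := (@mul_eB R W K phi).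
Local Notation y := (del^-1).
Local Notation act := (kact iota y).
Local Notation ev := (peval_at iota y).
Local Notation total_eB := (total_eB phi).
Hypothesis del0 : del != 0.
Hypothesis y_tr : forall p, ev p = 0 -> p = 0.
Hypothesis mkE : forall w, iota (mk w) = mm w.
Implicit Types (w g : W) (H X Y : hyp W) (B C : {set hyp W}).

Section Degree.
Variable n : nat.

(** Right multiplication mixes the [KW e_B] with [|B| = n], so that, unlike on the left, all
    collections of one size are treated together. *)
Definition gram_index :=
  {x : W * {set hyp W} | (x.2 \in tc) && (#|x.2| == n)}.
Local Notation J := gram_index.
Implicit Types (u v : {ffun J -> K^o}) (F : {set hyp W} -> group_alg K W).

Lemma sum_gram_index (U : nmodType) (f : W -> {set hyp W} -> U) :
  \sum_(x : J) f (val x).1 (val x).2 = \sum_(C in tc | #|C| == n) \sum_g f g C.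
Proof.
rewrite exchange_big pair_big_dep /=.
rewrite [RHS](reindex_omap (val : J -> _) insub) => [|x Px]; last by rewrite insubT.
by apply: eq_bigl => x; rewrite valK eqxx andbT (valP x).
Qed.

Definition gram_base (x : J) : A := ww (val x).1 * EB (val x).2.
Definition gram_eval v : A := \sum_x v x *: gram_base x.

Lemma gram_eval_linear : linear gram_eval.
Proof.
move=> a u v; rewrite scaler_sumr -big_split /=; apply: eq_bigr => x _.
by rewrite !ffunE scalerDl scalerA.
Qed.
HB.instance Definition _ := GRing.isLinear.Build K {ffun J -> K^o} A _
  gram_eval gram_eval_linear.

(** In [(w e_B) e_C = w (e_B e_C)] the last factor is the left action of [e_B] on the base vector 1
    of [KW e_C]; the right action is thus read off the left kernels with the two collections
    exchanged. *)
Definition right_total (x x' : J) : {poly k} :=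
  left_kernels mk (val x).2 (elems (val x').2) ((val x').1^-1 * (val x).1)%g 1%g.
Definition right_kernel C (x x' : J) : {poly k} :=
  if (val x).2 == C then right_total x x' else 0.

Lemma right_kernel_base C (x' : J) : C \in tc -> #|C| = n ->
  inI n.+1 (\sum_x ev (right_kernel C x x') *: gram_base x
            - y ^+ n *: (gram_base x' * EB C)).
Proof.
move=> tcC cC; have /andP[tcB /eqP cB] := valP x'.
set w := (val x').1; set B := (val x').2.
pose f g D := ev (if D == C then left_kernels mk D (elems B) (w^-1 * g)%g 1%g else 0)
  *: (ww g * EB D).
rewrite (eq_bigr (fun x => f (val x).1 (val x).2)) // sum_gram_index.
rewrite (bigD1 C) /=; last by rewrite tcC cC eqxx.
rewrite [X in _ + X - _]big1 ?addr0 => [|D /andP[_ /negPf DC]]; last first.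
  by rewrite big1 // => g _; rewrite /f DC peval_at0 scale0r.
have -> : \sum_g f g C = ww w * mB C (act (left_kernels mk C (elems B)) (ga_delta K 1%g)).
  rewrite mul_eB_kact [in RHS](bigD1 1%g) //= [X in _ + X]big1 ?addr0 => [|j /negPf j1]; last first.
    by rewrite ga_deltaE j1 scale0r.
  rewrite ga_deltaE eqxx scale1r mulr_sumr (reindex_inj (mulgI w)); apply: eq_bigr => g _.
  by rewrite /f eqxx mulKg -scalerAr brauer_wM mulrA.
rewrite /gram_base -/w -/B -mulrA scalerAr -mulrBr; apply: brauer_idealMl.
have := left_kernels_elems del0 mkE B (ga_delta K 1%g) tcC.
by rewrite mul_eB_delta brauer_w1 mul1r cC cB.
Qed.

Lemma gram_eval_kact (f : J -> J -> {poly k}) v :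
  gram_eval (act f v) = \sum_x' v x' *: \sum_x ev (f x x') *: gram_base x.
Proof.
rewrite /gram_eval; under eq_bigr do rewrite ffunE scaler_suml.
rewrite exchange_big; apply: eq_bigr => j _; rewrite scaler_sumr.
by apply: eq_bigr => i _; rewrite scalerA [v j * _]mulrC.
Qed.

Lemma right_kernel_step C v : C \in tc -> #|C| = n ->
  inI n.+1 (gram_eval (act (right_kernel C) v) - y ^+ n *: (gram_eval v * EB C)).
Proof.
move=> tcC cC; rewrite gram_eval_kact mulr_suml scaler_sumr -sumrB.
apply: brauer_ideal_sum => x _; rewrite -scalerAl scalerA [y ^+ n * _]mulrC -scalerA.
by rewrite -scalerBr; apply: brauer_idealZ; exact: right_kernel_base.
Qed.

Definition gram_part C v : {ffun J -> K^o} :=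
  [ffun x => if (val x).2 == C then v x else 0].

Lemma gram_part_linear C : linear (gram_part C).
Proof.
move=> a u v; apply/ffunP => g; rewrite !ffunE.
by case: ifP => _ //; rewrite scaler0 addr0.
Qed.
HB.instance Definition _ C := GRing.isLinear.Build K {ffun J -> K^o} {ffun J -> K^o}
  _ (gram_part C) (gram_part_linear C).

Lemma sum_gram_part v : v = \sum_(C in tc | #|C| == n) gram_part C v.
Proof.
apply/ffunP => x; rewrite sum_ffunE (bigD1 (val x).2) ?(valP x) //=.
rewrite big1 ?addr0 ?ffunE ?eqxx // => C /andP[_ gC].
by rewrite ffunE eq_sym (negPf gC).
Qed.

Lemma gram_part_total C v : gram_part C (act right_total v) = act (right_kernel C) v.
Proof.
apply/ffunP => x; rewrite !ffunE /right_kernel; case: eqP => // _.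
by rewrite big1 // => x' _; rewrite peval_at0 mul0r.
Qed.

Lemma right_total_step v :
  inI n.+1 (gram_eval (act right_total v) - gram_eval v * total_eB n).
Proof.
rewrite [act _ _]sum_gram_part raddf_sum /= mulr_sumr -sumrB.
apply: brauer_ideal_sum => C /andP[tcC /eqP cC]; rewrite gram_part_total -scalerAr.
exact: right_kernel_step.
Qed.

(** At 0 the kernel asks for equal group elements and an inclusion of collections, which is an
    equality by size. *)
Lemma right_total_at0 x x' : (right_total x x').[0] = (x == x')%:R.
Proof.
have /andP[_ /eqP cC] := valP x; have /andP[_ /eqP cB] := valP x'.
rewrite left_kernels_at0 hact_imset1; congr (nat_of_bool _)%:R.
have -> : all (fun H => H \in (val x).2) (elems (val x').2) = ((val x').2 == (val x).2).
  by rewrite all_elems eqEcard cB cC leqnn andbT.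
have -> : (x == x') = ((val x).1 == (val x').1) && ((val x).2 == (val x').2).
  by rewrite -val_eqE; case: (val x) (val x') => w C [g B]; rewrite xpair_eqE.
rewrite -[in LHS](inj_eq (mulgI (val x').1)) mulKVg mulg1; congr andb; exact: eq_sym.
Qed.

Let Q v := inI n.+1 (gram_eval v).
Let Q0 : Q 0. Proof. by rewrite /Q raddf0; exact: BrauerIdeal0. Qed.
Let QD u v : Q u -> Q v -> Q (u + v).
Proof. by rewrite /Q raddfD; exact: brauer_idealD. Qed.
Let QZ a u : Q u -> Q (a *: u).
Proof. by rewrite /Q linearZ; exact: brauer_idealZ. Qed.

(** The grading argument transposed: modulo larger collections, right multiplication by [e_C] lands
    in [KW e_C]. It makes the [KW e_B] with [|B| = n] independent modulo the next ideal. *)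
Lemma ideal_gram_part C v : Q v -> Q (gram_part C v).
Proof.
move=> Qv; pose Qg u := forall D, Q (gram_part D u).
have Qstep u : Q u -> forall D, Q (gram_part D (act right_total u)).
  move=> Qu D; have [/andP[tcD /eqP cD]|nD] := boolP ((D \in tc) && (#|D| == n)); last first.
    rewrite (_ : gram_part _ _ = 0) //; apply/ffunP => x; rewrite !ffunE.
    by case: eqP => // E; case/negP: nD; rewrite -E (valP x).
  rewrite gram_part_total /Q -[gram_eval _](subrK (y ^+ n *: (gram_eval u * EB D))).
  apply: brauer_idealD; first exact: right_kernel_step.
  exact/brauer_idealZ/brauer_idealMr.
suff : Qg v by exact.
apply: (kact_reflect y_tr right_total_at0 (Q := Qg)).
- by move=> D; rewrite raddf0.
- by move=> u u' Qu Qu' D; rewrite raddfD; apply: QD; [exact: Qu|exact: Qu'].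
- by move=> a u Qu D; rewrite linearZ; apply: QZ; exact: Qu.
- move=> u Qu; apply: Qstep; rewrite [u]sum_gram_part.
  by rewrite /Q raddf_sum; apply: brauer_ideal_sum => D _; exact: Qu.
- exact: Qstep.
Qed.

Lemma right_total_surj v : exists u, inI n.+1 (gram_eval u * total_eB n - gram_eval v).
Proof.
have [u <-] := kact_surj y_tr right_total_at0 v.
by exists u; rewrite -opprB -scaleN1r; exact/brauer_idealZ/right_total_step.
Qed.

Lemma right_total_reflect v : inI n.+1 (gram_eval v * total_eB n) -> Q v.
Proof.
have Qact u : inI n.+1 (gram_eval u * total_eB n) -> Q (act right_total u).
  move=> Iu; rewrite /Q -[gram_eval _](subrK (gram_eval u * total_eB n)).
  by apply: brauer_idealD => //; exact: right_total_step.
move=> Iv; apply: (kact_reflect y_tr right_total_at0 (Q := Q)) => //; last exact: Qact.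
by move=> u Qu; apply/Qact/brauer_idealMr.
Qed.

Definition gram_vec F : {ffun J -> K^o} := [ffun x => F (val x).2 (val x).1].

Lemma gram_eval_vec F :
  gram_eval (gram_vec F) = \sum_(B in tc | #|B| == n) mB B (F B).
Proof.
rewrite (eq_bigr (fun B => \sum_g F B g *: (ww g * EB B))) => [|B _]; last exact: mul_eBE.
by rewrite -sum_gram_index; apply: eq_bigr => x _; rewrite ffunE.
Qed.

Lemma ideal_sum_mul_eB F : inI n.+1 (\sum_(B in tc | #|B| == n) mB B (F B)) ->
  forall B, B \in tc -> #|B| = n -> inI n.+1 (mB B (F B)).
Proof.
move=> IF B tcB cB; pose G C := if C == B then F C else 0.
have -> : mB B (F B) = \sum_(C in tc | #|C| == n) mB C (G C).
  rewrite (bigD1 B) /=; last by rewrite tcB cB eqxx.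
  rewrite big1 ?addr0 => [|C /andP[_ /negPf CB]]; last by rewrite /G CB raddf0.
  by rewrite /G eqxx.
rewrite -gram_eval_vec (_ : gram_vec G = gram_part B (gram_vec F)); last first.
  by apply/ffunP => x; rewrite !ffunE /G; case: ifP => _; rewrite ?ffunE.
by apply: ideal_gram_part; rewrite /Q gram_eval_vec.
Qed.

Lemma ideal_decomp a : inI n a ->
  exists F, inI n.+1 (a - \sum_(B in tc | #|B| == n) mB B (F B)).
Proof.
elim=> [|c w B {}a tcB nB _ [F IF]].
  by exists (fun=> 0); rewrite big1 ?subrr => [|B _]; [exact: BrauerIdeal0|exact: raddf0].
have [cB|cB] := eqVneq #|B| n; last first.
  exists F; rewrite -addrA; apply: brauer_idealD => //; apply/brauer_idealZ/brauer_ideal_base => //.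
  by rewrite ltn_neqAle eq_sym cB.
exists (fun C => (if C == B then c *: ga_delta K w else 0) + F C).
under eq_bigr do rewrite raddfD /=.
rewrite big_split /= opprD addrACA; apply: brauer_idealD => //.
rewrite (bigD1 B) /=; last by rewrite tcB cB eqxx.
rewrite big1 ?addr0 => [|C /andP[_ /negPf CB]]; last by rewrite CB raddf0.
by rewrite eqxx linearZ /= mul_eB_delta subrr; exact: BrauerIdeal0.
Qed.

Lemma ideal_gram_eval v : inI n (gram_eval v).
Proof.
apply: brauer_ideal_sum => x _; apply/brauer_idealZ.
by have /andP[tcB /eqP cB] := valP x; apply: brauer_ideal_base; rewrite ?cB.
Qed.

Lemma ideal_total : inI n (total_eB n).
Proof.
apply: brauer_ideal_sum => C /andP[tcC /eqP cC]; apply/brauer_idealZ.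
by apply: brauer_ideal_eB => //; rewrite cC.
Qed.

Lemma ideal_decomp_vec a : inI n a -> exists v, inI n.+1 (a - gram_eval v).
Proof. by case/ideal_decomp=> F IF; exists (gram_vec F); rewrite gram_eval_vec. Qed.

Lemma ideal_right_surj a : inI n a ->
  exists2 b, inI n b & inI n.+1 (b * total_eB n - a).
Proof.
case/ideal_decomp_vec=> v Iv; have [u Iu] := right_total_surj v.
exists (gram_eval u); first exact: ideal_gram_eval.
by rewrite -[X in inI _ X](subrKA (gram_eval v)); apply: brauer_idealD => //;
  rewrite -opprB -scaleN1r; exact: brauer_idealZ.
Qed.

Lemma ideal_right_reflect a : inI n a -> inI n.+1 (a * total_eB n) -> inI n.+1 a.
Proof.
case/ideal_decomp_vec=> v Iv Ia; rewrite -[a](subrK (gram_eval v)).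
apply: brauer_idealD => //; apply: right_total_reflect.
have -> : gram_eval v * total_eB n = a * total_eB n - (a - gram_eval v) * total_eB n.
  by rewrite mulrBl opprB addrC subrK.
by apply: brauer_idealB => //; exact: brauer_idealMr.
Qed.

Lemma ideal_left_surj a : inI n a ->
  exists2 b, inI n b & inI n.+1 (total_eB n * b - a).
Proof.
case/ideal_decomp=> F IF.
have exG B : exists u : group_alg K W, B \in tc -> #|B| = n ->
    inI n.+1 (total_eB n * mB B u - mB B (F B)).
  have [tcB|] := boolP (B \in tc); last by exists 0.
  by have [u Iu] := left_total_surj del0 y_tr mkE (F B) tcB; exists u => _ <-.
have [G IG] := choice exG.
exists (\sum_(B in tc | #|B| == n) mB B (G B)).
  apply: brauer_ideal_sum => B /andP[tcB /eqP cB].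
  by apply: brauer_ideal_mul_eB; rewrite ?cB.
rewrite -[X in inI _ X](subrKA (\sum_(B in tc | #|B| == n) mB B (F B))).
apply: brauer_idealD; last by rewrite -opprB -scaleN1r; exact: brauer_idealZ.
rewrite mulr_sumr -sumrB; apply: brauer_ideal_sum => B /andP[tcB /eqP cB]; exact: IG.
Qed.

(** Left multiplication by [total_eB n] preserves each [KW e_B] modulo the next ideal; by
    independence the hypothesis splits over the collections, and each component is handled by its
    own invertible matrix. *)
Lemma ideal_left_reflect a : inI n a -> inI n.+1 (total_eB n * a) -> inI n.+1 a.
Proof.
case/ideal_decomp=> F IF Ia; set S := \sum_(B in tc | _) _ in IF.
have IS : inI n.+1 (total_eB n * S).
  have -> : total_eB n * S = total_eB n * a - total_eB n * (a - S).
    by rewrite mulrBr opprB addrC subrK.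
  by apply: brauer_idealB => //; exact: brauer_idealMl.
rewrite -[a](subrK S); apply: brauer_idealD => //.
apply: brauer_ideal_sum => B /andP[tcB /eqP cB].
have := left_total_reflect del0 y_tr mkE (v := F B) tcB; rewrite cB; apply.
pose G B := act (left_total mk B) (F B).
have GF C : C \in tc -> #|C| = n -> inI n.+1 (mB C (G C) - total_eB n * mB C (F C)).
  by move=> tcC cC; have := left_total_step del0 mkE (F C) tcC; rewrite cC.
have -> : total_eB n * mB B (F B) = mB B (G B) - (mB B (G B) - total_eB n * mB B (F B)).
  by rewrite opprB addrC subrK.
apply: brauer_idealB; last exact: GF.
apply: (ideal_sum_mul_eB _ tcB cB) => //.
rewrite -[X in inI _ X](subrK (total_eB n * S)); apply: brauer_idealD => //.
rewrite mulr_sumr -sumrB; apply: brauer_ideal_sum => C /andP[tcC /eqP cC]; exact: GF.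
Qed.

End Degree.

Lemma ideal_unit n : exists2 u, inI n u & forall a, inI n a -> u * a = a /\ a * u = a.
Proof.
have [N] := ubnP (#|{: hyp W}|.+1 - n); elim: N n => // N IH n ltN.
have [ltn|len] := ltnP #|{: hyp W}| n.
  exists 0; first exact: BrauerIdeal0.
  by move=> a /(brauer_ideal_gt ltn) ->; rewrite mul0r.
have [|l Il lE] := IH n.+1.
  by rewrite subSS; move: ltN; rewrite subSn //.
have [u Iu uE] := ideal_left_surj (ideal_total n).
have [r Ir rE] := ideal_right_surj (ideal_total n).
(* With [T = total_eB n], [T (u a - a) = (T u - T) a] lies in the next ideal, and [T] reflects
   membership. *)
have uP a : inI n a -> inI n.+1 (u * a - a).
  move=> Ia; apply: ideal_left_reflect.
    by apply: brauer_idealB => //; exact: brauer_idealMl.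
  by rewrite mulrBr mulrA -mulrBl; exact: brauer_idealMr.
have rP a : inI n a -> inI n.+1 (a * r - a).
  move=> Ia; apply: ideal_right_reflect.
    by apply: brauer_idealB => //; exact: brauer_idealMl.
  by rewrite mulrBl -mulrA -mulrBr; exact: brauer_idealMl.
have leI a : inI n.+1 a -> inI n a by apply: brauer_ideal_leq.
(* [L a = u a - l (u a - a)], and [l] acts as 1 on [u a - a], which lies in the next ideal; [L'] is
   the mirror image. *)
pose L := u + l - l * u; pose L' := r + l - r * l.
have IL : inI n L.
  apply: brauer_idealB; last exact: brauer_idealMl.
  by apply: brauer_idealD => //; exact: leI.
have IL' : inI n L'.
  apply: brauer_idealB; last exact/leI/brauer_idealMl.
  by apply: brauer_idealD => //; exact: leI.
have LE a : inI n a -> L * a = a.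
  move=> Ia; have [h _] := lE _ (uP _ Ia).
  have -> : L * a = u * a - l * (u * a - a).
    by rewrite /L mulrBl mulrDl mulrBr opprB -mulrA addrA.
  by rewrite h subKr.
have L'E a : inI n a -> a * L' = a.
  move=> Ia; have [_ h] := lE _ (rP _ Ia).
  have -> : a * L' = a * r - (a * r - a) * l.
    by rewrite /L' mulrBr mulrDr mulrBl opprB mulrA addrA.
  by rewrite h subKr.
exists L => // a Ia; split; first exact: LE.
(* A left unit and a right unit of one ideal coincide, as [L = L L' = L']. *)
by rewrite -(L'E L IL) LE // L'E.
Qed.

End RightGram.

(** * The action on [KW / Ann(B)] *)

Section ModuleOperators.
Variables (R : realType) (W : complexReflectionGroup R).
Variables (K : fieldType) (phi : {rmorphism paramRing W -> K}).
Local Notation ww := (@brauer_w R W K phi).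
Local Notation mm := (@refl_coef R W K phi).
Local Notation tc := (transverse_collections W).
Local Notation mB := (@mul_eB R W K phi).
Local Notation KW := (group_alg K W).
Implicit Types (w g h s : W) (H X Y : hyp W) (C : {set hyp W}) (x z : group_alg K W).
Variable B : {set hyp W}.
Hypothesis tcB : B \in tc.
Local Notation im g := (hact g @: B).
Local Notation dl := (@ga_delta K W).
Local Notation Ann := (ann phi B).

Let tc_im g : im g \in tc. Proof. by rewrite transverse_collection_act. Qed.

Lemma mem_lcoset_stab w h : (h \in (w *: stab B)%g) = (im h == im w).
Proof.
rewrite mem_lcoset inE -(inj_eq (imset_inj (@hact_inj _ _ w))) -hact_imsetM mulKVg.
by rewrite eq_sym eq_sym.
Qed.

Lemma coset_projE w x : coset_proj B w x = coset_part B (im w) x.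
Proof. by apply/ffunP => h; rewrite !ffunE mem_lcoset_stab. Qed.

Lemma coset_partM C D x :
  coset_part B C (coset_part B D x) = if C == D then coset_part B C x else 0.
Proof.
apply/ffunP => g; rewrite !ffunE; case: (eqVneq C D) => [<-|CD]; rewrite !ffunE.
  by case: eqP.
by case: eqP => // ->; rewrite (negPf CD).
Qed.

Definition ltrans w x : KW := [ffun g => x (w^-1 * g)%g].

Lemma ltrans_linear w : linear (ltrans w).
Proof. by move=> a x z; apply/ffunP => g; rewrite !ffunE. Qed.
HB.instance Definition _ w := GRing.isLinear.Build K KW KW _ (ltrans w) (ltrans_linear w).

Lemma ltrans1 x : ltrans 1%g x = x.
Proof. by apply/ffunP => g; rewrite ffunE invg1 mul1g. Qed.

Lemma ltransM w g x : ltrans (w * g)%g x = ltrans w (ltrans g x).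
Proof. by apply/ffunP => h; rewrite !ffunE invMg mulgA. Qed.

Lemma ltrans_delta w g : ltrans w (dl g) = dl (w * g)%g.
Proof.
by apply/ffunP => h; rewrite !ffunE -(inj_eq (mulgI w)) mulKVg.
Qed.

Lemma mul_eB_ltrans w x : mB B (ltrans w x) = ww w * mB B x.
Proof.
rewrite !mul_eBE mulr_sumr (reindex_inj (mulgI w)) /=.
by apply: eq_bigr => g _; rewrite ffunE mulKg -scalerAr brauer_wM mulrA.
Qed.

Lemma sum_delta x : x = \sum_g x g *: dl g.
Proof.
apply/ffunP => g; rewrite sum_ffunE (bigD1 g) //= big1 => [|h /negPf hg].
  by rewrite !ffunE eqxx addr0 [RHS]mulr1.
by rewrite !ffunE eq_sym hg; exact: mulr0.
Qed.

Lemma ltrans_coset_part w C x :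
  ltrans w (coset_part B C x) = coset_part B (hact w @: C) (ltrans w x).
Proof.
apply/ffunP => g; rewrite !ffunE -(inj_eq (imset_inj (@hact_inj _ _ w))).
by rewrite -hact_imsetM mulKVg.
Qed.

Lemma mem_ann_eB x : (x \in ann_eB phi B) = (mB B x == 0).
Proof. exact: memv_kerv. Qed.

Lemma ltrans_ann_eB w x : x \in ann_eB phi B -> ltrans w x \in ann_eB phi B.
Proof. by rewrite !mem_ann_eB mul_eB_ltrans => /eqP ->; rewrite mulr0. Qed.

Lemma coset_part_ann_eB C x : x \in ann_eB phi B -> coset_part B C x \in Ann.
Proof.
move=> xA; have [/existsP[w /eqP E]|ne] := boolP [exists w, im w == C]; last first.
  rewrite (_ : coset_part _ _ _ = 0) ?rpred0 //; apply/ffunP => g; rewrite !ffunE.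
  by case: eqP => // E; case/existsP: ne; exists g; apply/eqP.
apply: (subvP (sumv_sup w (P := predT) _ (subvv _))) => //.
rewrite -E -coset_projE -[coset_proj B w x](lfunE [the {linear _ -> _} of coset_proj B w]).
exact: memv_img.
Qed.

(** [Ann(e_B)] is stable under left translation, so the part of an element in [w Stab(B)] is [w]
    times the identity-coset part of another element. *)
Lemma ann_ind (P : KW -> Prop) : P 0 -> (forall x z, P x -> P z -> P (x + z)) ->
  (forall w x, x \in ann_eB phi B -> P (ltrans w (coset_part B B x))) ->
  forall x, x \in Ann -> P x.
Proof.
move=> P0 PD Pg x /memv_sumP[v vA ->]; elim/big_ind: _ => // w _.
have /memv_imgP[z zA ->] := vA w isT; rewrite lfunE /= coset_projE.
have -> : coset_part B (im w) z = ltrans w (coset_part B B (ltrans w^-1%g z)).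
  by rewrite ltrans_coset_part -ltransM mulgV ltrans1.
exact/Pg/ltrans_ann_eB.
Qed.

Lemma sub_ann_eB x : x \in ann_eB phi B -> x \in Ann.
Proof.
move=> xA; rewrite [x](sum_coset_part _ tcB); apply: rpred_sum => C _.
exact: coset_part_ann_eB.
Qed.

Lemma ltrans_ann w x : x \in Ann -> ltrans w x \in Ann.
Proof.
elim/ann_ind => [|{}x z xA zA|g {}x xA]; first by rewrite raddf0 rpred0.
  by rewrite raddfD rpredD.
by rewrite -ltransM ltrans_coset_part coset_part_ann_eB ?ltrans_ann_eB.
Qed.

Lemma coset_part_ann C x : x \in Ann -> coset_part B C x \in Ann.
Proof.
elim/ann_ind => [|{}x z xA zA|g {}x xA]; first by rewrite raddf0 rpred0.
  by rewrite raddfD rpredD.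
rewrite ltrans_coset_part coset_partM; case: eqP => _; last exact: rpred0.
by rewrite coset_part_ann_eB ?ltrans_ann_eB.
Qed.

(** The [h] kept here are those with [e_H h e_B = delta h e_B]. *)
Definition hyp_proj H x : KW := [ffun h => if H \in im h then x h else 0].

Lemma hyp_proj_linear H : linear (hyp_proj H).
Proof.
move=> a x z; apply/ffunP => g; rewrite !ffunE.
by case: ifP => _ //; rewrite scaler0 addr0.
Qed.
HB.instance Definition _ H := GRing.isLinear.Build K KW KW _ (hyp_proj H) (hyp_proj_linear H).
Local Notation D := hyp_proj.

Lemma hyp_projK H x : D H (D H x) = D H x.
Proof. by apply/ffunP => g; rewrite !ffunE; case: (H \in im g). Qed.

Lemma hyp_projC H X x : D H (D X x) = D X (D H x).
Proof. by apply/ffunP => g; rewrite !ffunE; case: (H \in im g); case: (X \in im g). Qed.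

Lemma hyp_proj_delta H g : D H (dl g) = if H \in im g then dl g else 0.
Proof.
apply/ffunP => h; rewrite !ffunE; case: (eqVneq h g) => [->|hg].
  by case: (H \in im g); rewrite !ffunE ?eqxx.
by case: (H \in im g); case: (H \in im h); rewrite !ffunE ?(negPf hg).
Qed.

Lemma ltrans_hyp_proj w H x : ltrans w (D H x) = D (hact w H) (ltrans w x).
Proof.
apply/ffunP => g; rewrite !ffunE -{1}(hactK w H) hact_imsetM.
by rewrite (mem_imset _ _ (@hact_inj _ _ _)).
Qed.

Lemma coset_part_hyp_proj C H x :
  coset_part B C (D H x) = if H \in C then coset_part B C x else 0.
Proof.
apply/ffunP => g; rewrite !ffunE; case: eqP => [E|/eqP/negPf gC].
  by rewrite E; case: (H \in C); rewrite !ffunE ?E ?eqxx.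
by case: (H \in C); rewrite !ffunE // gC.
Qed.

Lemma hyp_proj_coset_part C H x :
  D H (coset_part B C x) = if H \in C then coset_part B C x else 0.
Proof.
rewrite -coset_part_hyp_proj; apply/ffunP => g; rewrite !ffunE.
by case: (H \in im g); case: (im g == C).
Qed.

Lemma hyp_proj_ann H x : x \in Ann -> D H x \in Ann.
Proof.
elim/ann_ind => [|{}x z xA zA|g {}x xA]; first by rewrite raddf0 rpred0.
  by rewrite raddfD rpredD.
rewrite ltrans_coset_part hyp_proj_coset_part; case: ifP => _; last exact: rpred0.
by rewrite coset_part_ann_eB ?ltrans_ann_eB.
Qed.

(** A reflection carrying [gB] to [hB] enters the action of [e_H] for every [H] that it gains.
    Dividing by their number makes it count once in the sum over all [H]. *)
Definition switch_coef h g : K :=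
  if im h == im g then 0 else #|im h :\: im g|%:R^-1.

(* On [KW / Ann], all the [e_H] are cut out of this one operator. *)
Definition switch x : KW := [ffun h => \sum_g mm (h * g^-1)%g * switch_coef h g * x g].

Lemma switch_linear : linear switch.
Proof.
move=> a x z; apply/ffunP => h; rewrite !ffunE scaler_sumr -big_split /=.
by apply: eq_bigr => g _; rewrite !ffunE mulrDr; congr (_ + _); exact: mulrCA.
Qed.
HB.instance Definition _ := GRing.isLinear.Build K KW KW _ switch switch_linear.
Local Notation Xi := switch.

Lemma switch_delta g h : Xi (dl g) h = mm (h * g^-1)%g * switch_coef h g.
Proof.
rewrite ffunE (bigD1 g) //= big1 ?addr0 => [|l /negPf lg]; rewrite ga_deltaE ?eqxx ?mulr1 //.
by rewrite lg mulr0.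
Qed.

Lemma switch_coef_act w h g : switch_coef (w * h)%g (w * g)%g = switch_coef h g.
Proof.
rewrite /switch_coef !hact_imsetM (inj_eq (imset_inj (@hact_inj _ _ w))).
case: eqP => // _; congr (_%:R^-1); rewrite -(card_hact w (im h :\: im g)).
congr #|pred_of_set _|; apply/setP => X; have -> : X = hact w (hact w^-1%g X).
  by rewrite hactKV.
by rewrite in_setD !(mem_imset _ _ (@hact_inj _ _ w)) in_setD.
Qed.

Lemma switch_ltrans w x : Xi (ltrans w x) = ltrans w (Xi x).
Proof.
apply/ffunP => h; rewrite !ffunE (reindex_inj (mulgI w)); apply: eq_bigr => g _.
rewrite ffunE mulKg -{2}(mulKVg w h) switch_coef_act; congr (_ * _ * _).
by rewrite -[RHS](refl_coefJ phi w) invMg !mulgA mulgV mul1g.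
Qed.

(** On the identity coset the kernel depends on [h g^-1] alone, so [Xi] is there left multiplication
    by an element of [KW]; the other cosets follow by equivariance. *)
Lemma switch_ann x : x \in Ann -> Xi x \in Ann.
Proof.
elim/ann_ind => [|{}x z xA zA|w {}x xA]; first by rewrite raddf0 rpred0.
  by rewrite raddfD rpredD.
rewrite switch_ltrans; apply: ltrans_ann; set z := coset_part B B x.
have zA : z \in Ann by exact: coset_part_ann_eB.
suff -> : Xi z = \sum_s (mm s * switch_coef s 1%g) *: ltrans s z.
  by apply: rpred_sum => s _; rewrite rpredZ // ltrans_ann.
apply/ffunP => h; rewrite ffunE sum_ffunE.
have inv_bij : {on predT, bijective (fun g : W => (h * g^-1)%g)}.
  by exists (fun s => (s^-1 * h)%g) => g _; rewrite ?invMg ?invgK ?mulgKV ?mulKVg // mulgA mulgKV.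
rewrite [RHS](reindex (fun g : W => (h * g^-1)%g)) //; apply: eq_bigr => g _.
rewrite !ffunE !invMg !invgK mulgKV; have [gB|] := eqVneq (im g) B; last by rewrite !scaler0 mulr0.
congr (_ * _ * _); rewrite -[h in LHS](mulgKV g).
by rewrite /switch_coef [im (_ * g)%g]hact_imsetM gB hact_imset1.
Qed.

End ModuleOperators.

(** * The operators of the [e_H] and the relations other than (B4) *)

Section ModuleRelations.
Variables (R : realType) (W : complexReflectionGroup R).
Variables (K : fieldType) (phi : {rmorphism paramRing W -> K}).
Local Notation ww := (@brauer_w R W K phi).
Local Notation ee := (@brauer_e R W K phi).
Local Notation EB := (@brauer_eB R W K phi).
Local Notation del := (phi (delta W)).
Local Notation mm := (@refl_coef R W K phi).
Local Notation tc := (transverse_collections W).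
Local Notation mB := (@mul_eB R W K phi).
Local Notation KW := (group_alg K W).
Implicit Types (w g h s : W) (H X Y : hyp W) (C : {set hyp W}) (x z : group_alg K W).
Variable B : {set hyp W}.
Hypothesis tcB : B \in tc.
Hypothesis natK : forall n, (n%:R == 0 :> K) = (n == 0)%N.
Local Notation im g := (hact g @: B).
Local Notation dl := (@ga_delta K W).
Local Notation Ann := (ann phi B).
Local Notation D := (hyp_proj B).
Local Notation Xi := (switch phi B).
Local Notation cp := (coset_part B).

Let tc_im g : im g \in tc. Proof. by rewrite transverse_collection_act. Qed.

Let refl_im h g : mm (h * g^-1)%g != 0 ->
  [/\ (h * g^-1)%g \in reflections W & im h = hact (h * g^-1)%g @: im g].
Proof. by move/refl_coef_neq0; split; rewrite // -hact_imsetM mulgKV. Qed.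

Lemma ann_lfun (F : 'End({ffun W -> K^o})) :
  (forall g, F (dl g) \in Ann) -> forall x, F x \in Ann.
Proof.
move=> FA x; rewrite [x]sum_delta linear_sum; apply: rpred_sum => g _.
by rewrite linearZ /= rpredZ.
Qed.

Lemma card_setD_sym C g : #|C| = #|B| -> #|C :\: im g| = #|im g :\: C|.
Proof. by move=> cC; rewrite !cardsD cC card_hact setIC. Qed.

Lemma card_setD_neq0 C g H : H \in C -> H \notin im g ->
  (#|C :\: im g|%:R : K) != 0.
Proof.
move=> HC Hg; rewrite natK -lt0n; apply/card_gt0P; exists H.
by rewrite in_setD Hg HC.
Qed.

(** The value that (B5) prescribes for [e_H g] when [X] belongs to [gB]. *)
Definition reach H X g : KW := \sum_(s | hact s X == H) mm s *: dl (s * g)%g.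

Lemma reachE H X g h :
  reach H X g h = if hact (h * g^-1)%g X == H then mm (h * g^-1)%g else 0.
Proof.
rewrite sum_ffunE; case: ifP => Hs.
  rewrite (bigD1 (h * g^-1)%g) //= big1 => [|s /andP[_ /negPf sh]].
    by rewrite addr0 !ffunE mulgKV eqxx; exact: mulr1.
  by rewrite !ffunE -(inj_eq (mulIg g^-1%g)) mulgK eq_sym sh; exact: mulr0.
rewrite big1 // => s /eqP sX; rewrite !ffunE -(inj_eq (mulIg g^-1%g)) mulgK.
by case: eqP => [hs|_]; [rewrite hs sX eqxx in Hs | exact: mulr0].
Qed.

(** Multiplied by [e_B], both terms become [e_H g e_B], by (B5) for [X] and for [Y]. *)
Lemma reach_ann_eB H X Y g : X \in im g -> Y \in im g ->
  nontransverse H X -> nontransverse H Y ->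
  reach H X g - reach H Y g \in ann_eB phi B.
Proof.
have mE Z : Z \in im g -> nontransverse H Z -> mB B (reach H Z g) = ee H * EB (im g) * ww g.
  move=> Zg ntr; rewrite raddf_sum /= (brauer_e_eB_nontransverse phi Zg) // mulr_suml.
  apply: eq_bigr => s _; rewrite linearZ /= mul_eB_delta -scalerAl brauer_wM.
  by rewrite -!mulrA brauer_w_eB.
by move=> Xg Yg nX nY; rewrite mem_ann_eB raddfB /= !mE // subrr.
Qed.

Lemma reach_coset_part0 H X C g : H \notin C -> cp C (reach H X g) = 0 \/ X \notin im g.
Proof.
move=> HC; have [Xg|] := boolP (X \in im g); last by right.
left; apply/ffunP => h; rewrite ffunE reachE [RHS]ffunE.
case: eqP => // hC; case: eqP => // E; case/negP: HC.
by rewrite -hC -E -[h in im h](mulgKV g) hact_imsetM imset_f.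
Qed.

(** A reflection [s] carrying [gB] to [C] satisfies [H = sY] for exactly one [Y] in [gB]. This [Y]
    is not in [C]: there it would be transverse to [H], while a reflection moves a hyperplane to a
    non-transverse one. So each entry of [Xi] occurs in one summand. *)
Lemma reach_sum H C g : C \in tc -> H \in C -> H \notin im g ->
  #|C :\: im g|%:R *: cp C (Xi (dl g)) = \sum_(Y in im g :\: C) cp C (reach H Y g).
Proof.
move=> /transverse_collectionP tcC HC Hg; apply/ffunP => h.
rewrite ffunE sum_ffunE ffunE switch_delta.
under eq_bigr do rewrite ffunE reachE.
case: eqP => [hC|_]; last by rewrite scaler0 big1.
have [m0|m0] := eqVneq (mm (h * g^-1)%g) 0.
  by rewrite m0 mul0r scaler0 big1 // => Y _; case: ifP.
have [sR imh] := refl_im m0; set s := (h * g^-1)%g in m0 sR imh *.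
have : H \in im h by rewrite hC.
rewrite {1}imh => /imsetP[Y Yg HY].
have YC : Y \notin C.
  apply/negP => YC; have sY : hact s Y != Y by rewrite -HY; apply: contraNneq Hg => ->.
  have := reflection_nontransverse sR sY; rewrite -HY => /nontransverseN/negP; apply.
  by apply: tcC => //; rewrite HY eq_sym.
rewrite (bigD1 Y) /=; last by rewrite in_setD YC Yg.
rewrite big1 => [|X /andP[_ XY]]; last first.
  by rewrite HY (inj_eq (@hact_inj _ _ s)) (negPf XY).
rewrite addr0 HY eqxx /switch_coef hC; case: eqP => [E|_].
  by case/negP: Hg; rewrite -E.
by rewrite /GRing.scale /= mulrCA mulfV ?mulr1 // (card_setD_neq0 HC).
Qed.

(** On the part of a collection [C] containing [H], [Xi] is the average of the [reach H Y g] over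
    [Y] in [gB] outside [C]. Those with [Y] non-transverse to [H] agree with [reach H X g] modulo
    [Ann]. *)
Lemma hyp_proj_switch_delta H X g : X \in im g -> H \notin im g ->
  nontransverse H X -> D H (Xi (dl g)) - reach H X g \in Ann.
Proof.
move=> Xg Hg ntr; rewrite [_ - _](sum_coset_part _ tcB).
apply: rpred_sum => C /andP[tcC /eqP cC]; rewrite raddfB /= coset_part_hyp_proj.
have [HC|HC] := boolP (H \in C); last first.
  by case: (reach_coset_part0 X g HC) => [->|/negP//]; rewrite subr0 rpred0.
have c0 := card_setD_neq0 HC Hg.
rewrite -[X in X \in _](scalerK c0) rpredZ // scalerBr (reach_sum tcC HC Hg) scaler_nat.
rewrite (card_setD_sym _ cC) -sumr_const -sumrB; apply: rpred_sum => Y.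
rewrite in_setD => /andP[YC Yg]; have [nY|nY] := boolP (nontransverse H Y).
  by rewrite -raddfB coset_part_ann_eB // reach_ann_eB.
(* [Y] leaves and [H] enters; as they are not non-transverse, no reflection of nonzero weight
   carries [gB] to [C], so both terms vanish. *)
suff z0 Z : cp C (reach H Z g) = 0 by rewrite !z0 subrr rpred0.
apply/ffunP => h; rewrite ffunE reachE [RHS]ffunE.
case: eqP => // hC; case: eqP => // sZ; apply/eqP; apply: contraNT nY => m0.
have [sR imh] := refl_im m0; rewrite nontransverse_sym.
by apply: (reflection_collection_nontransverse (tc_im g) sR); rewrite // -imh hC.
Qed.

(** A reflection that gains [H] cannot lose [X], since the two are transverse. *)
Lemma hyp_proj_switch_comm H X g : transverse H X -> X \in im g -> H \notin im g ->
  D X (D H (Xi (dl g))) = D H (Xi (dl g)).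
Proof.
move=> tr Xg Hg; apply/ffunP => h; rewrite ffunE [D H _ h]ffunE switch_delta.
case: (boolP (H \in im h)) => Hh; last by case: ifP.
case: (boolP (X \in im h)) => // Xh.
have [->|m0] := eqVneq (mm (h * g^-1)%g) 0; first by rewrite mul0r.
have [sR imh] := refl_im m0; rewrite imh in Hh Xh.
have := reflection_collection_nontransverse (tc_im g) sR Xg Xh Hh Hg.
by rewrite nontransverse_sym => /nontransverseN; rewrite tr.
Qed.

(** [delta] on the [h] with [H] in [hB]; the other basis vectors are switched into their span. The
    outer [D H] makes (B1) immediate. *)
Definition e_op H x : KW := del *: D H x + D H (Xi (x - D H x)).

Lemma e_op_linear H : linear (e_op H).
Proof.
move=> a x z; rewrite /e_op.
have -> : a *: x + z - D H (a *: x + z) = a *: (x - D H x) + (z - D H z).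
  by rewrite linearP scalerBr opprD addrACA.
by rewrite !linearP /= addrACA !scalerA [del * a]mulrC.
Qed.
HB.instance Definition _ H := GRing.isLinear.Build K KW KW _ (e_op H) (e_op_linear H).
Local Notation E := e_op.

Lemma e_op_proj H x : E H (D H x) = del *: D H x.
Proof. by rewrite /e_op hyp_projK subrr raddf0 raddf0 addr0. Qed.

Lemma e_op_im H x : D H (E H x) = E H x.
Proof. by rewrite /e_op linearD linearZ /= !hyp_projK. Qed.

Lemma e_opM H x : E H (E H x) = del *: E H x.
Proof. by rewrite -[E H x in LHS]e_op_im e_op_proj e_op_im. Qed.

Lemma ltrans_e_op w H x : ltrans w (E H x) = E (hact w H) (ltrans w x).
Proof.
by rewrite /e_op linearD linearZ /= !ltrans_hyp_proj -switch_ltrans linearB /= ltrans_hyp_proj.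
Qed.

Lemma e_op_ann H x : x \in Ann -> E H x \in Ann.
Proof.
move=> xA; rewrite rpredD ?rpredZ ?hyp_proj_ann //.
by apply/switch_ann/rpredB => //; exact: hyp_proj_ann.
Qed.

Lemma e_op_delta H g :
  E H (dl g) = if H \in im g then del *: dl g else D H (Xi (dl g)).
Proof.
have := hyp_proj_delta K B H g; case: ifP => _ DE; first by rewrite -{1}DE e_op_proj DE.
by rewrite /e_op DE scaler0 add0r subr0.
Qed.

Lemma hyp_proj_fix w H x : (ssval H <= fix_space w)%VS ->
  ltrans w (D H x) - D H x \in Ann.
Proof.
move=> fixH; pose F := ((linfun (ltrans w) - \1) \o linfun (D H))%VF : 'End({ffun W -> K^o}).
have FE z : F z = ltrans w (D H z) - D H z.
  by rewrite comp_lfunE add_lfunE opp_lfunE id_lfunE !lfunE.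
rewrite -FE; apply: ann_lfun => g; rewrite FE hyp_proj_delta.
case: ifP => [Hg|_]; last by rewrite subr0 raddf0 rpred0.
rewrite ltrans_delta; apply: sub_ann_eB => //; rewrite mem_ann_eB raddfB /= !mul_eB_delta.
by rewrite brauer_wM -mulrA brauer_w_eB // mulrA (brauer_fix_eB phi Hg) // subrr.
Qed.

Lemma e_op_nontransverse H X x : nontransverse H X ->
  E H (D X x) - \sum_(s | hact s X == H) mm s *: ltrans s (D X x) \in Ann.
Proof.
move=> ntr.
pose F := ((linfun (E H) - \sum_(s | hact s X == H) mm s *: linfun (ltrans s))
  \o linfun (D X))%VF : 'End({ffun W -> K^o}).
have FE z : F z = E H (D X z) - \sum_(s | hact s X == H) mm s *: ltrans s (D X z).
  rewrite comp_lfunE add_lfunE opp_lfunE sum_lfunE !lfunE; congr (_ - _).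
  by apply: eq_bigr => s _; rewrite scale_lfunE lfunE.
rewrite -FE; apply: ann_lfun => g; rewrite FE hyp_proj_delta.
case: ifP => [Xg|_]; last first.
  by rewrite raddf0 big1 ?subr0 ?rpred0 // => s _; rewrite raddf0 scaler0.
have Hg : H \notin im g.
  apply/negP => Hg; have /transverse_collectionP h := tc_im g.
  by have := nontransverseN ntr; rewrite h // nontransverse_neq.
rewrite e_op_delta (negPf Hg) (eq_bigr (fun s => mm s *: dl (s * g)%g)).
  exact: hyp_proj_switch_delta.
by move=> s _; rewrite ltrans_delta.
Qed.

End ModuleRelations.

(** * Commutation of the [e_H] for transverse hyperplanes *)

Section ModuleCommutation.
Variables (R : realType) (W : complexReflectionGroup R).
Variables (K : fieldType) (phi : {rmorphism paramRing W -> K}).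
Local Notation del := (phi (delta W)).
Local Notation mm := (@refl_coef R W K phi).
Local Notation tc := (transverse_collections W).
Local Notation KW := (group_alg K W).
Implicit Types (w g h s : W) (H X Y : hyp W) (C : {set hyp W}) (x z : group_alg K W).
Variable B : {set hyp W}.
Hypothesis tcB : B \in tc.
Hypothesis natK : forall n, (n%:R == 0 :> K) = (n == 0)%N.
Local Notation im g := (hact g @: B).
Local Notation dl := (@ga_delta K W).
Local Notation Ann := (ann phi B).
Local Notation D := (hyp_proj B).
Local Notation Xi := (switch phi B).
Local Notation cp := (coset_part B).
Local Notation E := (e_op phi B).

Definition refl_sum x : KW := \sum_s mm s *: ltrans s x.

Definition refl_diag x : KW :=
  [ffun h => \sum_g (if im h == im g then mm (h * g^-1)%g else 0) * x g].

Definition refl_off x : KW :=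
  [ffun h => \sum_g (if im h == im g then 0 else mm (h * g^-1)%g) * x g].

Lemma refl_diag_linear : linear refl_diag.
Proof.
move=> a u v; apply/ffunP => h; rewrite !ffunE scaler_sumr -big_split /=.
by apply: eq_bigr => g _; rewrite !ffunE mulrDr; congr (_ + _); exact: mulrCA.
Qed.
HB.instance Definition _ := GRing.isLinear.Build K KW KW _ refl_diag refl_diag_linear.

Lemma refl_sumE x h : refl_sum x h = \sum_g mm (h * g^-1)%g * x g.
Proof.
rewrite sum_ffunE.
have inv_bij : {on predT, bijective (fun g : W => (h * g^-1)%g)}.
  by exists (fun s => (s^-1 * h)%g) => g _; rewrite ?invMg ?invgK ?mulgKV ?mulKVg // mulgA mulgKV.
rewrite (reindex (fun g : W => (h * g^-1)%g)) //; apply: eq_bigr => g _.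
by rewrite !ffunE invMg invgK mulgKV.
Qed.

Lemma refl_sum_split x : refl_sum x = refl_diag x + refl_off x.
Proof.
apply/ffunP => h; rewrite refl_sumE !ffunE -big_split; apply: eq_bigr => g _ /=.
by case: ifP => _; rewrite mul0r ?addr0 ?add0r.
Qed.

Lemma hyp_proj_refl_diag H x : D H (refl_diag x) = refl_diag (D H x).
Proof.
apply/ffunP => h; rewrite !ffunE; case: ifP => Hh.
  by apply: eq_bigr => g _; rewrite ffunE; case: eqP => [<-|_]; rewrite ?Hh // !mul0r.
rewrite big1 // => g _; rewrite ffunE; case: eqP => [<-|_]; last by rewrite mul0r.
by rewrite Hh mulr0.
Qed.

Lemma switch_coef_im h g l : im l = im g -> switch_coef K B h l = switch_coef K B h g.
Proof. by rewrite /switch_coef => ->. Qed.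

Lemma switch_coef_iml h g l : im l = im h -> switch_coef K B l g = switch_coef K B h g.
Proof. by rewrite /switch_coef => ->. Qed.

(* Both sides have the same kernel, by the Hurwitz move [l |-> h l^-1 g]. *)
Lemma switch_refl_diag x : Xi (refl_diag x) = refl_diag (Xi x).
Proof.
apply/ffunP => h; rewrite !ffunE.
transitivity (\sum_g (\sum_(l | im l == im g) mm (h * l^-1)%g * switch_coef K B h l
                        * mm (l * g^-1)%g) * x g).
  under eq_bigr do rewrite ffunE mulr_sumr.
  rewrite exchange_big; apply: eq_bigr => g _; rewrite mulr_suml [RHS]big_mkcond.
  by apply: eq_bigr => l _; case: ifP => _; rewrite ?mul0r ?mulr0 // mulrA.
symmetry; transitivity (\sum_g (\sum_(l | im h == im l) mm (h * l^-1)%g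
    * (mm (l * g^-1)%g * switch_coef K B l g)) * x g).
  under eq_bigr do rewrite ffunE mulr_sumr.
  rewrite exchange_big; apply: eq_bigr => g _; rewrite mulr_suml [RHS]big_mkcond.
  by apply: eq_bigr => l _; case: ifP => _; rewrite ?mul0r ?mulr0 // mulrA.
apply: eq_bigr => g _; congr (_ * _).
(* The pair [(h l^-1, l g^-1)] becomes a conjugate of [l g^-1] followed by [h l^-1]: the two
   reflections are exchanged, and their weights depend only on conjugacy classes. *)
rewrite (reindex (fun l : W => (h * l^-1 * g)%g)); last first.
  exists (fun l => (g * l^-1 * h)%g) => l _.
    by rewrite !invMg !invgK !mulgA mulgV mul1g mulgKV.
  by rewrite !invMg !invgK !mulgA mulgV mul1g mulgKV.
have imE l : (im h == im (h * l^-1 * g)%g) = (im l == im g).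
  rewrite -mulgA hact_imsetM (inj_eq (imset_inj (@hact_inj _ _ h))).
  rewrite -[in RHS](inj_eq (imset_inj (@hact_inj _ _ l^-1%g))).
  by rewrite -!hact_imsetM mulVg hact_imset1.
apply: eq_big => l; first exact: imE.
rewrite imE => /eqP lg; have hlg : im (h * l^-1 * g)%g = im h.
  by apply/esym/eqP; rewrite imE lg.
rewrite (switch_coef_iml _ hlg) (switch_coef_im _ lg) mulgK.
have -> : (h * (h * l^-1 * g)^-1)%g = (h * (g^-1 * l) * h^-1)%g.
  by rewrite !invMg invgK !mulgA.
have -> : (l * g^-1)%g = (g * (g^-1 * l) * g^-1)%g by rewrite mulgA mulgV mul1g.
by rewrite !refl_coefJ mulrC.
Qed.

Lemma e_op_refl_diag H x : E H (refl_diag x) = refl_diag (E H x).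
Proof.
rewrite {1}/e_op hyp_proj_refl_diag -linearB switch_refl_diag hyp_proj_refl_diag.
by rewrite -linearZ -linearD.
Qed.

(** The entry of [Xi] from [g] to [h] is counted once for each [H] in [hB] outside [gB], and its
    weight is the inverse of that number. *)
Lemma sum_e_op x : \sum_H E H x = (#|B|%:R * del) *: x + refl_off x.
Proof.
have sumD z h : \sum_H D H z h = #|B|%:R * z h.
  under eq_bigr do rewrite ffunE.
  by rewrite -big_mkcond sumr_const card_hact mulr_natl.
rewrite /e_op big_split /= -scaler_sumr; apply/ffunP => h.
rewrite !ffunE !sum_ffunE; congr (_ + _).
  by rewrite sumD /GRing.scale /= mulrCA mulrA.
under eq_bigr do rewrite 2!ffunE.
pose t H g : K := mm (h * g^-1)%g * switch_coef K B h g * (x - D H x) g.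
rewrite (eq_bigr (fun H => \sum_g (if H \in im h then t H g else 0))); last first.
  by move=> H _; case: ifP => // _; rewrite big1.
rewrite exchange_big; apply: eq_bigr => g _; rewrite -big_mkcond /=.
rewrite (eq_bigr (fun H => if H \notin im g
    then mm (h * g^-1)%g * switch_coef K B h g * x g else 0)); last first.
  move=> H _; rewrite /t !ffunE; case: ifP => _; last by rewrite subr0.
  by rewrite subrr mulr0.
rewrite -big_mkcondr /= sumr_const -mulr_natl.
have -> : #|[pred i in im h | i \notin im g]| = #|im h :\: im g|.
  by apply: eq_card => H; rewrite in_setD inE andbC.
rewrite /switch_coef; case: eqP => hg; first by rewrite mulr0 !mul0r mulr0.
rewrite !mulrA [_ * mm _]mulrC -!mulrA; congr (_ * _); rewrite mulrA mulfV ?mul1r //.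
rewrite natK cards_eq0 setD_eq0; apply/negP => sub; apply: hg.
by apply/eqP; rewrite eqEcard sub !card_hact leqnn.
Qed.

(* [sum_s mu_s s - sum_H e_H] acts block-diagonally, hence commutes with [e_H]. *)
Lemma sum_e_op_comm H x :
  \sum_X (E H (E X x) - E X (E H x)) = E H (refl_sum x) - refl_sum (E H x).
Proof.
have -> : \sum_X (E H (E X x) - E X (E H x)) = E H (\sum_X E X x) - \sum_X E X (E H x).
  by rewrite linear_sum -sumrB.
have DZ a u v : E H (a *: u + v) = a *: E H u + E H v by rewrite linearP.
have DD u v : E H (u + v) = E H u + E H v by rewrite linearD.
rewrite !sum_e_op DZ opprD addrACA subrr add0r.
by rewrite !refl_sum_split DD e_op_refl_diag opprD addrACA subrr add0r.
Qed.

(** Every reflection [s] moving [H] occurs once: for [X = s^-1 H] in the first sum, for [X = sH] in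
    the second. Both are non-transverse to [H]. *)
Lemma sum_nontransverse (H : hyp W) (F : W -> KW) :
    (forall s, mm s = 0 -> F s = 0) ->
  (\sum_(X | nontransverse H X) \sum_(s | hact s X == H) F s
     = \sum_(s | hact s H != H) F s) /\
  (\sum_(X | nontransverse H X) \sum_(s | hact s H == X) F s
     = \sum_(s | hact s H != H) F s).
Proof.
move=> F0; split; rewrite (exchange_big_dep predT) //= [RHS]big_mkcond /=;
    apply: eq_bigr => s _.
  have [/F0 ->|m0] := eqVneq (mm s) 0; first by rewrite if_same big1.
  rewrite (eq_bigl (fun X => (X == hact s^-1%g H) && nontransverse H X)); last first.
    by move=> X; rewrite andbC -(inj_eq (@hact_inj _ _ s) X) hactKV.
  rewrite big_mkcondr big_pred1_eq -(nontransverse_act s) hactKV nontransverse_sym.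
  case: (eqVneq (hact s H) H) => [->|sH]; first by rewrite /nontransverse eqxx.
  by rewrite reflection_nontransverse // (refl_coef_neq0 m0).
have [/F0 ->|m0] := eqVneq (mm s) 0; first by rewrite if_same big1.
rewrite (eq_bigl (fun X => (X == hact s H) && nontransverse H X)) => [|X]; last first.
  by rewrite andbC [hact s H == X]eq_sym.
rewrite big_mkcondr big_pred1_eq.
case: (eqVneq (hact s H) H) => [->|sH]; first by rewrite /nontransverse eqxx.
by rewrite reflection_nontransverse // (refl_coef_neq0 m0).
Qed.

(** By (B5), [e_H e_X] is the sum of the [mu_s e_H s] with [sX = H], and [e_X e_H] that of the
    [mu_s s e_H] with [sH = X]. Over all [X] this gives the commutator of [e_H] with the reflections
    that move [H]; the others commute with [e_H]. *)
Lemma sum_e_op_comm_nontransverse H x :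
  \sum_(X | nontransverse H X) (E H (E X x) - E X (E H x))
    - (E H (refl_sum x) - refl_sum (E H x)) \in Ann.
Proof.
pose F s : KW := mm s *: E H (ltrans s x); pose G s : KW := mm s *: ltrans s (E H x).
have F0 s : mm s = 0 -> F s = 0 by rewrite /F => ->; rewrite scale0r.
have G0 s : mm s = 0 -> G s = 0 by rewrite /G => ->; rewrite scale0r.
have -> : E H (refl_sum x) - refl_sum (E H x) = \sum_(X | nontransverse H X)
   (\sum_(s | hact s X == H) F s - \sum_(s | hact s H == X) G s).
  rewrite sumrB; have [-> _] := sum_nontransverse H F0.
  have [_ ->] := sum_nontransverse H G0; rewrite -sumrB.
  have -> : E H (refl_sum x) = \sum_s F s.
    by rewrite raddf_sum /=; apply: eq_bigr => s _; rewrite linearZ.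
  rewrite -sumrB [LHS](bigID (fun s => hact s H != H)) /=.
  rewrite [X in _ + X]big1 ?addr0 // => s /negPn/eqP sH.
  by rewrite /F /G ltrans_e_op sH subrr.
rewrite -sumrB; apply: rpred_sum => X ntr.
have h1 : E H (E X x) - \sum_(s | hact s X == H) F s \in Ann.
  have := e_op_nontransverse phi tcB natK (E X x) ntr; rewrite e_op_im.
  rewrite (eq_bigr F) // => s /eqP sX; rewrite /F.
  by rewrite ltrans_e_op // sX.
have h2 : E X (E H x) - \sum_(s | hact s H == X) G s \in Ann.
  rewrite nontransverse_sym in ntr.
  by have := e_op_nontransverse phi tcB natK (E H x) ntr; rewrite e_op_im.
suff aux (a b f f' : KW) : a - f \in Ann -> b - f' \in Ann -> a - b - (f - f') \in Ann.
  exact: aux.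
move=> af bf; have -> : a - b - (f - f') = (a - f) - (b - f'); last exact: rpredB.
by rewrite !opprD !opprK !addrA (addrAC a).
Qed.

(** The commutators with all [X] and those with non-transverse [X] have the same sum modulo [Ann].
    Separating the remaining terms is the task of the lemmas that follow. *)
Lemma sum_e_op_comm_transverse H x :
  \sum_(X | transverse H X) (E H (E X x) - E X (E H x)) \in Ann.
Proof.
pose c X := E H (E X x) - E X (E H x).
have nt : \sum_(X | nontransverse H X) c X - \sum_X c X \in Ann.
  by have := sum_e_op_comm_nontransverse H x; rewrite -sum_e_op_comm.
suff E1 : \sum_X c X = \sum_(X | transverse H X) c X + \sum_(X | nontransverse H X) c X.
  by move: nt; rewrite E1 opprD addrCA subrr addr0 rpredN.
rewrite (bigID (transverse H)) /=; congr (_ + _).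
rewrite (bigD1 H) /=; last by rewrite /transverse eqxx.
rewrite {1}/c subrr add0r; apply: eq_bigl => X.
by rewrite /nontransverse andbC eq_sym.
Qed.

Definition two_step X g : KW := Xi (D X (Xi (dl g))).
Local Notation G := two_step.

Lemma hyp_proj_switch_stable H X x : transverse H X ->
  D X (D H (Xi (D X x - D H (D X x)))) = D H (Xi (D X x - D H (D X x))).
Proof.
move=> tr.
pose P := (linfun Xi \o (linfun (D X) - (linfun (D H) \o linfun (D X))))%VF : 'End({ffun W -> K^o}).
have PE z : P z = Xi (D X z - D H (D X z)).
  by rewrite comp_lfunE add_lfunE opp_lfunE comp_lfunE !lfunE.
rewrite -PE [x]sum_delta !linear_sum; apply: eq_bigr => g _.
rewrite !linearZ /= PE hyp_proj_delta; congr (_ *: _).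
case: ifP => [Xg|_]; last by rewrite sub0r [D H 0]raddf0 oppr0 !raddf0.
rewrite hyp_proj_delta; case: ifP => [_|/negbT Hg]; first by rewrite subrr !raddf0.
by rewrite subr0 hyp_proj_switch_comm.
Qed.

(** In the expansion of [e_H e_X g], the terms containing [D H (D X (Xi g))] are symmetric in [H]
    and [X] and cancel; what remains are the two-step terms. *)
Lemma e_op_comm_delta H X g : transverse H X -> H \notin im g ->
  E H (E X (dl g)) - E X (E H (dl g)) =
    if X \in im g then 0 else D H (D X (G X g - G H g)).
Proof.
move=> tr Hg; rewrite !e_op_delta (negPf Hg); case: (boolP (X \in im g)) => Xg.
  rewrite linearZ /= e_op_delta (negPf Hg).
  rewrite -{2}(hyp_proj_switch_comm phi tcB tr Xg Hg) e_op_proj.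
  by rewrite (hyp_proj_switch_comm phi tcB tr Xg Hg) subrr.
have tr' : transverse X H by rewrite transverse_sym.
set u := Xi (dl g); rewrite {1 2}/e_op.
rewrite -(hyp_proj_switch_stable u tr) -(hyp_proj_switch_stable u tr').
rewrite (hyp_projC B X H u) (hyp_projC B X H (Xi _)) opprD addrACA subrr add0r.
rewrite /two_step -/u -!raddfB /=; congr (D H (D X (Xi _))).
by rewrite (linearB (D H)) /= opprB addrA subrK.
Qed.

(** The [C]-part of the sum of commutators sees only the [X] in [C] outside [gB]. Inside [C] such an
    [X] is transverse to [H] or equal to it, and [X = H] contributes zero. *)
Lemma two_step_sum C H g : C \in tc -> #|C| = #|B| -> H \in C -> H \notin im g ->
  \sum_(X in C :\: im g) (cp C (G X g) - cp C (G H g)) \in Ann.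
Proof.
move=> /transverse_collectionP tcC cC HC Hg.
have := coset_part_ann C (sum_e_op_comm_transverse H (dl g)).
rewrite raddf_sum /= (bigID (fun X => X \in C :\: im g)) /= [X in _ + X]big1 => [|X]; last first.
  case/andP=> tr XC; rewrite e_op_comm_delta //; case: ifP => [_|/negbT Xg]; first exact: raddf0.
  rewrite !coset_part_hyp_proj HC; case: ifP => // XC'.
  by case/negP: XC; rewrite in_setD Xg.
rewrite addr0 => h; rewrite (bigID (transverse H)) /= [X in _ + X]big1 ?addr0 => [|X]; last first.
  case/andP; rewrite in_setD => /andP[_ XC] ntr.
  have [->|XH] := eqVneq X H; first by rewrite subrr.
  by case/negP: ntr; apply: tcC; rewrite // eq_sym.
move: h; rewrite (eq_bigl (fun X => (X \in C :\: im g) && transverse H X)) => [|X]; last first.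
  exact: andbC.
rewrite (eq_bigr (fun X => cp C (G X g) - cp C (G H g))) // => X /andP[].
rewrite in_setD => /andP[Xg XC] tr.
by rewrite e_op_comm_delta // (negPf Xg) !coset_part_hyp_proj HC XC raddfB.
Qed.

(** The relations of [two_step_sum] for [H] and for [X] have the same index set; their difference is
    [|C - gB|] times the claim. *)
Lemma two_step_indep C H X g : C \in tc -> #|C| = #|B| -> H \in C -> X \in C ->
  H \notin im g -> X \notin im g -> cp C (G X g) - cp C (G H g) \in Ann.
Proof.
move=> tcC cC HC XC Hg Xg; have c0 := card_setD_neq0 natK HC Hg.
rewrite -[Y in Y \in _](scalerK c0) rpredZ // scaler_nat -sumr_const.
have -> : \sum_(Y in C :\: im g) (cp C (G X g) - cp C (G H g)) =
   \sum_(Y in C :\: im g) (cp C (G Y g) - cp C (G H g))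
   - \sum_(Y in C :\: im g) (cp C (G Y g) - cp C (G X g)).
  by rewrite -sumrB; apply: eq_bigr => Y _; rewrite opprB [RHS]addrC addrA subrK.
by rewrite rpredB // two_step_sum.
Qed.

Lemma e_op_transverse H X x : transverse H X -> E H (E X x) - E X (E H x) \in Ann.
Proof.
move=> tr; pose F := ((linfun (E H) \o linfun (E X)) - (linfun (E X) \o linfun (E H)))%VF
  : 'End({ffun W -> K^o}).
have FE z : F z = E H (E X z) - E X (E H z).
  by rewrite add_lfunE opp_lfunE !comp_lfunE !lfunE.
rewrite -FE; apply: ann_lfun => g; rewrite FE.
have tr' : transverse X H by rewrite transverse_sym.
have [Hg|Hg] := boolP (H \in im g).
  have [Xg|Xg] := boolP (X \in im g).
    by rewrite !e_op_delta Hg Xg [E H _]linearZ [E X _]linearZ /= !e_op_delta Hg Xg subrr rpred0.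
  by rewrite -opprB rpredN e_op_comm_delta // Hg rpred0.
rewrite e_op_comm_delta //; case: ifP => [_|/negbT Xg]; first exact: rpred0.
rewrite [D _ _](sum_coset_part _ tcB); apply: rpred_sum => C /andP[tcC /eqP cC].
rewrite !coset_part_hyp_proj; case: ifP => HC; last exact: rpred0.
case: ifP => XC; last exact: rpred0.
by rewrite raddfB two_step_indep.
Qed.

End ModuleCommutation.

(** * The representation on [KW/Ann(B)] *)

Section ModuleRepresentation.
Variables (R : realType) (W : complexReflectionGroup R).
Variables (K : fieldType) (phi : {rmorphism paramRing W -> K}).
Local Notation ww := (@brauer_w R W K phi).
Local Notation ee := (@brauer_e R W K phi).
Local Notation EB := (@brauer_eB R W K phi).
Local Notation del := (phi (delta W)).
Local Notation tc := (transverse_collections W).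
Local Notation inI := (@brauer_ideal R W K phi).
Local Notation mB := (@mul_eB R W K phi).
Local Notation KW := {ffun W -> K^o}.
Implicit Types (w g h s : W) (H X Y : hyp W) (C : {set hyp W}) (x z v : KW).
Variable B : {set hyp W}.
Hypothesis tcB : B \in tc.
Hypothesis natK : forall n, (n%:R == 0 :> K) = (n == 0)%N.
Hypothesis del0 : del != 0.
Local Notation im g := (hact g @: B).
Local Notation dl := (@ga_delta K W).
Local Notation Ann := (ann phi B).
Local Notation D := (hyp_proj B).
Local Notation E := (e_op phi B).

Section Compression.
(* [pr] is a projection with kernel [Ann]; compressing by it replaces the quotient
   by [Ann]. *)
Variable pr : 'End(KW).
Hypothesis ann_compl_sub : forall v, v - pr v \in Ann.
Hypothesis ann_compl_eq0 : forall v, (pr v == 0) = (v \in Ann).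

Lemma ann_compl_cong u v : u - v \in Ann -> pr u = pr v.
Proof. by rewrite -ann_compl_eq0 linearB subr_eq0 => /eqP. Qed.

Lemma ann_complK v : pr (pr v) = pr v.
Proof. by apply/esym/ann_compl_cong/ann_compl_sub. Qed.

Lemma ann_compl_add u v : pr (pr u + (v - pr v)) = pr u.
Proof. by rewrite linearD linearB /= !ann_complK subrr addr0. Qed.

Lemma ann_compl_ltrans w v : pr (ltrans w (pr v)) = pr (ltrans w v).
Proof.
apply/esym/ann_compl_cong; rewrite -raddfB; exact/ltrans_ann/ann_compl_sub.
Qed.

Lemma ann_compl_e_op H v : pr (E H (pr v)) = pr (E H v).
Proof.
apply/esym/ann_compl_cong; rewrite -raddfB; exact/e_op_ann/ann_compl_sub.
Qed.

Fact group_alg_proper : (0 < dim KW)%N.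
Proof.
rewrite lt0n -dimvf dimv_eq0; apply/eqP => V0.
have : dl 1%g \in (fullv : {vspace KW}) by rewrite memvf.
rewrite V0 memv0 => /eqP/ffunP/(_ 1%g); rewrite !ffunE eqxx => /eqP.
by rewrite oner_eq0.
Qed.

Local Notation S := (lfun_comp_nzRingType group_alg_proper).

Lemma mulSE (f g : S) v : (f * g : S) v = (f : 'End(KW)) ((g : 'End(KW)) v).
Proof. exact: comp_lfunE. Qed.

Definition scalar_end (a : K) : S := (a *: \1)%VF.

Fact scalar_end_zmod : zmod_morphism scalar_end.
Proof. by move=> a b; exact: scalerBl. Qed.

Fact scalar_end_monoid : monoid_morphism scalar_end.
Proof.
split; first exact: scale1r.
move=> a b; apply/lfunP => v; rewrite [RHS]mulSE.
by rewrite !scale_lfunE !id_lfunE scalerA.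
Qed.

HB.instance Definition _ := GRing.isZmodMorphism.Build K S scalar_end scalar_end_zmod.
HB.instance Definition _ := GRing.isMonoidMorphism.Build K S scalar_end scalar_end_monoid.

Lemma scalar_endE a (f : S) v : (scalar_end a * f : S) v = a *: (f : 'End(KW)) v.
Proof. by rewrite mulSE scale_lfunE id_lfunE. Qed.

(** The summand [\1 - pr] lets the identity of [W] act as the unit of the endomorphism ring, which
    is [\1] and not [pr]. *)
Definition end_w w : S := ((pr \o (linfun (ltrans w) \o pr)) + (\1 - pr))%VF.
Definition end_e H : S := (pr \o (linfun (E H) \o pr))%VF.

Lemma end_wE w v : (end_w w : 'End(KW)) v = pr (ltrans w v) + (v - pr v).
Proof.
rewrite [LHS]add_lfunE [X in X + _]comp_lfunE [X in pr X]comp_lfunE [linfun _ _]lfunE /=.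
by rewrite [X in _ + X]add_lfunE opp_lfunE id_lfunE ann_compl_ltrans.
Qed.

Lemma end_eE H v : (end_e H : 'End(KW)) v = pr (E H v).
Proof.
by rewrite [LHS]comp_lfunE [X in pr X]comp_lfunE [linfun _ _]lfunE /= ann_compl_e_op.
Qed.

Lemma end_e_compl H v : pr ((end_e H : 'End(KW)) v) = (end_e H : 'End(KW)) v.
Proof. by rewrite end_eE ann_complK. Qed.

Lemma end_w_compl w v : pr v = v -> (end_w w : 'End(KW)) v = pr (ltrans w v).
Proof. by move=> vE; rewrite end_wE vE subrr addr0. Qed.

Lemma end_wMe w H v : (end_w w * end_e H : S) v = pr (ltrans w (E H v)).
Proof. by rewrite mulSE end_w_compl ?end_e_compl // end_eE ann_compl_ltrans. Qed.

Lemma end_eMe H X v : (end_e H * end_e X : S) v = pr (E H (E X v)).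
Proof. by rewrite mulSE !end_eE ann_compl_e_op. Qed.

Lemma end_eMw H w v : (end_e H * end_w w : S) v = pr (E H (ltrans w v)).
Proof.
by rewrite mulSE end_eE -ann_compl_e_op end_wE ann_compl_add ann_compl_e_op.
Qed.

Lemma sumSE (I : finType) (P : pred I) (F : I -> S) v :
  ((\sum_(i | P i) F i : S) : 'End(KW)) v = \sum_(i | P i) (F i : 'End(KW)) v.
Proof. exact: sum_lfunE. Qed.

Lemma module_rep : exists rho : brauer_ext phi -> S,
  [/\ {morph rho : a b / a + b}, {morph rho : a b / a * b} & rho 1 = 1] /\
  [/\ forall a b, rho (a *: b) = scalar_end a * rho b,
      forall w, rho (ww w) = end_w w & forall H, rho (ee H) = end_e H].
Proof.
apply: brauer_ext_rep.
- move=> a f; apply/lfunP => v; rewrite scalar_endE mulSE.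
  by rewrite scale_lfunE id_lfunE linearZ.
- by apply/lfunP => v; rewrite end_wE ltrans1 addrC subrK [RHS]id_lfunE.
- move=> g w; apply/lfunP => v; rewrite mulSE !end_wE ltransM ann_compl_add.
  rewrite -ann_compl_ltrans -[X in _ = X + _]ann_compl_ltrans ann_compl_add.
  by rewrite [X in _ = _ + X]addrAC subrr add0r.
- by move=> H; apply/lfunP => v; rewrite end_eMe e_opM // linearZ scalar_endE end_eE.
- by move=> w H; apply/lfunP => v; rewrite end_wMe end_eMw ltrans_e_op.
- move=> w H fixH; apply/lfunP => v; rewrite end_wMe end_eE -e_op_im.
  by apply: ann_compl_cong; exact: hyp_proj_fix.
- move=> H X tr; apply/lfunP => v; rewrite !end_eMe.
  by apply: ann_compl_cong; exact: e_op_transverse.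
- move=> H X ntr; apply/lfunP => v; rewrite end_eMe [RHS]sumSE.
  under eq_bigr do rewrite scalar_endE end_wMe -linearZ.
  rewrite -linear_sum /=; apply: ann_compl_cong; rewrite -(e_op_im phi B X v).
  exact: e_op_nontransverse.
Qed.

Lemma foldr_hyp_proj t v h : foldr (fun H x => D H x) v t h =
  if all (fun H => H \in im h) t then v h else 0.
Proof. by elim: t => //= H t IH; rewrite ffunE IH; case: (H \in im h). Qed.

Lemma mul_eB_ann_compressed v : inI #|B|.+1 (mB B v) -> v \in Ann.
Proof.
have [rho [[rhoD rhoM rho1] [rhoZ rhow rhoe]]] := module_rep.
have rhoZE a b u : (rho (a *: b) : 'End(KW)) u = a *: (rho b : 'End(KW)) u.
  by rewrite rhoZ scalar_endE.
have rhoME a b u : (rho (a * b) : 'End(KW)) u = (rho a : 'End(KW)) ((rho b : 'End(KW)) u).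
  by rewrite rhoM mulSE.
have rhoDE a b u : (rho (a + b) : 'End(KW)) u = (rho a : 'End(KW)) u + (rho b : 'End(KW)) u.
  by rewrite rhoD; exact: add_lfunE.
have rho0E u : (rho 0 : 'End(KW)) u = 0.
  by rewrite -[0 in LHS](scale0r 0) rhoZE scale0r.
(* Any factor [e_H] of [e_C] can be put first, so [z] is fixed by every [D H], [H] in [C], modulo
   [Ann]; the composite of these projections is zero, as no [hB] is large enough to contain [C]. *)
have rho_big C u : C \in tc -> (#|B| < #|C|)%N -> (rho (EB C) : 'End(KW)) u = 0.
  move=> tcC ltC; set z := (rho (EB C) : 'End(KW)) u.
  have DzH H : H \in C -> pr z = z /\ D H z - z \in Ann.
    move=> HC; have [t ->] : exists t, z = pr (E H t).
      exists ((rho (EB (C :\ H)) : 'End(KW)) u).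
      by rewrite /z (brauer_eBD1 phi HC tcC) rhoME rhoe end_eE.
    rewrite ann_complK; split=> //; set e := E H t.
    have -> : D H (pr e) - pr e = (e - pr e) - D H (e - pr e).
      have De : D H e = e by exact: e_op_im.
      by rewrite linearB /= De opprB [RHS]addrC addrA subrK.
    by rewrite rpredB // hyp_proj_ann.
  have [H HC] : exists H, H \in C by apply/card_gt0P; exact: leq_ltn_trans ltC.
  have [<- _] := DzH H HC; apply/eqP; rewrite ann_compl_eq0.
  have foldA t : {subset t <= C} -> foldr (fun H x => D H x) z t - z \in Ann.
    elim: t => [|X t IH] tC /=; first by rewrite subrr rpred0.
    rewrite -[X in X \in _](subrKA (D X z)) -linearB rpredD //=.
      by apply/hyp_proj_ann/IH => Y Yt; apply: tC; rewrite inE Yt orbT.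
    by have [] := DzH X (tC X (mem_head _ _)).
  have : foldr (fun H x => D H x) z (elems C) - z \in Ann.
    by apply: foldA => X; rewrite mem_elems.
  rewrite (_ : foldr _ _ _ = 0) ?sub0r ?rpredN //; apply/ffunP => h.
  rewrite foldr_hyp_proj all_elems [RHS]ffunE; case: ifP => // sCB.
  have /subset_leq_card : C \subset im h by apply/subsetP => X XC; exact: (subsetP sCB).
  by rewrite card_hact leqNgt ltC.
have rho_ideal a : inI #|B|.+1 a -> forall u, (rho a : 'End(KW)) u = 0.
  elim=> [|c w C {}a tcC ltC _ IH] u; first exact: rho0E.
  by rewrite rhoDE rhoZE rhoME rho_big // IH linear0 scaler0 addr0.
move/rho_ideal/(_ (pr (dl 1%g))).
have rho_eB t : {subset t <= B} ->
    (rho (\prod_(H <- t) ee H) : 'End(KW)) (pr (dl 1%g)) = del ^+ size t *: pr (dl 1%g).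
  elim: t => [|H t IH] tB; first by rewrite big_nil rho1 id_lfunE scale1r.
  rewrite big_cons rhoME IH => [|X Xt]; last by apply: tB; rewrite inE Xt orbT.
  rewrite linearZ /= rhoe end_eE ann_compl_e_op e_op_delta hact_imset1 tB ?mem_head //.
  by rewrite linearZ scalerA -exprSr.
have -> : (rho (mB B v) : 'End(KW)) (pr (dl 1%g)) = del ^+ #|B| *: pr v.
  rewrite mul_eBE (big_morph (fun a => (rho a : 'End(KW)) (pr (dl 1%g)))
    (id1 := 0) (op1 := +%R)); [|by move=> a b; exact: rhoDE|exact: rho0E].
  rewrite [v in RHS]sum_delta !linear_sum; apply: eq_bigr => w _.
  rewrite rhoZE rhoME brauer_eB_elems rho_eB => [|X]; last by rewrite mem_elems.
  rewrite size_elems linearZ /= rhow end_w_compl ?ann_complK // ann_compl_ltrans.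
  by rewrite ltrans_delta mulg1 !linearZ /= !scalerA mulrC.
move/eqP; rewrite scaler_eq0 expf_eq0 (negPf del0) andbF /=.
by rewrite ann_compl_eq0.
Qed.

End Compression.

Lemma mul_eB_ann v : inI #|B|.+1 (mB B v) -> v \in Ann.
Proof.
pose pr := (\1 - projv Ann)%VF : 'End(KW).
have prE u : pr u = u - projv Ann u by rewrite add_lfunE opp_lfunE id_lfunE.
apply: (@mul_eB_ann_compressed pr) => [u|u].
  by rewrite prE opprB addrC subrK memv_proj.
apply/eqP/idP => [E0|uA]; last by rewrite prE projv_id // subrr.
by rewrite -[u](subrK (projv Ann u)) -prE E0 add0r memv_proj.
Qed.

End ModuleRepresentation.

(** * Dimension *)

Section Dimension.
Variables (R : realType) (W : complexReflectionGroup R).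
Variables (K : fieldType) (phi : {rmorphism paramRing W -> K}).
Variables (k : fieldType) (iota : {rmorphism k -> K}) (mk : W -> k).
Local Notation A := (brauer_ext phi).
Local Notation del := (phi (delta W)).
Local Notation mm := (@refl_coef R W K phi).
Local Notation tc := (transverse_collections W).
Local Notation inI := (@brauer_ideal R W K phi).
Local Notation mB := (@mul_eB R W K phi).
Local Notation KW := {ffun W -> K^o}.
Hypothesis del0 : del != 0.
Hypothesis y_tr : forall p, peval_at iota del^-1 p = 0 -> p = 0.
Hypothesis mkE : forall w, iota (mk w) = mm w.
Hypothesis natK : forall n, (n%:R == 0 :> K) = (n == 0)%N.
Implicit Types (B C : {set hyp W}) (v : {set hyp W} -> KW).

(** Elements of [Ann(e_B)] kill [e_B]; by the grading their coset parts do so modulo larger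
    collections. *)
Lemma ann_mul_eB B x : B \in tc -> x \in ann phi B -> inI #|B|.+1 (mB B x).
Proof.
move=> tcB; elim/ann_ind => [|{}x z xA zA|w {}x xA].
- by rewrite raddf0; exact: BrauerIdeal0.
- by rewrite raddfD; exact: brauer_idealD.
- rewrite mul_eB_ltrans; apply/brauer_ideal_w/(ideal_coset_part del0 y_tr mkE) => //.
  by move: xA; rewrite mem_ann_eB => /eqP ->; exact: BrauerIdeal0.
Qed.

Lemma sum_mul_eB_inj v : {in tc, forall B, v B \in (ann phi B)^C%VS} ->
  \sum_(B in tc) mB B (v B) = 0 -> {in tc, forall B, v B = 0}.
Proof.
move=> vC v0; suff h n : {in tc, forall B, (#|B| < n)%N -> v B = 0}.
  by move=> B tcB; exact: (h #|B|.+1).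
elim: n => // n IH B tcB; rewrite ltnS leq_eqVlt => /predU1P[cB|]; last exact: IH.
suff : v B \in (ann phi B :&: (ann phi B)^C)%VS by rewrite capv_compl memv0 => /eqP.
rewrite memv_cap vC // andbT; apply: (mul_eB_ann tcB natK del0); rewrite cB.
apply: (ideal_sum_mul_eB del0 y_tr mkE (F := v) _ tcB cB).
(* The terms of size [n] add up to minus the others, of which the smaller ones vanish by induction
   and the larger ones lie in the next ideal. *)
move: v0; rewrite (bigID (fun C => #|C| == n)) /= => /eqP.
rewrite addr_eq0 => /eqP ->; rewrite -scaleN1r; apply/brauer_idealZ.
apply: brauer_ideal_sum => C /andP[tcC nC].
have [ltC|gtC|eqC] := ltngtP #|C| n; last by rewrite eqC eqxx in nC.
  by rewrite IH // raddf0; exact: BrauerIdeal0.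
exact: brauer_ideal_mul_eB.
Qed.

Lemma sum_mul_eB_surj a : exists2 v, {in tc, forall B, v B \in (ann phi B)^C%VS} &
  a = \sum_(B in tc) mB B (v B).
Proof.
suff h N n : (#|{: hyp W}|.+1 - n <= N)%N -> forall a, inI n a ->
    exists2 v, {in tc, forall B, v B \in (ann phi B)^C%VS} & a = \sum_(B in tc) mB B (v B).
  exact: (h _ 0%N (leqnn _) a (brauer_ideal_all a)).
elim: N n => [|N IH] n leN {}a Ia.
  have n_gt : (#|{: hyp W}| < n)%N by rewrite -subn_eq0 -leqn0.
  exists (fun=> 0); first by move=> B _; exact: rpred0.
  by rewrite (brauer_ideal_gt n_gt Ia) big1 // => B _; exact: raddf0.
have [F IF] := ideal_decomp Ia.
(* Moving each coefficient into the complement of [Ann(B)] costs only an element of the next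
   ideal. *)
pose u B := F B - projv (ann phi B) (F B).
have Iu : inI n.+1 (a - \sum_(B in tc | #|B| == n) mB B (u B)).
  rewrite -[X in inI _ X](subrKA (\sum_(B in tc | #|B| == n) mB B (F B))).
  apply: brauer_idealD => //; rewrite -sumrB; apply: brauer_ideal_sum => B /andP[tcB /eqP <-].
  by rewrite -raddfB /u opprB addrC subrK; apply: ann_mul_eB => //; exact: memv_proj.
have [|v vC E] := IH n.+1 _ _ Iu; first by move: leN; rewrite subnS; case: (_ - n)%N.
exists (fun B => v B + (if #|B| == n then u B else 0)).
  move=> B tcB; rewrite rpredD ?vC //; case: ifP => _; [exact: memv_projC | exact: rpred0].
under eq_bigr do rewrite raddfD /=.
rewrite big_split /= -E [X in _ = _ + X](_ : _ = \sum_(B in tc | #|B| == n) mB B (u B)).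
  by rewrite subrK.
by rewrite big_mkcondr; apply: eq_bigr => B _; case: ifP => _; rewrite ?raddf0.
Qed.

Local Notation ZT := {ffun {set hyp W} -> KW}.

Definition family_at B (x : KW) : ZT := [ffun C => if C == B then x else 0].

Lemma family_at_linear B : linear (family_at B).
Proof.
move=> a u v; apply/ffunP => C; rewrite !ffunE; case: ifP => _ //.
by rewrite scaler0 addr0.
Qed.
HB.instance Definition _ B := GRing.isLinear.Build K KW ZT _ (family_at B) (family_at_linear B).

Definition family_sum (z : ZT) : A := \sum_(B in tc) mB B (z B).

Lemma family_sum_linear : linear family_sum.
Proof.
move=> a u v; rewrite scaler_sumr -big_split; apply: eq_bigr => B _.
by rewrite !ffunE linearP.
Qed.
HB.instance Definition _ := GRing.isLinear.Build K ZT A _ family_sum family_sum_linear.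

(** A finite dimensional model of the direct sum of the [KW/Ann(B)], each replaced by a complement
    of [Ann(B)]. *)
Definition family_compl : {vspace ZT} :=
  (\sum_(B in tc) (linfun (family_at B) @: (ann phi B)^C))%VS.

Lemma family_complP z : z \in family_compl -> exists2 v,
  {in tc, forall B, v B \in (ann phi B)^C%VS} & z = \sum_(B in tc) family_at B (v B).
Proof.
case/memv_sumP=> f fP ->.
have ex B : exists x, B \in tc -> x \in (ann phi B)^C%VS /\ f B = family_at B x.
  have [tcB|] := boolP (B \in tc); last by exists 0.
  by have /memv_imgP[x xA ->] := fP B tcB; exists x; rewrite lfunE.
have [v vP] := choice ex; exists v => [B /vP[]//|].
by apply: eq_bigr => B /vP[].
Qed.

Lemma family_atE v B : B \in tc -> (\sum_(C in tc) family_at C (v C)) B = v B.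
Proof.
move=> tcB; rewrite sum_ffunE (bigD1 B) //= big1 => [|C /andP[_ /negPf CB]].
  by rewrite !ffunE eqxx addr0.
by rewrite !ffunE eq_sym CB.
Qed.

Lemma family_sum_at v : family_sum (\sum_(C in tc) family_at C (v C)) =
  \sum_(B in tc) mB B (v B).
Proof. by apply: eq_bigr => B tcB; rewrite family_atE. Qed.

Lemma dim_family_compl : \dim family_compl = (\sum_(B in tc) dim_quot_ann phi B)%N.
Proof.
have : directv (\sum_(B in tc) (linfun (family_at B) @: (ann phi B)^C))%VS.
  apply/directv_sum_independent => us usP us0 B tcB.
  have ex C : exists x, C \in tc -> us C = family_at C x.
    have [tcC|] := boolP (C \in tc); last by exists 0.
    by have /memv_imgP[x xA ->] := usP C tcC; exists x; rewrite lfunE.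
  have [v vP] := choice ex; rewrite vP //.
  move: us0; rewrite (eq_bigr _ vP) => /ffunP/(_ B); rewrite family_atE // => ->.
  by rewrite ffunE raddf0.
move/directvP=> /= ->; apply: eq_bigr => B _; rewrite limg_dim_eq.
  by rewrite dimv_compl.
apply/eqP; rewrite -subv0; apply/subvP => x; rewrite memv_cap memv_ker lfunE => /andP[_].
by move/eqP/ffunP/(_ B); rewrite !ffunE eqxx memv0 => ->.
Qed.

Lemma brauer_has_dim : has_dim A (\sum_(B in tc) dim_quot_ann phi B)%N.
Proof.
rewrite -dim_family_compl; pose g (z : subvs_of family_compl) := family_sum (vsval z).
have gD z z' c : g (c *: z + z') = c *: g z + g z' by rewrite /g !linearP.
have g0 z : g z = 0 -> z = 0.
  move=> gz; apply: val_inj; have [v vC zE] := family_complP (subvsP z).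
  move: gz; rewrite /g zE family_sum_at => /(sum_mul_eB_inj vC) v0 /=.
  by rewrite zE big1 // => B /v0 ->; rewrite raddf0.
have gsurj a : exists z, g z = a.
  have [v vC ->] := sum_mul_eB_surj a.
  have zC : \sum_(B in tc) family_at B (v B) \in family_compl.
    apply: memv_sumr => B tcB; rewrite -[family_at B _](lfunE (family_at B)).
    exact/memv_img/vC.
  by exists (Subvs zC); rewrite /g /= family_sum_at.
have [h hE] := choice gsurj.
have gI : injective g.
  move=> z z' E; apply/eqP; rewrite -subr_eq0; apply/eqP/g0.
  by rewrite -[z - z']addrC -scaleN1r gD E scaleN1r addNr.
have hK z : h (g z) = z by apply: gI; rewrite hE.
have [f fL [f' fK f'K]] := subvs_vect_iso family_compl.
constructor; exists (fun a => f (h a)).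
  move=> c a b; rewrite -fL; congr f; apply: gI.
  by rewrite gD !hE.
exists (fun r => g (f' r)) => [a|r]; first by rewrite fK hE.
by rewrite hK f'K.
Qed.

End Dimension.

(** * Splitting *)

Section SchurScalar.
Variables (k K : fieldType) (iota : {rmorphism k -> K}) (gT : finGroupType).
Variables (G : {group gT}) (V : lmodType K) (op : gT -> V -> V) (U : V -> Prop).
Variables (u0 : V) (f : V -> V).
Hypothesis splitk : group_closure_field k gT.
Hypothesis op_linear : forall g, linear (op g).
Hypothesis op1 : forall u, U u -> op 1%g u = u.
Hypothesis opM : forall g h u, op (g * h)%g u = op g (op h u).
Hypothesis U0 : U 0.
Hypothesis U_linear : forall c u u', U u -> U u' -> U (c *: u + u').
Hypothesis U_op : forall g u, g \in G -> U u -> U (op g u).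
Hypothesis U_simple : forall u u', U u -> u != 0 -> U u' ->
  exists z : gT -> K, u' = \sum_(g in G) z g *: op g u.
Hypothesis Uu0 : U u0.
Hypothesis u0_neq0 : u0 != 0.
Hypothesis f_linear : linear f.
Hypothesis U_f : forall u, U u -> U (f u).
Hypothesis f_op : forall g u, g \in G -> U u -> f (op g u) = op g (f u).

Definition orbit_sum (z : {ffun gT -> K^o}) : V := \sum_(g in G) z g *: op g u0.

Lemma orbit_sum_linear : linear orbit_sum.
Proof.
move=> c z z'; rewrite scaler_sumr -big_split; apply: eq_bigr => g _.
by rewrite !ffunE scalerDl scalerA.
Qed.
HB.instance Definition _ := GRing.isLinear.Build K {ffun gT -> K^o} V _
  orbit_sum orbit_sum_linear.

Lemma schur_sum (h : V -> V) n (x : 'I_n -> V) (c : 'I_n -> K) : linear h ->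
  h (\sum_i c i *: x i) = \sum_i c i *: h (x i).
Proof.
move=> hL; pose hl : {linear V -> V} := HB.pack h (GRing.isLinear.Build _ _ _ _ _ hL).
by rewrite -[h]/(hl : _ -> _) linear_sum; apply: eq_bigr => i _; rewrite linearZ.
Qed.

(** Simplicity makes [U] the span of the orbit of [u0]; a complement of the kernel of the orbit map
    provides coordinates. *)
Lemma U_coordinates : exists m (tau : {linear 'rV[K]_m -> V}),
  [/\ injective tau, forall v, U (tau v) & forall u, U u -> exists v, tau v = u].
Proof.
set S := (kerv orbit_sum)^C%VS; exists (\dim S).
have [j jL [j' jK j'K]] := subvs_vect_iso S.
have j'L : linear j' by move=> c a b; apply: (can_inj jK); rewrite jL !j'K.
pose tau v := orbit_sum (vsval (j' v)).
have tauL : linear tau by move=> c a b; rewrite /tau j'L !linearP.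
pose tl : {linear 'rV[K]_(\dim S) -> V} := HB.pack tau (GRing.isLinear.Build _ _ _ _ _ tauL).
exists tl; split=> [v v' E|v|u Uu].
- apply: (can_inj j'K); apply: val_inj; apply/eqP; rewrite -subr_eq0 -memv0.
  rewrite -(capv_compl (kerv orbit_sum)) memv_cap memv_kerv raddfB /= subr_eq0.
  by apply/andP; split; [exact/eqP/E | apply: rpredB; exact: subvsP].
- rewrite /= /tau /orbit_sum; elim/big_ind: _ => // [u u' Uu Uu'|g gG].
    by rewrite -[u]scale1r; exact: U_linear.
  by rewrite -[_ *: _]addr0; apply: U_linear => //; exact: U_op.
have [z ->] := U_simple Uu0 u0_neq0 Uu.
have : [ffun g => z g : K^o] \in (kerv orbit_sum + S)%VS by rewrite addv_complf memvf.
case/memv_addP=> z1 z1S [z2 z2S E]; exists (j (Subvs z2S)).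
transitivity (orbit_sum (z1 + z2)).
  rewrite raddfD /= /tau jK /=; move: z1S; rewrite memv_kerv => /eqP ->.
  by rewrite add0r.
by rewrite -E /= /orbit_sum; apply: eq_bigr => g _; rewrite ffunE.
Qed.

Lemma schur_scalar : exists c : K, forall u, U u -> f u = c *: u.
Proof.
have [m [tau [tauI Utau tauS]]] := U_coordinates.
have mxE (h : V -> V) : linear h -> (forall u, U u -> U (h u)) ->
    exists M : 'M[K]_m, forall v, tau (v *m M) = h (tau v).
  move=> hL Uh; have ex i : exists r, tau r = h (tau (delta_mx 0 i)) by exact/tauS/Uh/Utau.
  have [r rE] := choice ex; exists (\matrix_i r i) => v.
  rewrite mulmx_sum_row linear_sum [in RHS](row_sum_delta v) linear_sum /=.
  under [in RHS]eq_bigr do rewrite linearZ /=.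
  by rewrite schur_sum //; apply: eq_bigr => i _; rewrite linearZ /= rowK rE.
(* Matrices act on rows from the right, so the inverse is what makes [r] multiplicative. *)
have exr g : exists M : 'M[K]_m, g \in G -> forall v, tau (v *m M) = op g^-1%g (tau v).
  have [gG|] := boolP (g \in G); last by exists 0.
  have [|M ME] := mxE (op g^-1%g) (op_linear _); last by exists M.
  by move=> u; apply: U_op; rewrite groupV.
have [r rE] := choice exr.
have rP : mx_repr G r.
  split=> [|g h gG hG]; apply/row_matrixP => i; rewrite !rowE; apply: tauI.
    by rewrite rE ?group1 // invg1 op1 // mulmx1.
  by rewrite mulmxA !rE ?groupM // invMg opM.
pose rG := MxRepresentation rP.
have irr : mx_irreducible rG.
  apply/mx_irrP; split.
    have [v vE] := tauS _ Uu0; rewrite lt0n; apply: contraNneq u0_neq0 => m0.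
    rewrite -vE (_ : v = 0) ?raddf0 //; apply/rowP => -[i lti]; exfalso.
    by rewrite m0 in lti.
  move=> X /mxmoduleP modX /rowV0Pn[v vX v0]; rewrite -sub1mx; apply/row_subP => i.
  have [|z zE] := U_simple (Utau v) _ (Utau (row i 1%:M)).
    by apply: contraNneq v0 => E; apply/eqP/tauI; rewrite E raddf0.
  have -> : row i 1%:M = \sum_(g in G) z g *: (v *m rG g^-1%g).
    apply: tauI; rewrite zE linear_sum; apply: eq_bigr => g gG.
    by rewrite linearZ /= rE ?groupV // invgK.
  apply: summx_sub => g gG; apply: scalemx_sub.
  by apply: submx_trans (modX _ _); [exact: submxMr | rewrite groupV].
(* A splitting field stays one under the extension [iota], so irreducibility over [K] is absolute
   and the centralizer consists of scalars. *)
have absr := extend_group_splitting_field iota (@splitk G) irr.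
have [F FE] := mxE f f_linear U_f.
have /is_scalar_mxP[c Fc] : is_scalar_mx F.
  apply: (mx_abs_irr_cent_scalar absr); apply/centgmxP => g gG.
  apply/row_matrixP => i; rewrite !rowE; apply: tauI.
  by rewrite !mulmxA FE !rE // FE f_op ?groupV.
exists c => u /tauS[v <-]; rewrite -FE Fc mul_mx_scalar.
exact: linearZ.
Qed.

End SchurScalar.

(** An alias that carries the [K]-structure, kept apart from the [A]-structure of [V]. *)
Definition restrict_scalars (K : fieldType) (A : algType K) (V : lmodType A) : Type := V.

Section RestrictScalars.
Variables (K : fieldType) (A : algType K) (V : lmodType A).
Local Notation VK := (restrict_scalars V).
HB.instance Definition _ := GRing.Zmodule.on VK.

Definition restrict_scale (c : K) (v : VK) : VK := (c%:A : A) *: (v : V).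

Lemma restrict_scaleA c d v : restrict_scale c (restrict_scale d v) = restrict_scale (c * d) v.
Proof. by rewrite /restrict_scale scalerA mulr_algl scalerA. Qed.

Lemma restrict_scale1 : left_id 1 restrict_scale.
Proof. by move=> v; rewrite /restrict_scale !scale1r. Qed.

Lemma restrict_scaleDr : right_distributive restrict_scale +%R.
Proof. by move=> c u v; exact: scalerDr. Qed.

Lemma restrict_scaleDl v : {morph restrict_scale^~ v : c d / c + d}.
Proof. by move=> c d; rewrite /restrict_scale !scalerDl. Qed.

HB.instance Definition _ := GRing.Zmodule_isLmodule.Build K VK
  restrict_scaleA restrict_scale1 restrict_scaleDr restrict_scaleDl.

Lemma restrict_scaleE c (v : VK) : c *: v = (c%:A : A) *: (v : V). Proof. by []. Qed.

Lemma restrict_scaler c (a : A) (v : V) : (c *: a) *: v = (c%:A : A) *: (a *: v).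
Proof. by rewrite scalerA mulr_algl. Qed.

Lemma restrict_scalel c (a : A) (v : V) : a *: ((c%:A : A) *: v) = (c%:A : A) *: (a *: v).
Proof. by rewrite !scalerA mulr_algl mulr_algr. Qed.

Lemma simple_module_gen (u v : V) : simple_module V -> u != 0 -> exists a : A, v = a *: u.
Proof.
case=> _ simV u0; pose S : {pred V} := fun w => `[< exists a : A, w = a *: u >].
have SP w : w \in S <-> exists a : A, w = a *: u by split=> [/asboolP//|]; move/asboolP.
apply/SP; apply: simV; last by exists u => //; apply/SP; exists 1; rewrite scale1r.
split=> [|b w w' /SP[a ->] /SP[a' ->]]; apply/SP; first by exists 0; rewrite scale0r.
by exists (b * a + a'); rewrite scalerDl scalerA.
Qed.

End RestrictScalars.

Section Split.
Variables (R : realType) (W : complexReflectionGroup R).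
Variables (K : fieldType) (phi : {rmorphism paramRing W -> K}).
Variables (k : fieldType) (iota : {rmorphism k -> K}) (mk : W -> k).
Local Notation A := (brauer_ext phi).
Local Notation ww := (@brauer_w R W K phi).
Local Notation EB := (@brauer_eB R W K phi).
Local Notation del := (phi (delta W)).
Local Notation mm := (@refl_coef R W K phi).
Local Notation tc := (transverse_collections W).
Local Notation inI := (@brauer_ideal R W K phi).
Local Notation mB := (@mul_eB R W K phi).
Local Notation KW := {ffun W -> K^o}.
Local Notation y := (del^-1).
Hypothesis del0 : del != 0.
Hypothesis mkE : forall w, iota (mk w) = mm w.
Implicit Types (B C : {set hyp W}).

(** [a e_B] reduces to [x e_B] with [x] in [KW], and the kernel of [e_C] then confines the result to
    the coset [gB = C]; the power of [delta] undoes the normalization of the kernels. *)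
Lemma brauer_corner B C (a : A) : B \in tc -> C \in tc -> #|C| = #|B| ->
  exists2 z : KW, forall g, hact g @: B != C -> z g = 0 &
    inI #|B|.+1 (EB C * a * EB B - mB B z).
Proof.
move=> tcB tcC cC; have [x Ix] := brauer_mul_eB a tcB.
pose z := kact iota y (left_kernels mk B (elems C)) x.
exists (del ^+ #|C| *: z) => [g gC|].
  rewrite !ffunE big1 ?scaler0 // => j _.
  by rewrite (left_kernels_coset mkE) // peval_at0 mul0r.
rewrite -mulrA -[X in inI _ X](subrKA (EB C * mB B x)) -mulrBr.
apply: brauer_idealD; first exact: brauer_idealMl.
have -> : EB C * mB B x - mB B (del ^+ #|C| *: z) =
    (- del ^+ #|C|) *: (mB B z - y ^+ #|C| *: (EB C * mB B x)).
  rewrite linearZ /= scalerBr scalerA mulNr -exprMn divff // expr1n scaleN1r opprK.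
  by rewrite addrC scaleNr.
exact/brauer_idealZ/(left_kernels_elems del0 mkE).
Qed.

(* Locked, lest [mulrA] see the product hidden in the scaling. *)
Definition eB_idem B : A := locked (y ^+ #|B| *: EB B).

Lemma eB_idemE B : eB_idem B = y ^+ #|B| *: EB B.
Proof. by rewrite /eB_idem -lock. Qed.

Lemma brauer_eB_sqr B : B \in tc -> EB B * EB B = del ^+ #|B| *: EB B.
Proof.
move=> tcB; suff h (s : seq (hyp W)) : all (mem B) s ->
    (\prod_(x <- s) @brauer_e R W K phi x) * EB B = del ^+ size s *: EB B.
  by rewrite {1}brauer_eB_elems h ?size_elems //; rewrite all_elems.
elim: s => [_|H s IH /= /andP[HB sB]]; first by rewrite big_nil mul1r scale1r.
by rewrite big_cons -mulrA IH // -scalerAr brauer_e_eB_in // scalerA exprSr.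
Qed.

Lemma eB_idemM B : B \in tc -> eB_idem B * eB_idem B = eB_idem B.
Proof.
move=> tcB; rewrite eB_idemE -scalerAl -scalerAr brauer_eB_sqr // !scalerA.
by rewrite -mulrA -exprMn mulVf // expr1n mulr1.
Qed.

Lemma eB_idem_eB B : B \in tc -> eB_idem B * EB B = EB B.
Proof.
by move=> tcB; rewrite eB_idemE -scalerAl brauer_eB_sqr // scalerA -exprMn mulVf // expr1n scale1r.
Qed.

Lemma eB_idem_w B w : B \in tc -> ww w * eB_idem B = eB_idem (hact w @: B) * ww w.
Proof.
by move=> tcB; rewrite !eB_idemE -scalerAr brauer_w_eB // -scalerAl card_hact.
Qed.

Lemma eB_idem_corner B C (a : A) : B \in tc -> C \in tc -> #|C| = #|B| ->
  exists2 z : KW, forall g, hact g @: B != C -> z g = 0 &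
    inI #|B|.+1 (eB_idem C * a * eB_idem B - \sum_g z g *: ww g * eB_idem B).
Proof.
move=> tcB tcC cC; have [z z0 Iz] := brauer_corner a tcB tcC cC.
exists (y ^+ #|C| *: z) => [g gC|]; first by rewrite ffunE z0 // scaler0.
set X := _ - _; rewrite (_ : X = y ^+ #|C| *: (y ^+ #|B| *: (EB C * a * EB B - mB B z))).
  by do 2!apply: brauer_idealZ.
rewrite /X !eB_idemE -!scalerAl -!scalerAr !scalerBr; congr (_ - _).
rewrite mul_eBE !scaler_sumr; apply: eq_bigr => g _.
rewrite ffunE -scalerAl -scalerAr [RHS]scalerA [in RHS]scalerA [LHS]scalerA; congr (_ *: _).
by rewrite -[y ^+ #|C| *: z g]/(y ^+ #|C| * z g) -!mulrA [z g * _]mulrC.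
Qed.

Hypothesis splitk : group_closure_field k W.

Lemma brauer_split : split_algebra A.
Proof.
move=> V simV f; have [[v0 v0N] _] := simV.
pose P n := `[< exists a (v : V), inI n a /\ a *: v != 0 >].
have exP : exists n, P n.
  exists 0%N; apply/asboolP; exists 1, v0; rewrite scale1r; split=> //.
  exact: brauer_ideal_all.
have ubP n : P n -> (n <= #|{: hyp W}|)%N.
  move/asboolP=> [a [v [Ia av]]]; rewrite leqNgt; apply: contraNN av => lt.
  by rewrite (brauer_ideal_gt lt Ia) scale0r.
case: (ex_maxnP exP ubP) => n /asboolP[a [v [Ia av]]] maxn.
have kill b (w : V) : inI n.+1 b -> b *: w = 0.
  move=> Ib; apply/eqP; apply: contraT => bw; suff /maxn : P n.+1 by rewrite ltnn.
  by apply/asboolP; exists b, w.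
have [B [tcB cB Bv]] : exists B, [/\ B \in tc, #|B| = n & EB B *: v != 0].
  have [F IF] := ideal_decomp Ia.
  have [/existsP[B /and3P[tcB /eqP cB Bv]]|/existsPn N] :=
      boolP [exists B, [&& B \in tc, #|B| == n & EB B *: v != 0]]; first by exists B.
  case/eqP: av; rewrite -[a](subrK (\sum_(B in tc | #|B| == n) mB B (F B))).
  rewrite scalerDl (kill _ _ IF) add0r scaler_suml big1 // => B /andP[tcB cB].
  have := N B; rewrite tcB cB /= negbK => /eqP Bv.
  by rewrite /mul_eB -scalerA Bv scaler0.
pose p := eB_idem B; pose u0 : restrict_scalars V := EB B *: v.
pose U (u : restrict_scalars V) := p *: (u : V) = u.
pose op g (u : restrict_scalars V) : restrict_scalars V := ww g *: (u : V).
have Uu0 : U u0 by rewrite /U /u0 scalerA eB_idem_eB.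
have wp g : g \in stab_group B -> ww g * p = p * ww g.
  by rewrite inE => /eqP gB; rewrite eB_idem_w // gB.
have [||||||||||||c cE] := @schur_scalar k K iota W (stab_group B) (restrict_scalars V)
    op U u0 f splitk => //.
- by move=> g c u u'; rewrite /op scalerDr !restrict_scaleE restrict_scalel.
- by move=> u _; rewrite /op brauer_w1 scale1r.
- by move=> g h u; rewrite /op scalerA brauer_wM.
- by rewrite /U scaler0.
- by move=> c u u' Uu Uu'; rewrite /U scalerDr !restrict_scaleE restrict_scalel Uu Uu'.
- by move=> g u gB Uu; rewrite /U /op scalerA -wp // -scalerA Uu.
(* [u' = b u] gives [u' = (p b p) u], and [p b p] agrees with an element of [K Stab(B)] times [p]
   modulo an ideal that kills [V]. *)
- move=> u u' Uu uN Uu'; have [b u'E] := simple_module_gen u' simV uN.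
  have [z z0 Iz] := eB_idem_corner b tcB tcB erefl.
  have {}Iz : inI n.+1 (p * b * p - \sum_g z g *: ww g * p) by rewrite -cB.
  exists z; rewrite -[LHS]Uu' u'E -{1}Uu !scalerA.
  rewrite -[p * b * p](subrK (\sum_g z g *: ww g * p)) scalerDl (kill _ _ Iz) add0r.
  rewrite scaler_suml [RHS]big_mkcond; apply: eq_bigr => g _.
  rewrite -scalerA Uu; case: ifPn => [_|]; last by rewrite inE => /z0 ->; rewrite !scale0r.
  by rewrite restrict_scaleE -restrict_scaler.
- by move=> c u u'; rewrite !restrict_scaleE linearD linearZ.
- by move=> u Uu; rewrite /U -linearZ /= Uu.
- by move=> g u _ _; rewrite /op linearZ.
exists c => w; have [b ->] := simple_module_gen w simV Bv.
by rewrite linearZ /= (cE _ Uu0) restrict_scaleE restrict_scalel.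
Qed.

End Split.

(** * Semisimplicity *)

Lemma linear_projection (K : fieldType) (V : lmodType K) n (P : V -> Prop) :
    has_dim V n -> P 0 -> (forall u v, P u -> P v -> P (u + v)) ->
    (forall c u, P u -> P (c *: u)) ->
  exists theta : V -> V,
    [/\ linear theta, forall v, P (theta v) & forall v, P v -> theta v = v].
Proof.
move=> [[r rL [r' rK r'K]]] P0 PD PZ.
have r'L : linear r' by move=> c a b; apply: (can_inj rK); rewrite rL !r'K.
pose rl : {linear V -> 'rV[K]_n} := HB.pack r (GRing.isLinear.Build _ _ _ _ _ rL).
pose r'l : {linear 'rV[K]_n -> V} := HB.pack r' (GRing.isLinear.Build _ _ _ _ _ r'L).
have [|||S SP] := @pred_vspace K 'rV[K]_n (fun x => P (r'l x)).
- by rewrite raddf0.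
- by move=> u v Pu Pv; rewrite raddfD; exact: PD.
- by move=> c u Pu; rewrite linearZ; exact: PZ.
exists (fun v => r'l (projv S (rl v))); split=> [c u v|v|v Pv].
- by rewrite !linearP.
- by apply/SP; exact: memv_proj.
rewrite projv_id /= ?rK //; apply/SP; by rewrite /= rK.
Qed.

Section Semisimple.
Variables (R : realType) (W : complexReflectionGroup R).
Variables (K : fieldType) (phi : {rmorphism paramRing W -> K}).
Variables (k : fieldType) (iota : {rmorphism k -> K}) (mk : W -> k).
Local Notation A := (brauer_ext phi).
Local Notation ww := (@brauer_w R W K phi).
Local Notation EB := (@brauer_eB R W K phi).
Local Notation del := (phi (delta W)).
Local Notation mm := (@refl_coef R W K phi).
Local Notation tc := (transverse_collections W).
Local Notation inI := (@brauer_ideal R W K phi).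
Local Notation y := (del^-1).
Hypothesis del0 : del != 0.
Hypothesis y_tr : forall p, peval_at iota y p = 0 -> p = 0.
Hypothesis mkE : forall w, iota (mk w) = mm w.
Hypothesis natK : forall n, (n%:R == 0 :> K) = (n == 0)%N.
Implicit Types (B C : {set hyp W}) (a b u t : A) (n : nat).

Section IdealUnits.
Variable l : nat -> A.
Hypothesis lI : forall n, inI n (l n).
Hypothesis lP : forall n a, inI n a -> l n * a = a /\ a * l n = a.

(** Both sides equal [l n * a * l n], since [l n * a] and [a * l n] lie in the ideal. *)
Lemma unit_central n a : l n * a = a * l n.
Proof.
have [_ <-] := lP (brauer_idealMr a (lI n)).
by rewrite -mulrA; have [-> _] := lP (brauer_idealMl a (lI n)).
Qed.

Definition layer n := l n - l n.+1.

Lemma layer_central n a : layer n * a = a * layer n.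
Proof. by rewrite mulrBl mulrBr !unit_central. Qed.

Lemma layer_ideal n a : inI n (layer n * a).
Proof.
apply/brauer_idealMr/brauer_idealB => //.
exact: brauer_ideal_leq (leqnSn n) (lI n.+1).
Qed.

Lemma layer_kill n a : inI n.+1 a -> layer n * a = 0.
Proof.
move=> Ia; rewrite mulrBl; have [-> _] := lP Ia.
by have [-> _] := lP (brauer_ideal_leq (leqnSn n) Ia); rewrite subrr.
Qed.

Lemma layer_orthogonal n m a : n != m -> layer n * (layer m * a) = 0.
Proof.
have h i j b : (i < j)%N -> layer i * (layer j * b) = 0.
  by move=> ij; apply/layer_kill/brauer_ideal_leq/layer_ideal.
rewrite neq_ltn => /orP[|] lt; first exact: h.
by rewrite mulrA layer_central -mulrA h.
Qed.

Lemma layer_idem n a : layer n * (layer n * a) = layer n * a.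
Proof.
rewrite [X in layer n * X]mulrBl mulrBr (layer_kill (brauer_idealMr a (lI n.+1))) subr0.
rewrite mulrA -unit_central [in LHS]mulrBr; have [-> _] := lP (lI n).
by have [-> _] := lP (brauer_ideal_leq (leqnSn n) (lI n.+1)).
Qed.

Lemma sum_layer a : a = \sum_(n < #|{: hyp W}|.+1) layer n * a.
Proof.
rewrite -mulr_suml; set N := _.+1.
suff -> : \sum_(i < N) layer i = 1 by rewrite mul1r.
have -> : \sum_(i < N) layer i = l 0%N - l N.
  elim: N => [|N IH]; first by rewrite big_ord0 subrr.
  by rewrite big_ord_recr IH /= /layer addrA subrK.
rewrite (brauer_ideal_gt (leqnn N) (lI N)) subr0 -[LHS]mulr1.
by have [] := lP (brauer_ideal_all 1).
Qed.

Definition layer_eB B := eB_idem phi B * layer #|B|.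
Local Notation eb := layer_eB.

Local Notation pB := (eB_idem phi).

Lemma layer_eB_idem B a : B \in tc -> eb B * (eb B * a) = eb B * a.
Proof.
move=> tcB; rewrite /layer_eB -!mulrA [layer _ * (pB B * _)]mulrA (layer_central _ (pB B)).
by rewrite -[pB B * layer _ * _]mulrA layer_idem [LHS]mulrA eB_idemM // -mulrA.
Qed.

Lemma layer_eB_w B w a : B \in tc -> ww w * (eb B * a) = eb (hact w @: B) * (ww w * a).
Proof.
move=> tcB; rewrite /layer_eB card_hact !mulrA eB_idem_w // -!mulrA.
by rewrite [layer _ * (ww w * a)]mulrA (layer_central _ (ww w)) -!mulrA.
Qed.

(** The layer idempotent kills the next ideal and so turns the congruence for corners into an
    equality. *)
Lemma layer_eB_corner B C a b : B \in tc -> C \in tc -> #|C| = #|B| ->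
  exists2 z : W -> K, forall g, hact g @: B != C -> z g = 0 &
    eb C * (a * (eb B * b)) = \sum_g z g *: (ww g * (eb B * b)).
Proof.
move=> tcB tcC cC; have [z z0 Iz] := eB_idem_corner del0 mkE a tcB tcC cC.
exists (fun g => z g) => //; move/layer_kill: Iz => /(congr1 (fun c => c * b)).
rewrite mul0r mulrBr mulrBl => /eqP; rewrite subr_eq0 => /eqP E.
transitivity (layer #|B| * (pB C * a * pB B) * b).
  rewrite /layer_eB cC -!mulrA.
  have -> : a * (pB B * (layer #|B| * b)) = layer #|B| * (a * (pB B * b)).
    rewrite [pB B * (layer _ * _)]mulrA -(layer_central _ (pB B)) -mulrA mulrA.
    by rewrite -(layer_central _ a) -!mulrA.
  by rewrite layer_idem [LHS]mulrA -(layer_central _ (pB C)) -!mulrA.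
rewrite E mulr_sumr mulr_suml; apply: eq_bigr => g _.
rewrite -[z g *: ww g * pB B]scalerAl -scalerAr -scalerAl; congr (_ *: _).
rewrite /layer_eB [layer _ * (ww g * pB B)]mulrA (layer_central _ (ww g)) -!mulrA.
by rewrite [layer _ * (pB B * b)]mulrA (layer_central _ (pB B)) -!mulrA.
Qed.

Section Complement.
Variables (S : A -> Prop) (theta : {linear A -> A}).
Hypothesis S_mul : forall a u, S u -> S (a * u).
Hypothesis S_sub : forall u v, S u -> S v -> S (u - v).
Hypothesis theta_S : forall a, S (theta a).
Hypothesis theta_id : forall u, S u -> theta u = u.
Hypothesis theta_w : forall w a, theta (ww w * a) = ww w * theta a.

(** [theta] commutes only with [W], so its kernel need not be a left ideal. On a corner, however,
    every [e_H] acts by [delta], by zero, or through group elements, so a condition stable under [W]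
    is enough. *)
Definition corner B u := u = eb B * u /\ eb B * theta u = 0.

Definition compl t := exists2 u : {set hyp W} -> A,
  forall B, B \in tc -> corner B (u B) & t = \sum_(B in tc) u B.

Lemma corner0 B : corner B 0.
Proof. by split; rewrite ?raddf0 mulr0. Qed.

Lemma cornerD B u v : corner B u -> corner B v -> corner B (u + v).
Proof.
move=> [uE u0] [vE v0]; split; first by rewrite mulrDr -uE -vE.
by rewrite raddfD mulrDr u0 v0 addr0.
Qed.

Lemma cornerZ B c u : corner B u -> corner B (c *: u).
Proof.
move=> [uE u0]; split; first by rewrite -scalerAr -uE.
by rewrite linearZ -scalerAr u0 scaler0.
Qed.

Lemma corner_w B w u : B \in tc -> corner B u -> corner (hact w @: B) (ww w * u).
Proof.
move=> tcB [uE u0]; split; first by rewrite -layer_eB_w // -uE.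
by rewrite theta_w -layer_eB_w // u0 mulr0.
Qed.

Lemma compl0 : compl 0.
Proof. by exists (fun=> 0) => [B _|]; [exact: corner0 | rewrite big1]. Qed.

Lemma complD t t' : compl t -> compl t' -> compl (t + t').
Proof.
move=> [u uP ->] [u' uP' ->]; exists (fun B => u B + u' B); last by rewrite big_split.
by move=> B tcB; apply: cornerD; [exact: uP | exact: uP'].
Qed.

Lemma complZ c t : compl t -> compl (c *: t).
Proof.
move=> [u uP ->]; exists (fun B => c *: u B); last by rewrite scaler_sumr.
by move=> B tcB; apply: cornerZ; exact: uP.
Qed.

Lemma compl_corner B u : B \in tc -> corner B u -> compl u.
Proof.
move=> tcB uP; exists (fun C => if C == B then u else 0) => [C tcC|].
  by case: eqP => [->//|_]; exact: corner0.
rewrite (bigD1 B) //= eqxx big1 ?addr0 // => C /andP[_ /negPf CB].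
by rewrite CB.
Qed.

Lemma compl_sum I (r : seq I) (P : pred I) (F : I -> A) :
  (forall i, P i -> compl (F i)) -> compl (\sum_(i <- r | P i) F i).
Proof. by move=> h; elim/big_ind: _ => //; [exact: compl0|exact: complD]. Qed.

Lemma compl_mul a t : compl t -> compl (a * t).
Proof.
move: a t; apply: brauer_ext_ind => [|a b Ia Ib|c a Ia|w a Ia|H a Ia] t Tt.
- by rewrite mul1r.
- by rewrite mulrDl; apply: complD; [exact: Ia | exact: Ib].
- by rewrite -scalerAl; apply/complZ/Ia.
- rewrite -mulrA; have [u uP ->] := Ia t Tt; rewrite mulr_sumr.
  apply: compl_sum => B tcB; apply: (@compl_corner (hact w @: B)).
    by rewrite transverse_collection_act.
  by apply: corner_w => //; exact: uP.
rewrite -mulrA; have [u uP ->] := Ia t Tt; rewrite mulr_sumr.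
apply: compl_sum => B tcB; have uB := uP B tcB; set v := u B in uB *.
(* Exposes [EB B] as a left factor, so that the rules for [e_H * EB B] apply. *)
have vE : v = EB B * (del^-1 ^+ #|B| *: (layer #|B| * v)).
  by rewrite {1}(proj1 uB) /layer_eB -mulrA eB_idemE -scalerAl scalerAr.
have [HB|HB] := boolP (H \in B).
  rewrite vE mulrA brauer_e_eB_in // -scalerAl -vE.
  exact/complZ/(compl_corner tcB).
have [tr|[X XB ntr]] := hyp_trichotomy HB.
  have tcHB := transverse_collectionU1 tcB tr.
  rewrite vE mulrA -brauer_eBU1 // -scalerAr mulrA -(layer_central _ (EB _)) -mulrA.
  rewrite layer_kill ?scaler0; first exact: compl0.
  by apply/brauer_idealMr/brauer_ideal_eB; rewrite ?cardsU1 ?HB.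
rewrite vE mulrA (brauer_e_eB_nontransverse phi XB) // mulr_suml.
apply: compl_sum => w _; rewrite -scalerAl -mulrA -vE.
apply/complZ/(@compl_corner (hact w @: B)); first by rewrite transverse_collection_act.
exact: corner_w.
Qed.

(** Collections of other sizes lie in orthogonal layers. For those of the size of [C], the corner
    formula leaves only translates by [g] with [gB = C], and these carry the corner of [B] to that
    of [C]. *)
Lemma compl_layer_eB (f : {set hyp W} -> A) C :
    (forall B, B \in tc -> corner B (f B)) -> C \in tc ->
  corner C (eb C * \sum_(B in tc) f B).
Proof.
move=> uP tcC; rewrite mulr_sumr; elim/big_ind: _ => [||B tcB].
- exact: corner0.
- by move=> a b; exact: cornerD.
have [uE _] := uP B tcB; have [cC|nC] := eqVneq #|C| #|B|; last first.
  rewrite uE /layer_eB -mulrA -[pB B * layer _ * _]mulrA [pB B * (layer _ * _)]mulrA.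
  rewrite -(layer_central _ (pB B)) -mulrA layer_orthogonal // mulr0; exact: corner0.
have [z z0 E] := layer_eB_corner 1 (f B) tcB tcC cC.
rewrite uE -[eb B * _]mul1r E; elim/big_ind: _ => [||g _].
- exact: corner0.
- by move=> a b; exact: cornerD.
have [gC|/z0->] := boolP (hact g @: B == C); last by rewrite scale0r; exact: corner0.
by rewrite -(eqP gC) -uE; apply/cornerZ/corner_w => //; exact: uP.
Qed.

(** [eb C * t] is in the corner of [C] and in [S], where [theta] is the identity; the corner
    condition then makes it zero for every [C]. Hence [total_eB n] kills each [layer n * t], which
    puts the latter in the next ideal, where the layer vanishes. *)
Lemma compl_inter t : compl t -> S t -> t = 0.
Proof.
move=> [u uP tE] St; have ebt C : C \in tc -> eb C * t = 0.
  move=> tcC; have [E E0] := compl_layer_eB uP tcC; rewrite -tE in E E0.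
  by rewrite E -E0 theta_id //; exact: S_mul.
rewrite (sum_layer t) big1 // => n _; suff : inI n.+1 (layer n * t).
  by move/layer_kill; rewrite layer_idem.
apply: (ideal_left_reflect del0 y_tr mkE); first exact: layer_ideal.
rewrite /total_eB mulr_suml big1 => [|C /andP[tcC /eqP cC]]; first exact: BrauerIdeal0.
by rewrite -cC -eB_idemE mulrA ebt.
Qed.

Lemma compl_add a : exists s t, [/\ S s, compl t & a = s + t].
Proof.
suff h b : exists2 s, S s & compl (b - s).
  by have [s Ss ct] := h a; exists s, (a - s); split=> //; rewrite addrC subrK.
have SD u v : S u -> S v -> S (u + v).
  have S0 : S 0 by rewrite -[X in S X](mul0r (theta 0)); exact: S_mul.
  by move=> Su Sv; rewrite -[v]opprK -[- v]sub0r; apply/S_sub/S_sub.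
have S0 : S 0 by rewrite -[X in S X](mul0r (theta 0)); exact: S_mul.
have add u v : (exists2 s, S s & compl (u - s)) -> (exists2 s, S s & compl (v - s)) ->
    exists2 s, S s & compl (u + v - s).
  move=> [s Ss cs] [s' Ss' cs']; exists (s + s'); first exact: SD.
  by rewrite opprD addrACA; exact: complD.
rewrite (sum_layer b); elim/big_ind: _ => // [|n _].
  by exists 0; rewrite // subr0; exact: compl0.
(* Surjectivity of [total_eB n] writes [layer n * b] as a sum of terms [eb C * c], treated one by
   one. *)
have [c _ Ic] := ideal_left_surj del0 y_tr mkE (layer_ideal n b).
move/layer_kill: Ic; rewrite mulrBr layer_idem => /eqP; rewrite subr_eq0 => /eqP <-.
rewrite mulrA (layer_central _ (total_eB _ _)) -mulrA mulr_suml.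
elim/big_ind: _ => [|//|C /andP[tcC /eqP cC]].
  by exists 0; rewrite // subr0; exact: compl0.
(* The [S]-component [s] is fixed by [theta] and by [eb C], so
   [eb C * theta (eb C * c - s) = s - s = 0]. *)
rewrite -cC -eB_idemE mulrA -/(layer_eB C); exists (eb C * theta (eb C * c)); first exact: S_mul.
apply: (compl_corner tcC); split; first by rewrite mulrBr !layer_eB_idem.
rewrite [theta (_ - _)]linearB mulrBr /= (theta_id (S_mul _ (theta_S _))).
by rewrite layer_eB_idem // subrr.
Qed.

End Complement.

End IdealUnits.

Lemma brauer_semisimple n : has_dim A n -> semisimple_algebra A.
Proof.
move=> dimA S [S0 Slin].
have SD u v : u \in S -> v \in S -> u + v \in S.
  by move=> Su Sv; rewrite -[u]scale1r; exact: Slin.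
have SM (a u : A) : u \in S -> a * u \in S.
  by move=> Su; rewrite -[a * u]addr0; exact: (Slin a u 0).
have SZ (c : K) (u : A) : u \in S -> c *: u \in S.
  by rewrite -mulr_algl; exact: SM.
have [th0 [th0L th0S th0id]] := linear_projection dimA S0 SD SZ.
pose theta a : A := (#|W|%:R)^-1 *: \sum_(w : W) ww w^-1%g * th0 (ww w * a).
have thL : linear theta.
  move=> c u v; rewrite /theta scalerA mulrC -scalerA -scalerDr; congr (_ *: _).
  rewrite scaler_sumr -big_split; apply: eq_bigr => w _ /=.
  by rewrite mulrDr -scalerAr th0L mulrDr -scalerAr.
pose thl : {linear A -> A} := HB.pack theta (GRing.isLinear.Build _ _ _ _ _ thL).
have thS a : thl a \in S.
  by apply: SZ; elim/big_ind: _ => // w _; apply: SM; exact: th0S.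
have thid u : u \in S -> thl u = u.
  move=> Su; rewrite /= /theta (eq_bigr (fun=> u)) => [|w _].
    rewrite sumr_const -scaler_nat scalerA mulVf ?scale1r // natK -lt0n.
    by apply/card_gt0P; exists 1%g.
  by rewrite th0id ?SM // mulrA -brauer_wM mulVg brauer_w1 mul1r.
have thw w a : thl (ww w * a) = ww w * thl a.
  rewrite /= /theta -scalerAr mulr_sumr; congr (_ *: _).
  rewrite (reindex_inj (mulIg w^-1%g)); apply: eq_bigr => g _.
  by rewrite mulrA -brauer_wM mulgKV invMg invgK brauer_wM -mulrA.
have ex m : exists u, inI m u /\ forall a, inI m a -> u * a = a /\ a * u = a.
  by have [u uI uP] := ideal_unit del0 y_tr mkE m; exists u.
have [l lP] := choice ex.
have lI m : inI m (l m) by case: (lP m).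
have lE m a : inI m a -> l m * a = a /\ a * l m = a by case: (lP m) => _; apply.
have SB u v : u \in S -> v \in S -> u - v \in S.
  by move=> Su Sv; rewrite -mulN1r; apply: SD => //; exact: SM.
pose T : {pred A^o} := fun t => `[< compl l thl t >].
have TP t : t \in T <-> compl l thl t by split=> [/asboolP//|]; move/asboolP.
exists T; split=> [|v Sv /TP|v].
- split=> [|a u v /TP Tu /TP Tv]; apply/TP; first exact: compl0.
  by apply: complD => //; exact: compl_mul.
- by move=> cv; apply: (compl_inter lI lE SM thid thw cv).
have [s [t [Ss ct ->]]] := compl_add lI lE SM SB thS thid v.
by exists s, t; split=> //; apply/TP.
Qed.

End Semisimple.

(** * Admissible collections *)

Section Admissible.
Variables (R : realType) (W : complexReflectionGroup R).
Variables (K : fieldType) (phi : {rmorphism paramRing W -> K}).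
Local Notation ww := (@brauer_w R W K phi).
Local Notation EB := (@brauer_eB R W K phi).
Local Notation tc := (transverse_collections W).
Local Notation mB := (@mul_eB R W K phi).
Local Notation KW := {ffun W -> K^o}.
Hypothesis natK : forall n, (n%:R == 0 :> K) = (n == 0)%N.
Variable B : {set hyp W}.
Hypothesis tcB : B \in tc.
Local Notation G := (stab_group B).
Local Notation Ann := (ann phi B).
Local Notation cG := (@coset_part R W K B B).

(** The product [x s] of the group algebra. *)
Definition group_alg_mul (x s : KW) : KW := [ffun u => \sum_g s g * x (u * g^-1)%g].

Lemma coset_part_stab s g : cG s = s -> g \notin G -> s g = 0.
Proof. by move=> <-; rewrite inE ffunE => /negPf ->. Qed.

(** Elements of [Stab(B)] commute with [e_B], so [x s e_B = x e_B s = 0]. *)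
Lemma ann_eB_mulr x s : cG s = s -> x \in ann_eB phi B -> group_alg_mul x s \in ann_eB phi B.
Proof.
move=> sG; rewrite !mem_ann_eB => /eqP x0.
have -> : mB B (group_alg_mul x s) = \sum_g s g *: (mB B x * ww g).
  rewrite mul_eBE; under eq_bigr do rewrite ffunE scaler_suml.
  rewrite exchange_big; apply: eq_bigr => g _ /=.
  have [gG|/(coset_part_stab sG)->] := boolP (g \in G); last first.
    by rewrite scale0r big1 // => u _; rewrite mul0r scale0r.
  rewrite mul_eBE mulr_suml scaler_sumr (reindex_inj (mulIg g)).
  apply: eq_bigr => u _; rewrite mulgK -scalerAl scalerA -mulrA brauer_eB_w //.
  rewrite brauer_wM -mulrA; congr (_ *: (_ * (_ * EB _))).
  by have : g^-1%g \in G by [rewrite groupV]; rewrite inE => /eqP.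
by rewrite big1 // => g _; rewrite x0 mul0r scaler0.
Qed.

(** The sum is [r^-1] times the part of [x s] in the coset [r Stab(B)]. *)
Lemma ann_coset_sum r x s : cG s = s -> x \in ann_eB phi B ->
  \sum_(h in G) x (r * h)%g *: ltrans h s \in Ann.
Proof.
move=> sG xA.
have -> : \sum_(h in G) x (r * h)%g *: ltrans h s =
    ltrans r^-1%g (coset_part B (hact r @: B) (group_alg_mul x s)).
  apply/esym/ffunP => u; rewrite sum_ffunE !ffunE invgK hact_imsetM.
  rewrite (inj_eq (imset_inj (@hact_inj _ _ r))) [RHS]big_mkcond /=.
  have uE : (hact u @: B == B) = (u \in G) by rewrite inE.
  rewrite uE; have [uG|uG] := boolP (u \in G); last first.
    rewrite big1 // => h _; case: ifP => // hG; rewrite !ffunE.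
    by rewrite (coset_part_stab sG) ?scaler0 // groupMl ?groupV.
  rewrite (reindex_inj invg_inj) (reindex_inj (mulgI u^-1%g)) /=.
  apply: eq_bigr => h _; rewrite invMg invgK; case: ifPn => hG.
    by rewrite [(_ * u)^-1%g]invMg invgK -!mulgA mulKVg !ffunE [RHS]mulrC.
  by rewrite (coset_part_stab sG) ?mul0r // groupMr // groupV.
exact/ltrans_ann/coset_part_ann_eB/ann_eB_mulr.
Qed.

(** Coordinates for the image of [K Stab(B)] in [KW/Ann(B)], through a complement of the
    intersection with [Ann(B)]. *)
Lemma ann_compl_coordinates : exists n (sigma : {linear 'rV[K]_n -> KW}),
  [/\ forall r, cG (sigma r) = sigma r, forall r, sigma r \in Ann -> r = 0
    & forall x, cG x = x -> exists r, x - sigma r \in Ann].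
Proof.
have [|||X XP] := @pred_vspace K KW (fun x => cG x = x).
- by rewrite raddf0.
- by move=> u v uG vG; rewrite raddfD /= uG vG.
- by move=> c u uG; rewrite linearZ /= uG.
set U := (X :\: Ann)%VS; have [f fL [f' fK f'K]] := subvs_vect_iso U.
have f'L : linear f' by move=> c a b; apply: (can_inj fK); rewrite fL !f'K.
pose sig r : KW := vsval (f' r).
have sL : linear sig by move=> c a b; rewrite /sig f'L linearP.
have sU r : sig r \in U by exact: subvsP.
pose sl : {linear 'rV[K]_(\dim U) -> KW} := HB.pack sig (GRing.isLinear.Build _ _ _ _ _ sL).
exists (\dim U), sl; split=> [r|r rA|x xG].
- by apply/XP; apply: (subvP (diffvSl X Ann)); exact: sU.
- have : sig r \in (U :&: Ann)%VS by rewrite memv_cap sU.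
  rewrite capv_diff memv0 => /eqP r0; apply: (can_inj f'K); apply: val_inj.
  by rewrite /= -/(sig r) r0 -[RHS]/(sl 0) raddf0.
have : x \in (U + X :&: Ann)%VS by rewrite addv_diff_cap; apply/XP.
case/memv_addP=> z zU [z' /[!memv_cap] /andP[_ z'A] ->]; exists (f (Subvs zU)).
by rewrite /= /sig fK /= addrC addKr.
Qed.

Lemma coset_part_ltrans h s : h \in G -> cG s = s -> cG (ltrans h s) = ltrans h s.
Proof.
by rewrite inE => /eqP hB sG; rewrite -{2}sG ltrans_coset_part hB.
Qed.

Lemma dim_quot_ann_admissible : dim_quot_ann phi B != 0%N -> admissible phi B.
Proof.
move=> annN; have [n [sigma [sG s0 sS]]] := ann_compl_coordinates.
have exc x : exists r, cG x = x -> x - sigma r \in Ann.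
  by have [xG|] := eqVneq (cG x) x; [have [r] := sS x xG; exists r | exists 0; move/eqP: i].
have [c cP] := choice exc.
have cE x r : cG x = x -> x - sigma r \in Ann -> c x = r.
  move=> xG xr; apply/eqP; rewrite -subr_eq0; apply/eqP/s0; rewrite raddfB.
  have -> : sigma (c x) - sigma r = (x - sigma r) - (x - sigma (c x)).
    by rewrite opprB [RHS]addrC addrA subrK.
  by rewrite rpredB // cP.
pose M h : 'M[K]_n := \matrix_i c (ltrans h (sigma (delta_mx 0 i))).
have ME h r : h \in G -> ltrans h (sigma r) - sigma (r *m M h) \in Ann.
  move=> hG; rewrite mulmx_sum_row [in ltrans _ _](row_sum_delta r) !linear_sum -big_split /=.
  apply: rpred_sum => i _; rewrite !linearZ -scalerDr /=; apply: rpredZ.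
  by rewrite rowK; apply: cP; apply: coset_part_ltrans.
(* The coordinates are rows, while modules in the definition of admissibility are columns. *)
pose r h := (M h)^T.
have rP : mx_repr G r.
  split=> [|g h gG hG]; apply: trmx_inj; rewrite ?trmx_mul !trmxK.
    apply/row_matrixP => i; rewrite rowK trmx1 row1; apply: cE.
      by rewrite ltrans1 sG.
    by rewrite ltrans1 subrr rpred0.
  apply/row_matrixP => i; rewrite rowK row_mul rowK; apply: cE.
    by apply: coset_part_ltrans; rewrite ?groupM.
  rewrite ltransM -[_ - _](subrKA (ltrans g (sigma (c (ltrans h (sigma (delta_mx 0 i))))))).
  apply: rpredD; last exact: ME.
  by rewrite -raddfB; apply/ltrans_ann/cP/coset_part_ltrans.
exists n, (MxRepresentation rP); split.
  (* A zero module would put 1 in [Ann(B)], hence all of [KW]. *)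
  rewrite lt0n; apply: contra annN => /eqP n0; rewrite subn_eq0.
  apply/dimvS/subvP => x _.
  have d1 : ga_delta K 1%g \in Ann.
    have dG : cG (ga_delta K 1%g) = ga_delta K 1%g.
      apply/ffunP => g; rewrite !ffunE; case: eqP => // gB.
      by case: eqP => // g1; case: gB; rewrite g1 hact_imset1.
    have c0 : c (ga_delta K 1%g) = 0.
      by apply/rowP => -[i lti]; exfalso; rewrite n0 in lti.
    by have := cP _ dG; rewrite c0 raddf0 subr0.
  rewrite (sum_delta x); apply: rpred_sum => g _; apply: rpredZ.
  by rewrite -[g]mulg1 -ltrans_delta; exact: ltrans_ann.
move=> x v xA.
have key g : \sum_(h in G) x (g * h)%g *: (r h *m v) = 0.
  apply: trmx_inj; rewrite trmx0 linear_sum; apply: s0.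
  have -> : sigma (\sum_(h in G) (x (g * h)%g *: (r h *m v))^T) =
      \sum_(h in G) x (g * h)%g *: sigma (v^T *m M h).
    rewrite linear_sum; apply: eq_bigr => h _; rewrite [(_ *: _)^T]linearZ /= linearZ /=.
    by rewrite trmx_mul /r trmxK.
  set S := \sum_(h in G) _.
  have -> : S = \sum_(h in G) x (g * h)%g *: ltrans h (sigma v^T) -
      \sum_(h in G) x (g * h)%g *: (ltrans h (sigma v^T) - sigma (v^T *m M h)).
    by rewrite -sumrB; apply: eq_bigr => h _; rewrite scalerBr opprB addrC subrK.
  apply: rpredB; first exact: ann_coset_sum.
  by apply: rpred_sum => h hG; apply/rpredZ/ME.
set J := ind_rel _; pose z := group_alg_act x (pure_ind 1%g v).
have zE : z = \sum_g pure_ind g (x g *: v).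
  apply/ffunP => u; rewrite sum_ffunE ffunE; apply: eq_bigr => g _; rewrite !ffunE.
  by rewrite -eq_mulVg1 eq_sym; case: eqP => _; rewrite ?scaler0.
rewrite -/z; have G0 : (#|G|%:R : K) != 0 by rewrite natK -lt0n cardG_gt0.
have -> : z = #|G|%:R^-1 *: (#|G|%:R *: z) by rewrite scalerA mulVf ?scale1r.
(* Each [gh (x) x(gh) v] appears once for every [h] in the stabilizer, and for fixed [g] the
   subtracted terms [g (x) x(gh) hv] add up to zero by [key]; so a multiple of [z] is a sum of
   induction relations. *)
apply: rpredZ; have -> : #|G|%:R *: z = \sum_(g : W) \sum_(h in G)
    (pure_ind (g * h)%g (x (g * h)%g *: v) - pure_ind g (r h *m (x (g * h)%g *: v))).
  rewrite scaler_nat -sumr_const; under [RHS]eq_bigr do rewrite sumrB.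
  rewrite sumrB exchange_big /= [X in _ = _ - X]big1 ?subr0 => [|g _]; last first.
    apply/ffunP => u; rewrite sum_ffunE; under eq_bigr do rewrite ffunE.
    case: (u == g); last by rewrite big1 // ffunE.
    by under eq_bigr do rewrite -scalemxAr; rewrite key ffunE.
  apply: eq_bigr => h _; rewrite zE (reindex_inj (mulIg h)) //.
apply: rpred_sum => g _; apply: rpred_sum => h hG.
pose q (v' : 'cV[K]_n) : {ffun W -> 'cV[K]_n} :=
  pure_ind (g * h)%g v' - pure_ind g (r h *m v').
have qL : linear q.
  move=> a u u'; apply/ffunP => i; rewrite !ffunE mulmxDr -scalemxAr.
  by case: (i == _); case: (i == _);
    rewrite ?subr0 ?sub0r ?scaler0 ?addr0 // ?scalerBr ?scalerN ?opprD // addrACA.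
pose ql : {linear 'cV[K]_n -> {ffun W -> 'cV[K]_n}} :=
  HB.pack q (GRing.isLinear.Build _ _ _ _ _ qL).
have /subvP : (limg (linfun q) <= J)%VS by apply: (sumv_sup g) => //; exact: (sumv_sup h).
apply; rewrite -/(q _) -[q _](lfunE ql); exact: memv_img (memvf _).
Qed.

End Admissible.

Theorem theorem5p17 (R : realType) (W : complexReflectionGroup R)
    (K : fieldType) (phi : {rmorphism paramRing W -> K})
    (hK : proper_field phi) :
  split_semisimple (brauer_ext phi) /\
  has_dim (brauer_ext phi)
    (\sum_(B in transverse_collections W) dim_quot_ann phi B)%N /\
  (\sum_(B in transverse_collections W) dim_quot_ann phi B =
   \sum_(B in admissible_collections phi) dim_quot_ann phi B)%N.
Proof.
have [/pcharf0P natK [k [iota [mu_iota splitk del_tr _]]]] := hK.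
have ex_mk w : exists a, iota a = refl_coef phi w.
  have [wR|/refl_coef0->] := boolP (w \in reflections W); last by exists 0; exact: rmorph0.
  have [a mua] := mu_iota (exist _ w wR).
  by exists a; rewrite -mua -refl_coef_val.
have [mk mkE] := choice ex_mk.
have del0 : phi (delta W) != 0.
  by apply/eqP => d0; apply: del_tr; rewrite d0; exact: algebraic0.
have y_tr p : peval_at iota (phi (delta W))^-1 p = 0 -> p = 0.
  move=> p0; apply/eqP; apply: contraT => pN; case: del_tr.
  rewrite -[phi _]invrK; apply: algebraic_inv; exists p => //; exact/rootP.
have dimA := brauer_has_dim del0 y_tr mkE natK.
split; last split=> //.
  split; first exact: (brauer_split del0 mkE splitk).
  exact: (brauer_semisimple del0 y_tr mkE natK dimA).
(* A collection that is not admissible contributes dimension zero. *)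
rewrite (bigID (fun B => `[< admissible phi B >])) /= [X in (_ + X)%N]big1 ?addn0.
  by apply: eq_bigl => B; rewrite !inE.
move=> B /andP[tcB]; apply: contraNeq => annN; apply/asboolP.
exact: dim_quot_ann_admissible.
Qed.
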